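(* Let $\Omega\subset\mathbb{R}^n$ be a bounded domain and let $N\ge 1$ be an integer. Let $a:\Omega\to(0,+\infty)$ be continuous (and positive) on $\Omega$. Let $G:\mathcal{F}_w(\Omega)\to\mathbb{R}$ be bounded and continuous for the distance $\mathrm{dist}$, i.e. $\lim_{k\to+\infty}G(\mathbf{W}_k)=G(\mathbf{W})$ whenever $\mathbf{W}\in\mathcal{F}_w(\Omega)$ and $\{\mathbf{W}_k\}$ is a sequence in $\mathcal{F}_w(\Omega)$ with $\lim_{k\to+\infty}\mathrm{dist}(\mathbf{W}_k,\mathbf{W})=0$. Let $J_w=F_w+G$. Then there exists $\mathbf{W}_0\in\mathcal{F}_w(\Omega)$ such that $$J_w(\mathbf{W}_0)\le J_w(\mathbf{W})\quad\text{for all }\mathbf{W}\in\mathcal{F}_w(\Omega).$$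
   Context: Throughout, $|A|$ is Lebesgue measure on $\mathbb{R}^n$. A Borel set $W\subset\Omega$ has locally finite perimeter in $\Omega$ if the distributional gradient $\nabla\mathbf{1}_W$ of its characteristic function is a locally finite vector-valued measure on $\Omega$; its total variation measure is denoted $\mu_W=|D\mathbf{1}_W|$ (a measure on the open set $\Omega$; nothing on $\partial\Omega$ is counted). $\mathcal{F}_w=\mathcal{F}_w(\Omega)$ is the set of $N$-tuples $\mathbf{W}=(W_1,\dots,W_N)$ of Borel subsets of $\Omega$ of locally finite perimeter in $\Omega$ such that $\sum_{i=1}^N\mathbf{1}_{W_i}=\mathbf{1}_\Omega$ almost everywhere; two $N$-tuples are identified if their components agree up to Lebesgue-null sets (functionals on $\mathcal{F}_w$ are well defined modulo null sets). Some $W_i$ may be empty. The distance is $\mathrm{dist}(\mathbf{W},\mathbf{W}')=\sum_{i=1}^N|W_i\triangle W_i'|$, with $A\triangle B=(A\setminus B)\cup(B\setminus A)$. For $\mathbf{W}\in\mathcal{F}_w$, $F_w(\mathbf{W})=\sum_{i=1}^N\int_\Omega a(x)\,d\mu_{W_i}(x)\in[0,+\infty]$, and $J_w(\mathbf{W})=F_w(\mathbf{W})+G(\mathbf{W})$. *)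

(* Defs.v *)
From HB Require Import structures.
From mathcomp Require Import all_boot all_order all_algebra.
From mathcomp Require Import all_classical all_reals all_analysis.

Set Implicit Arguments.
Unset Strict Implicit.
Unset Printing Implicit Defensive.

Import Order.TTheory GRing.Theory Num.Theory.
Import numFieldNormedType.Exports.

Local Open Scope classical_set_scope.
Local Open Scope ring_scope.

(* 'M[R]_(m, n), hence R^n = 'rV[R]_n, carries its Borel sigma-algebra. *)
Fact matrix_display : measure_display.
Proof. exact: default_measure_display. Qed.

Section borel.
Context (R : realType) (m n : nat).

HB.instance Definition _ := @isMeasurable.Build matrix_display 'M[R]_(m, n)
  <<s @open 'M[R]_(m, n) >> (@sigma_algebra0 _ _ _)
  (@sigma_algebraC _ _) (@sigma_algebra_bigcup _ _ _).

End borel.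

Section lebesgue_rV.
Context {R : realType}.

Lemma measurable_rV_coord n (i : 'I_n) :
  measurable_fun [set: 'rV[R]_n] (fun x : 'rV[R]_n => x ord0 i).
Proof.
apply: (measurability _ (measurable_realfun.RGenOpens.measurableE R)).
move=> _ [_ [a [b ->] <-]]; rewrite setTI; apply: sub_sigma_algebra.
by apply: open_comp; [move=> x _; exact: coord_continuous|exact: interval_open].
Qed.

Lemma measurable_rV d (T : measurableType d) n (f : T -> 'rV[R]_n) :
  (forall i, measurable_fun [set: T] (fun t => f t ord0 i)) ->
  measurable_fun [set: T] f.
Proof.
move=> mf; apply: (measurability (@open 'rV[R]_n)) => //.
move=> _ [U oU <-]; rewrite setTI.
pose box (q : {ffun 'I_n -> rat * rat}) : set 'rV[R]_n :=
  [set x | forall i, x ord0 i \in `]ratr (q i).1, ratr (q i).2[%R].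
have -> : U = \bigcup_q (if `[< box q `<=` U >] then box q else set0).
  apply/seteqP; split => [x Ux|x [q _]]; last by case: asboolP => // bU /bU.
  have /nbhs_ballP[e /= e0 xeU] : nbhs x U by exact: open_nbhs_nbhs.
  have qP i : {q : rat * rat | (x ord0 i - e < ratr q.1 < x ord0 i) /\
                                (x ord0 i < ratr q.2 < x ord0 i + e)}.
    apply: cid; have [|p pe] := @rat_in_itvoo R (x ord0 i - e) (x ord0 i).
      by rewrite ltrBlDr ltrDl.
    have [|q qe] := @rat_in_itvoo R (x ord0 i) (x ord0 i + e).
      by rewrite ltrDl.
    by exists (p, q); rewrite !in_itv/= in pe qe.
  pose q := [ffun i => sval (qP i)].
  exists q => //; case: asboolP => [_ i|[]].
    rewrite ffunE; case: (svalP (qP i)) => /=.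
    by rewrite in_itv/= => /andP[_ ->] /andP[-> _].
  move=> y qy; apply: xeU; split => // i j; rewrite ord1.
  have := qy j; rewrite ffunE; case: (svalP (qP j)).
  rewrite /ball/= !in_itv/= => /andP[a b] /andP[c d'] /andP[a' b'].
  rewrite ltr_norml; apply/andP; split.
    by rewrite ltrBrDr addrC ltrBlDr (lt_trans b')// .
  by rewrite ltrBlDr -ltrBlDl (lt_trans a).
rewrite preimage_bigcup; apply: countable_bigcupT_measurable => // q.
case: ifPn => _; last by rewrite preimage_set0.
rewrite [X in measurable X](_ : _ = \bigcap_(i in [set: 'I_n])
    ((fun t => f t ord0 i) @^-1` `]ratr (q i).1, ratr (q i).2[)).
  apply: fin_bigcap_measurable => // i _; rewrite -[X in measurable X]setTI.
  by apply: mf => //; exact: measurable_itv.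
by apply/seteqP; split => [t h i _|t h i]; [exact: h|exact: h].
Qed.

Definition rV_cons n (p : R * 'rV[R]_n) : 'rV[R]_n.+1 := row_mx p.1%:M p.2.

Lemma measurable_rV_cons n : measurable_fun setT (@rV_cons n).
Proof.
apply: measurable_rV => i.
case: (@split_ordP 1 n i) => j ->{i}.
- rewrite [X in measurable_fun _ X](_ : _ = fst)//.
  apply/funext => p; apply: etrans (row_mxEl _ _ _ _) _.
  by rewrite [j]ord1 mxE eqxx.
- rewrite [X in measurable_fun _ X](_ : _ = (fun x : 'rV_n => x ord0 j) \o snd).
    by apply: measurableT_comp => //; exact: measurable_rV_coord.
  by apply/funext => p; exact: row_mxEr.
Qed.

Section step.
Context n (mu : {sigma_finite_measure set 'rV[R]_n -> \bar R}).

Definition lebesgue_cons : set 'rV[R]_n.+1 -> \bar R :=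
  pushforward (@lebesgue_measure R \x mu)%E (@rV_cons n).

Let mcons := @measurable_rV_cons n.

Let lebesgue_cons0 : lebesgue_cons set0 = 0%E.
Proof. by rewrite /lebesgue_cons /pushforward preimage_set0 measure0. Qed.

Let lebesgue_cons_ge0 A : (0 <= lebesgue_cons A)%E.
Proof. by rewrite /lebesgue_cons /pushforward measure_ge0. Qed.

Let lebesgue_cons_sigma_additive : semi_sigma_additive lebesgue_cons.
Proof.
move=> F mF tF mUF; rewrite /lebesgue_cons /pushforward preimage_bigcup.
apply: measure_semi_sigma_additive.
- by move=> k; rewrite -[X in measurable X]setTI; exact: mcons.
- apply/trivIsetP => /= i j _ _ ij; rewrite -preimage_setI.
  by move/trivIsetP : tF => /(_ _ _ _ _ ij) ->//; rewrite preimage_set0.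
- by rewrite -preimage_bigcup -[X in measurable X]setTI; exact: mcons.
Qed.

HB.instance Definition _ := isMeasure.Build _ _ _ lebesgue_cons
  lebesgue_cons0 lebesgue_cons_ge0 lebesgue_cons_sigma_additive.

Let lebesgue_cons_sigma_finite : sigma_finite setT lebesgue_cons.
Proof.
have /sigma_finiteP[F [TF ndF Foo]] := sigma_finiteT (@lebesgue_measure R).
have /sigma_finiteP[G [TG ndG Goo]] := sigma_finiteT mu.
pose g (x : 'rV[R]_n.+1) := (x ord0 ord0, rsubmx (x : 'rV[R]_(1 + n))).
have mg : measurable_fun setT g.
  apply: measurable_fun_pair; first exact: measurable_rV_coord.
  apply: measurable_rV => i.
  rewrite [X in measurable_fun _ X](_ : _ =
    fun x : 'rV[R]_(1 + n) => x ord0 (rshift 1 i)).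
    exact: measurable_rV_coord.
  by apply/funext => x; rewrite mxE.
have gK p : g (rV_cons p) = p.
  case: p => t y; rewrite /g /rV_cons row_mxKr; congr (_, _) => /=.
  rewrite (_ : ord0 = lshift n (ord0 : 'I_1)); last exact: val_inj.
  by apply: etrans (row_mxEl _ _ _ _) _; rewrite mxE eqxx.
exists (fun k => g @^-1` (F k `*` G k)).
  apply/seteqP; split => // x _.
  have [j _ Fj] : (\bigcup_k F k) (g x).1 by rewrite -TF.
  have [k _ Gk] : (\bigcup_k G k) (g x).2 by rewrite -TG.
  exists (maxn j k) => //; split.
  - by move: Fj; apply/subsetPset/ndF/leq_maxl.
  - by move: Gk; apply/subsetPset/ndG/leq_maxr.
move=> k; have [mF Fk] := Foo k; have [mG Gk] := Goo k; split.
  by rewrite -[X in measurable X]setTI; apply: mg => //; exact: measurableX.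
rewrite /lebesgue_cons /pushforward -comp_preimage.
rewrite (_ : g \o _ = id); last by apply/funext => p; exact: gK.
by rewrite preimage_id product_measure1E// lte_mul_pinfty// ge0_fin_numE.
Qed.

HB.instance Definition _ := Measure_isSigmaFinite.Build _ _ _ lebesgue_cons
  lebesgue_cons_sigma_finite.

End step.

Fixpoint lebesgue_rV n : {sigma_finite_measure set 'rV[R]_n -> \bar R} :=
  match n with
  | 0 => dirac (0 : 'rV[R]_0)
  | k.+1 => lebesgue_cons (lebesgue_rV k)
  end.
End lebesgue_rV.

Lemma lebesgue_rV_box {R : realType} n (a b : 'I_n -> R) :
  (forall i, a i <= b i) ->
  lebesgue_rV n [set x : 'rV[R]_n | forall i, x ord0 i \in `[a i, b i]]
    = (\prod_i (b i - a i))%:E.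
Proof.
elim: n a b => [|n IH] a b ab.
  rewrite big_ord0 /= diracE mem_set//= => i; by case: i.
rewrite big_ord_recl /= /lebesgue_cons /pushforward.
rewrite (_ : _ @^-1` _ = `[a ord0, b ord0]%classic `*`
    [set y : 'rV[R]_n | forall i, y ord0 i \in
      `[a (lift ord0 i), b (lift ord0 i)]]).
  rewrite product_measure1E//; last first.
    rewrite [X in measurable X](_ : _ = \bigcap_(i in [set: 'I_n])
      ((fun x : 'rV[R]_n => x ord0 i) @^-1`
        `[a (lift ord0 i), b (lift ord0 i)])).
      apply: fin_bigcap_measurable => // i _; rewrite -[X in measurable X]setTI.
      by apply: measurable_rV_coord => //; exact: measurable_itv.
    by apply/seteqP; split => [x h i _|x h i]; exact: h.
  rewrite IH; last by move=> i; exact: ab.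
  rewrite EFinM; congr (_ * _)%E.
  apply: etrans (lebesgue_measure_itv _) _; rewrite /= lte_fin.
  by have := ab ord0; rewrite le_eqVlt => /orP[/eqP->|->//]; rewrite ltxx subrr.
have e0 (p : R * 'rV[R]_n) : rV_cons p ord0 ord0 = p.1.
  rewrite (_ : ord0 = lshift n (ord0 : 'I_1)); last exact: val_inj.
  by apply: etrans (row_mxEl _ _ _ _) _; rewrite mxE eqxx.
have e1 (p : R * 'rV[R]_n) i : rV_cons p ord0 (lift ord0 i) = p.2 ord0 i.
  rewrite (_ : lift ord0 i = rshift 1 i); last exact: val_inj.
  exact: row_mxEr.
apply/seteqP; split => [p h|p [h0 h1] i].
  split => [|i]; first by have := h ord0; rewrite e0.
  by have := h (lift ord0 i); rewrite e1.
by case: (unliftP ord0 i) => [j|] ->; [rewrite e1; exact: h1|rewrite e0].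
Qed.

Section perimeter.
Context {R : realType} {n : nat}.
Implicit Types (Omega W E K : set 'rV[R]_n) (phi : 'rV[R]_n -> R).
Implicit Types lam : set 'rV[R]_n -> 'rV[R]_n.

(* The library norm on 'rV[R]_n is the sup norm. *)
Definition enorm (v : 'rV[R]_n) : R := Num.sqrt (\sum_i v ord0 i ^+ 2).

Definition relatively_compact Omega E :=
  exists K, [/\ compact K, K `<=` Omega & E `<=` K].

(* A locally finite R^n-valued measure on the open set Omega is a set function
   defined on the Borel sets that are relatively compact in Omega and countably
   additive inside each compact subset; its other values are meaningless and
   never used. *)
Definition locally_finite_vmeasure Omega lam :=
  forall K, compact K -> K `<=` Omega ->
  forall F : nat -> set 'rV[R]_n,
    (forall k, measurable (F k)) -> (forall k, F k `<=` K) ->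
    trivIset [set: nat] F ->
    (fun m => \sum_(k < m) lam (F k)) @ \oo --> lam (\bigcup_k F k).

Definition total_variation Omega lam E : \bar R :=
  ereal_sup [set s | exists m (F : 'I_m -> set 'rV[R]_n),
    [/\ forall k, [/\ measurable (F k), relatively_compact Omega (F k) &
                      F k `<=` E],
        trivIset [set: 'I_m] F &
        s = (\sum_(k < m) enorm (lam (F k)))%:E]].

(* Positive part of the Jordan decomposition of a locally finite signed
   measure; the negative part of nu is the positive part of - nu. *)
Definition pos_variation Omega (nu : set 'rV[R]_n -> R) E : \bar R :=
  ereal_sup [set (nu B)%:E | B in
    [set B | [/\ measurable B, relatively_compact Omega B & B `<=` E]]].

Definition signed_integral Omega (nu : set 'rV[R]_n -> R) phi : \bar R :=
  (\int[pos_variation Omega nu]_(x in Omega) (phi x)%:E -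
   \int[pos_variation Omega (fun B => - nu B)%R]_(x in Omega) (phi x)%:E)%E.

Definition partial (i : 'I_n) phi : 'rV[R]_n -> R :=
  fun x => 'D_(delta_mx ord0 i) phi x.

Definition smooth phi :=
  forall s : seq 'I_n, let psi := foldr partial phi s in
    continuous psi /\ forall x i, derivable psi x (delta_mx ord0 i).

Definition test_function Omega phi :=
  let supp := closure [set x | phi x != 0] in
  [/\ smooth phi, compact supp & supp `<=` Omega].

Definition is_gradient_measure Omega W lam :=
  locally_finite_vmeasure Omega lam /\
  forall phi, test_function Omega phi -> forall i : 'I_n,
    signed_integral Omega (fun B => lam B ord0 i) phi =
      (- \int[lebesgue_rV n]_(x in W) (partial i phi x)%:E)%E.

Definition locally_finite_perimeter Omega W :=
  exists lam, is_gradient_measure Omega W lam.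

(* The gradient measure is unique on the Borel sets that are relatively compact
   in Omega, so the total variation below does not depend on the choice. *)
Definition gradient_measure Omega W : set 'rV[R]_n -> 'rV[R]_n :=
  xget (fun=> 0) [set lam | is_gradient_measure Omega W lam].

Definition perimeter_measure Omega W : set 'rV[R]_n -> \bar R :=
  total_variation Omega (gradient_measure Omega W).

End perimeter.

Section functional.
Context {R : realType} {n N : nat}.
Implicit Types (Omega : set 'rV[R]_n) (W : 'I_N -> set 'rV[R]_n).

(* Tuples are not quotiented by null sets: two tuples are identified exactly
   when dist_w is zero, and a functional continuous for dist_w cannot separate
   them. *)
Definition F_class Omega : set ('I_N -> set 'rV[R]_n) :=
  [set W | (forall i, [/\ measurable (W i), W i `<=` Omega &
                          locally_finite_perimeter Omega (W i)]) /\
           {ae lebesgue_rV n, forall x,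
              \sum_i \1_(W i) x = \1_Omega x :> R}].

Definition dist_w W W' : \bar R :=
  (\sum_i lebesgue_rV n (W i `+` W' i))%E.

Definition F_w Omega (a : 'rV[R]_n -> R) W : \bar R :=
  (\sum_i \int[perimeter_measure Omega (W i)]_(x in Omega) (a x)%:E)%E.

Definition J_w Omega (a : 'rV[R]_n -> R) (G : ('I_N -> set 'rV[R]_n) -> R) W
    : \bar R :=
  (F_w Omega a W + (G W)%:E)%E.

End functional.

(* Main.v *)
(* Direct method.  Since [a] is bounded below by a positive constant on every
   compact subset of [Omega], the perimeter measures of a minimising sequence are
   bounded on compact sets.

   Compactness.  The flux of [1_W] through coordinate segments is controlled by
   the perimeter, whence a relative isoperimetric inequality on small cubes: up
   to a small measure, a set of the sequence is determined by the finitely many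
   cubes of a fine grid of which it occupies at least half.  So the sequence is
   totally bounded for [dist_w], and a fast Cauchy subsequence converges to its
   upper limit set.

   The limit has locally finite perimeter: the Jordan parts of the gradient
   measures converge, along an ultrafilter and on compact sets, to a content;
   the Riesz construction turns it into a Borel measure that integrates test
   functions to the limit of their integrals.

   Lower semicontinuity.  On open sets, test the gradient measure of the limit
   against smooth cutoffs with disjoint supports; the weight [a] is then a
   superposition of indicators of its superlevel sets, which are open. *)
Require Import Defs.
From HB Require Import structures.
From mathcomp Require Import all_boot all_order all_algebra.
From mathcomp Require Import all_classical all_reals all_analysis.
From mathcomp Require Import measurable_realfun ring lra.
Import Order.TTheory GRing.Theory Num.Theory.
Import numFieldNormedType.Exports.
Local Open Scope classical_set_scope.
Local Open Scope ring_scope.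

Set Implicit Arguments.
Unset Strict Implicit.
Unset Printing Implicit Defensive.

(** The weight may tend to 0 at the boundary, so perimeters are controlled on compact subsets of
    [Omega] only and every estimate has to be local. Boundedness of [Omega] supplies the missing
    control: a large compact subset leaves out only a small volume. Locality also shapes the
    integrals. The variations are suprema over relatively compact sets, so each integral of a test
    function is first moved to a genuine measure on its compact support, obtained there from a Hahn
    decomposition. The isoperimetric inequality is a Fubini argument: in a cube, the product of the
    volumes of W and of its complement is the integral over h of the volume of the points that leave
    W under translation by h. The limit content and the measure built from it may differ on compact
    sets, since mass can reach a compact set from outside in the limit. Integrals of continuous
    functions still agree, because passing from one superlevel set to the next absorbs the
    difference. *)

(** * Thickenings of compact sets *)

Section rV_topology.
Context {R : realType} {n : nat}.
Implicit Types (K U A B : set 'rV[R]_n) (x y : 'rV[R]_n) (e : R).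

Lemma rV_norm_coord x i : `|x ord0 i| <= `|x|.
Proof.
by rewrite [leRHS]mx_normrE; exact: (le_bigmax _ (fun p => `|x p.1 p.2|) (ord0, i)).
Qed.

Lemma rV_norm_le x e : 0 <= e -> (forall i, `|x ord0 i| <= e) -> `|x| <= e.
Proof.
by move=> e0 xe; rewrite [leLHS]mx_normrE; apply/bigmax_leP; split => // -[i j] _; rewrite ord1.
Qed.

Lemma rV_norm_lt x e : 0 < e -> (forall i, `|x ord0 i| < e) -> `|x| < e.
Proof.
by move=> e0 xe; rewrite [ltLHS]mx_normrE; apply/bigmax_ltP; split => // -[i j] _; rewrite ord1.
Qed.

Lemma rV_ballE x e : ball x e = [set y | `|x - y| < e].
Proof. by rewrite mx_norm_ball. Qed.

Lemma compact_rV_closed K : compact K -> closed K.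
Proof. by apply: compact_closed; exact: norm_hausdorff. Qed.

Lemma subclosed_compact_rV K A : closed A -> compact K -> A `<=` K -> compact A.
Proof. by move=> cA cK AK; exact: subclosed_compact cA cK AK. Qed.

Lemma closed_norm_le (e : R) : closed [set y : 'rV[R]_n | `|y| <= e].
Proof.
rewrite (_ : mkset _ = (fun y : 'rV[R]_n => `|y|) @^-1` [set t | t <= e])//.
by apply: closed_comp => [? _|]; [exact: norm_continuous|exact: closed_le].
Qed.

Lemma compact_norm_le (e : R) : compact [set y : 'rV[R]_n | `|y| <= e].
Proof.
apply: bounded_closed_compact; last exact: closed_norm_le.
by exists e; split; [exact: num_real|move=> r er y /= /le_trans; apply; exact: ltW].
Qed.

Definition thicken K e := [set x + y | x in K & y in [set y : 'rV[R]_n | `|y| <= e]].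

Lemma thickenP K e y : thicken K e y <-> exists2 x, K x & `|x - y| <= e.
Proof.
split=> [[x Kx [z /= ze <-]]|[x Kx xye]].
  by exists x => //; rewrite opprD addrA subrr sub0r normrN.
by exists x => //; exists (y - x); rewrite /= ?(distrC y)// addrC subrK.
Qed.

Lemma compact_thicken K e : compact K -> compact (thicken K e).
Proof.
move=> cK.
rewrite (_ : thicken K e = (fun p => p.1 + p.2) @`
    (K `*` [set y : 'rV[R]_n | `|y| <= e])); last first.
  apply/seteqP; split => [y [x Kx [z ze <-]]|y [[x z] /= [Kx ze] <-]].
    by exists (x, z).
  by exists x => //; exists z.
apply: continuous_compact; last by apply: compact_setX => //; exact: compact_norm_le.
by apply: continuous_subspaceT => p; exact: add_continuous.
Qed.

Definition thicken_open K e := \bigcup_(x in K) [set y | `|x - y| < e].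

Lemma open_thicken_open K e : open (thicken_open K e).
Proof.
apply: bigcup_open => x _; rewrite openE => y /= xy.
apply/nbhs_ballP; exists (e - `|x - y|) => /=; first by rewrite subr_gt0.
move=> z; rewrite rV_ballE /= ltrBrDl => yz; apply: le_lt_trans yz.
by rewrite (le_trans _ (ler_normD _ _))// addrA subrK.
Qed.

Lemma thicken_open_sub K e : thicken_open K e `<=` thicken K e.
Proof. by move=> y [x Kx /= xy]; apply/thickenP; exists x => //; exact: ltW. Qed.

Lemma sub_thicken_open K e : 0 < e -> K `<=` thicken_open K e.
Proof. by move=> e0 x Kx; exists x => //=; rewrite subrr normr0. Qed.

(** Around each point of [K] a ball of radius r lies in [U], so radius r / 2 works for all points of
    the half ball; the near-covering form of compactness then makes the radius uniform. *)
Lemma compact_sub_open_thicken K U : compact K -> open U -> K `<=` U ->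
  exists2 e, 0 < e & thicken K e `<=` U.
Proof.
move=> /compact_near_coveringP cK oU KU.
have := cK _ (0 : R)^'+ (fun e x => forall y, `|x - y| <= e -> U y) _.
case=> [x Kx|e e0 He].
  have /nbhs_ballP[r /= r0 xrU] : nbhs x U by apply: open_nbhs_nbhs; split => //; exact: KU.
  exists (ball x (r / 2), [set e | e < r / 2]) => /=.
    split; first by apply: nbhsx_ballx; rewrite divr_gt0.
    by apply: nbhs_right_lt; rewrite divr_gt0.
  move=> [x' e]; rewrite rV_ballE /= => -[xx' er] y xy; apply: xrU.
  rewrite rV_ballE /= (splitr r) (le_lt_trans (ler_distD x' _ _))//.
  by rewrite ltrD// (le_lt_trans xy).
exists (e / 2); first by rewrite divr_gt0.
move=> y /thickenP[x Kx xy]; apply: (He (e / 2) _ _ x) => //=; last by rewrite divr_gt0.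
by rewrite sub0r normrN gtr0_norm ?divr_gt0// ltr_pdivrMr// ltr_pMr// ltr1n.
Qed.

Lemma compact_sub_open_nbhs K U : compact K -> open U -> K `<=` U ->
  exists V, [/\ open V, K `<=` V, compact (closure V) & closure V `<=` U].
Proof.
move=> cK oU KU; have [e e0 eU] := compact_sub_open_thicken cK oU KU.
exists (thicken_open K e).
have clV : closure (thicken_open K e) `<=` thicken K e.
  rewrite [X in _ `<=` X](iffLR (closure_id _)).
    exact: closure_subset (@thicken_open_sub _ _).
  by apply: compact_rV_closed; exact: compact_thicken.
split; [exact: open_thicken_open|exact: sub_thicken_open| |exact: subset_trans eU].
apply: subclosed_compact clV; [exact: closed_closure|exact: compact_thicken].
Qed.

(** If thickenings of radius e / 2 of two of the sets met, these two sets would come within e of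
    each other. Hence half of the smallest pairwise separation suffices. *)
Lemma disjoint_compacts_thicken m (K : 'I_m -> set 'rV[R]_n) :
  (forall j, compact (K j)) -> trivIset setT K ->
  exists2 e, 0 < e & trivIset setT (fun j => thicken_open (K j) e).
Proof.
move=> cK tK.
have key (i j : 'I_m) : exists2 e, 0 < e & i != j ->
    thicken (K i) e `<=` ~` K j.
  have [->|ij] := eqVneq i j; first by exists 1.
  have [||e e0 He] := @compact_sub_open_thicken (K i) (~` K j) (cK i).
  - by rewrite openC; exact: compact_rV_closed.
  - by move=> x Kix Kjx; have /eqP := ij; apply; apply: tK => //; exists x.
  - by exists e.
pose f (p : 'I_m * 'I_m) := s2val (cid2 (key p.1 p.2)).
(* The neutral value 1 keeps the radius positive when there are no pairs. *)
exists ((\big[Num.min/1]_p f p) / 2).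
  rewrite divr_gt0//; apply: lt_bigmin => // p _.
  exact: (s2valP (cid2 (key p.1 p.2))).
move=> i j _ _ [x [[a Kia /= ax] [b Kjb /= bx]]]; apply/eqP/negPn/negP => ij.
apply: (s2valP' (cid2 (key i j)) ij b) => //; rewrite -[s2val _]/(f (i, j)).
apply/thickenP; exists a => //.
rewrite (le_trans (ler_distD x _ _))// distrC (distrC x).
apply: le_trans (_ : \big[Num.min/1]_p f p <= _); last exact: bigmin_le.
by rewrite (splitr (\big[_/_]_p _)) lerD// ltW// distrC.
Qed.

End rV_topology.

(** * Smooth functions of one real variable *)

Section smooth_line.
Context {R : realType}.
Implicit Types (f g : R -> R).

(** The derivative is carried as a witness, so that closure under sums, products, inverses and
    affine substitutions is a plain induction on the order. *)
Fixpoint Ck k g := match k with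
  | 0 => continuous g
  | k.+1 => exists2 g' : R -> R, (forall x, is_derive x (1 : R) g (g' x)) & Ck k g'
  end.

Definition smooth1 g := forall k, Ck k g.

Lemma CkS k g : Ck k.+1 g -> Ck k g.
Proof.
elim: k g => [g [g' gg' _] x|k IH g [g' gg' g'k]]; last by exists g' => //; exact: IH.
by apply/differentiable_continuous/derivable1_diffP; have [] := gg' x.
Qed.

Lemma Ck_cst k (c : R) : Ck k (cst c).
Proof.
elim: k c => [c|k IH c]; first exact: cst_continuous.
by exists (cst 0); [move=> x; exact: is_derive_cst|exact: IH].
Qed.

Lemma CkD k f g : Ck k f -> Ck k g -> Ck k (f + g).
Proof.
elim: k f g => [f g cf cg x|k IH f g [f' ff' f'k] [g' gg' g'k]].
  by apply: continuousD; [exact: cf|exact: cg].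
by exists (f' + g'); [move=> x; exact: is_deriveD|exact: IH].
Qed.

Lemma CkM k f g : Ck k f -> Ck k g -> Ck k (f * g).
Proof.
elim: k f g => [f g cf cg x|k IH f g fk gk].
  by apply: continuousM; [exact: cf|exact: cg].
have [f' ff' f'k] := fk; have [g' gg' g'k] := gk.
exists (f * g' + g * f'); first by move=> x; apply: is_deriveM.
by apply: CkD; apply: IH => //; exact: CkS.
Qed.

Lemma CkV k f : (forall x, f x != 0) -> Ck k f -> Ck k (fun x => (f x)^-1).
Proof.
move=> f0; elim: k => [cf x|k IH fk]; first by apply: cvgV; [exact: f0|exact: cf].
have [f' ff' f'k] := fk.
exists ((cst (-1) * ((fun x => (f x)^-1) * (fun x => (f x)^-1))) * f').
  move=> x; have [df dfE] := ff' x.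
  apply: DeriveDef; first exact: derivableV.
  rewrite deriveV// dfE /= !fctE.
  by rewrite -[_ *: f' x]/(_ * _) expr2 invfM mulN1r.
apply: CkM => //; have fVk := IH (CkS fk).
by apply: CkM; [exact: Ck_cst|exact: CkM].
Qed.

Lemma Ck_affine k f (a b : R) : Ck k f -> Ck k (fun x => f (a * x + b)).
Proof.
have daff x : is_derive x (1 : R) (fun y => a * y + b) a.
  rewrite (_ : (fun y => a * y + b) = (a *: id) + cst b)//.
  by apply: is_derive_eq; rewrite addr0 -[_ *: _]/(_ * _) mulr1.
elim: k f => [f cf x|k IH f [f' ff' f'k]].
  apply: continuous_comp; last exact: cf.
  by apply/differentiable_continuous/derivable1_diffP; have [] := daff x.
exists (cst a * (fun x => f' (a * x + b))); last by apply: CkM; [exact: Ck_cst|exact: IH].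
move=> x; have := @is_derive1_comp _ f (fun y => a * y + b) x _ _ (ff' (a * x + b)) (daff x).
by rewrite mulrC.
Qed.

Lemma smooth1_derive f : smooth1 f ->
  smooth1 ('D_(1 : R) f) /\ forall x, is_derive x (1 : R) f ('D_1 f x).
Proof.
move=> fs; split=> [k|x]; last first.
  by have [f' /(_ x)[df _] _] := fs 1%N; exact: DeriveDef.
have [f' ff' f'k] := fs k.+1.
by rewrite (_ : 'D_1 f = f')//; apply/funext => x; have [] := ff' x.
Qed.

(** This is the classical flat function exp(-1/t) multiplied by powers of 1/t. The powers are
    included so that the family is closed under differentiation and smoothness becomes an
    induction. *)
Definition flat_exp (m : nat) (t : R) : R :=
  if 0 < t then t^-1 ^+ m * expR (- t^-1) else 0.

Lemma flat_exp_ge0 m t : 0 <= flat_exp m t.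
Proof.
by rewrite /flat_exp; case: ifPn => // t0; rewrite mulr_ge0 ?expR_ge0// exprn_ge0// invr_ge0 ltW.
Qed.

(** With u = 1/t, the bound u^(m+1) / (m+1)! <= exp u gives u^m exp(-u) <= (m+1)! / u. It provides
    continuity and differentiability at 0. *)
Lemma flat_exp_le m t : `|flat_exp m t| <= m.+1`!%:R * `|t|.
Proof.
rewrite ger0_norm ?flat_exp_ge0// /flat_exp; case: ifPn => [t0|_]; last first.
  by rewrite mulr_ge0.
rewrite (gtr0_norm t0) expRN ler_pdivrMr ?expR_gt0//.
have t'0 : 0 <= t^-1 by rewrite invr_ge0 ltW.
have H : t^-1 ^+ m.+1 <= m.+1`!%:R * expR t^-1.
  rewrite mulrC -ler_pdivrMr ?ltr0n ?fact_gt0//.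
  by apply: le_trans (expR_ge1Dxn m t'0); rewrite lerDr.
rewrite mulrAC -ler_pdivrMr// mulrC -exprS.
exact: H.
Qed.

Lemma flat_exp_derive m t :
  is_derive t (1 : R) (flat_exp m) (- m%:R * flat_exp m.+1 t + flat_exp m.+2 t).
Proof.
have [t0|t0|->] := ltgtP t 0.
- rewrite /flat_exp !ltNge (ltW t0) /= mulr0 addr0.
  apply: near_eq_is_derive (is_derive_cst 0 t 1).
  near=> s; have : s < 0 by near: s; exact: lt_nbhsl.
  by move=> /ltW s0; rewrite ltNge s0.
- pose h (s : R) := s^-1.
  have dh : is_derive t (1 : R) h (- t ^- 2).
    apply: DeriveDef; first by apply: derivableV; [exact: lt0r_neq0|exact: derivable_id].
    rewrite (@deriveV _ _ id)//; first by rewrite derive_id -[_ *: _]/(_ * _) mulr1.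
    exact: lt0r_neq0.
  have dE : is_derive t (1 : R) (expR \o - h) (t ^- 2 * expR (- t^-1)).
    have dNh : is_derive t (1 : R) (- h) (t ^- 2).
      by apply: is_derive_eq; rewrite opprK.
    have := @is_derive1_comp _ expR (- h) t _ _ (is_derive_expR (- t^-1)) dNh.
    by rewrite mulrC.
  have := is_deriveM (is_deriveX m dh) dE.
  rewrite [X in is_derive _ _ _ X](_ : _ = - m%:R * flat_exp m.+1 t + flat_exp m.+2 t).
    apply: near_eq_is_derive; near=> s.
    have s0 : 0 < s by near: s; exact: lt_nbhsr.
    by rewrite /flat_exp s0 !fctE.
  rewrite /flat_exp t0 !fctE; rewrite /h /= -!exprVn.
  rewrite -![_ *: _]/(_ * _).
  case: m => [|m]; first by rewrite oppr0 !mul0r !mulr0 addr0 add0r expr0 mul1r.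
  rewrite !exprS /= expr0; set u := t^-1; set e := expR _.
  by rewrite !mulr1; set k := m.+1%:R; lra.
- have f0 k : flat_exp k 0 = 0 by rewrite /flat_exp ltxx.
  rewrite !f0 mulr0 addr0.
  (* At 0 the difference quotient is, up to the sign of h, the next member of the family, which is
     O(h). *)
  have lim0 : h^-1 *: ((flat_exp m \o shift 0) (h *: 1) - flat_exp m 0) @[h --> 0^'] --> 0.
    apply/cvgr0Pnorm_lt => e e0; near=> h.

    rewrite f0 subr0 /= addr0 [h *: 1]mulr1 normrM.
    apply: (@le_lt_trans _ _ (m.+2`!%:R * `|h|)).
      apply: le_trans (flat_exp_le m.+1 h).
      rewrite /flat_exp; case: ifPn => _; last by rewrite !normr0 mulr0.
      by rewrite exprS -[in leRHS]mulrA [in leRHS]normrM.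
    rewrite -ltr_pdivlMl ?ltr0n ?fact_gt0//.
    near: h; apply: dnbhs0_lt.
    by rewrite mulr_gt0// invr_gt0 ltr0n fact_gt0.
  by apply: DeriveDef; [apply/cvg_ex; exists 0|exact: cvg_lim lim0].
Unshelve. all: by end_near. Qed.

Lemma Ck_flat_exp k m : Ck k (flat_exp m).
Proof.
elim: k m => [m x|k IH m].
  apply/differentiable_continuous/derivable1_diffP.
  by have [] := flat_exp_derive m x.
exists (cst (- m%:R) * flat_exp m.+1 + flat_exp m.+2); first exact: flat_exp_derive.
by apply: CkD => //; apply: CkM => //; exact: Ck_cst.
Qed.

Lemma flat_exp_gt0 m t : 0 < t -> 0 < flat_exp m t.
Proof. by move=> t0; rewrite /flat_exp t0 mulr_gt0 ?expR_gt0// exprn_gt0// invr_gt0. Qed.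

Lemma flat_exp_eq0 m t : t <= 0 -> flat_exp m t = 0.
Proof. by rewrite leNgt /flat_exp => /negbTE ->. Qed.

(** The denominator never vanishes because t and 1 - t are not both nonpositive; the quotient is 0
    for t <= 0 and 1 for t >= 1. *)
Definition smooth_step (t : R) := flat_exp 0 t / (flat_exp 0 t + flat_exp 0 (1 - t)).

Lemma smooth_step_den t : 0 < flat_exp 0 t + flat_exp 0 (1 - t).
Proof.
have [t0|t0] := ltP 0 t; first by rewrite ltr_wpDr ?flat_exp_ge0// flat_exp_gt0.
by rewrite ltr_wpDl ?flat_exp_ge0// flat_exp_gt0// subr_gt0 (le_lt_trans t0).
Qed.

Lemma smooth1_smooth_step : smooth1 smooth_step.
Proof.
move=> k; apply: (@CkM _ _ (fun t => (flat_exp 0 t + flat_exp 0 (1 - t))^-1)).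
  exact: Ck_flat_exp.
apply: CkV; first by move=> t; rewrite gt_eqF// smooth_step_den.
apply: (@CkD _ _ (fun t => flat_exp 0 (1 - t))); first exact: Ck_flat_exp.
rewrite (_ : (fun t => _) = fun t => flat_exp 0 (-1 * t + 1)).
  by apply: Ck_affine; exact: Ck_flat_exp.
by apply/funext => t; rewrite mulN1r addrC.
Qed.

Lemma smooth_step_ge0 t : 0 <= smooth_step t.
Proof. by rewrite mulr_ge0 ?flat_exp_ge0// invr_ge0 ltW// smooth_step_den. Qed.

Lemma smooth_step_le1 t : smooth_step t <= 1.
Proof. by rewrite ler_pdivrMr ?smooth_step_den// mul1r lerDl flat_exp_ge0. Qed.

Lemma smooth_step_eq0 t : t <= 0 -> smooth_step t = 0.
Proof. by move=> t0; rewrite /smooth_step flat_exp_eq0// mul0r. Qed.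

Lemma smooth_step_eq1 t : 1 <= t -> smooth_step t = 1.
Proof.
move=> t1; rewrite /smooth_step (@flat_exp_eq0 _ (1 - t)) ?subr_le0// addr0 divff//.
by rewrite gt_eqF// flat_exp_gt0// (lt_le_trans _ t1).
Qed.

End smooth_line.

(** * Smooth cutoff functions in R^n *)

Section smooth_cutoff.
Context {R : realType} {n : nat}.
Implicit Types (K U : set 'rV[R]_n) (phi psi : 'rV[R]_n -> R).

(** A syntactic class stable under every partial derivative: membership survives iterated
    differentiation, and continuity and derivability need checking on generators only. *)
Inductive smooth_gen : ('rV[R]_n -> R) -> Prop :=
| smooth_gen_coord i g : smooth1 g -> smooth_gen (fun y => g (y ord0 i))
| smooth_gen_cst c : smooth_gen (cst c)
| smooth_gen_add phi psi : smooth_gen phi -> smooth_gen psi -> smooth_gen (phi + psi)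
| smooth_gen_mul phi psi : smooth_gen phi -> smooth_gen psi -> smooth_gen (phi * psi).

Lemma smooth_gen_continuous phi : smooth_gen phi -> continuous phi.
Proof.
elim=> [i g g1 x|c|f g _ cf _ cg x|f g _ cf _ cg x].
- apply: continuous_comp; first exact: coord_continuous.
  exact: (g1 0%N).
- exact: cst_continuous.
- by apply: continuousD; [exact: cf|exact: cg].
- by apply: continuousM; [exact: cf|exact: cg].
Qed.

Lemma is_derive_coord (g : R -> R) i j (x : 'rV[R]_n) : smooth1 g ->
  is_derive x (delta_mx ord0 i) (fun y : 'rV[R]_n => g (y ord0 j))
    ((i == j)%:R * 'D_1 g (x ord0 j)).
Proof.
move=> g1; have [_ /(_ (x ord0 j)) [dg dgE]] := smooth1_derive g1.
have E (h : R) : (h *: delta_mx ord0 i + x : 'rV[R]_n) ord0 j =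
    (i == j)%:R * h + x ord0 j.
  by rewrite !mxE eqxx /= eq_sym mulrC.
have [ij|ij] := eqVneq i j; last first.
  have Eq : (fun h : R => h^-1 *: (((fun y : 'rV[R]_n => g (y ord0 j)) \o shift x)
     (h *: delta_mx ord0 i) - g (x ord0 j))) = cst 0.
    by apply/funext => h; rewrite /= E (negbTE ij) mul0r add0r subrr scaler0.
  rewrite mul0r; apply: DeriveDef; rewrite /derivable /derive Eq; first exact: is_cvg_cst.
  by rewrite lim_cst.
have Eq : (fun h : R => h^-1 *: (((fun y : 'rV[R]_n => g (y ord0 j)) \o shift x)
    (h *: delta_mx ord0 i) - g (x ord0 j))) =
   (fun h : R => h^-1 *: ((g \o shift (x ord0 j)) (h *: 1) - g (x ord0 j))).
  by apply/funext => h; rewrite /= E ij eqxx mul1r [h *: 1]mulr1.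
by rewrite mul1r; apply: DeriveDef; rewrite /derivable /derive Eq.
Qed.

Lemma smooth_gen_partial phi i : smooth_gen phi ->
  (forall x, derivable phi x (delta_mx ord0 i)) /\ smooth_gen (partial i phi).
Proof.
elim=> [j g g1|c|f g sf [df sdf] sg [dg sdg]|f g sf [df sdf] sg [dg sdg]].
- split; first by move=> x; have [] := is_derive_coord i j x g1.
  rewrite (_ : partial i _ =
    cst (i == j)%:R * (fun y : 'rV[R]_n => 'D_1 g (y ord0 j))); last first.
    by apply/funext => x; have [] := is_derive_coord i j x g1.
  apply: smooth_gen_mul; first exact: smooth_gen_cst.
  by apply: (@smooth_gen_coord j ('D_(1 : R) g)); have [] := smooth1_derive g1.
- split; first by move=> x; exact: derivable_cst.
  rewrite (_ : partial i _ = cst 0); first exact: smooth_gen_cst.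
  by apply/funext => x; exact: derive_cst.
- split; first by move=> x; exact: derivableD.
  rewrite (_ : partial i _ = partial i f + partial i g); first exact: smooth_gen_add.
  by apply/funext => x; exact: deriveD.
- split; first by move=> x; exact: derivableM.
  rewrite (_ : partial i _ = f * partial i g + g * partial i f).
    by apply: smooth_gen_add; exact: smooth_gen_mul.
  by apply/funext => x; exact: deriveM.
Qed.

Lemma smooth_gen_smooth phi : smooth_gen phi -> smooth phi.
Proof.
move=> sphi s /=; have : smooth_gen (foldr (@partial R n) phi s).
  by elim: s => //= i s IH; have [] := smooth_gen_partial i IH.
move=> sg; split; first exact: smooth_gen_continuous.
by move=> x i; have [] := smooth_gen_partial i sg.
Qed.

Lemma smooth_gen_prod (I : Type) (r : seq I) (F : I -> 'rV[R]_n -> R) :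
  (forall i, smooth_gen (F i)) -> smooth_gen (fun y => \prod_(i <- r) F i y).
Proof.
move=> sF; elim: r => [|i r IH].
  rewrite (_ : (fun y => _) = cst 1); first exact: smooth_gen_cst.
  by apply/funext => y; rewrite big_nil.
rewrite (_ : (fun y => _) = F i * (fun y => \prod_(i <- r) F i y)).
  exact: smooth_gen_mul.
by apply/funext => y; rewrite big_cons.
Qed.

(** In each coordinate the two arguments are 2 + (y - x0)/r and 2 - (y - x0)/r: both are at least 1
    when |y - x0| <= r, and one is negative when |y - x0| > 2r. *)
Definition box_cutoff (x0 : 'rV[R]_n) (r : R) (y : 'rV[R]_n) : R :=
  \prod_i (smooth_step (r^-1 * y ord0 i + (2 - r^-1 * x0 ord0 i)) *
           smooth_step (- r^-1 * y ord0 i + (2 + r^-1 * x0 ord0 i))).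

Lemma smooth_gen_box_cutoff x0 r : smooth_gen (box_cutoff x0 r).
Proof.
apply: (@smooth_gen_prod _ _ (fun i y => _)) => i.
have := @smooth_gen_mul (fun y => smooth_step (r^-1 * y ord0 i + (2 - r^-1 * x0 ord0 i)))
  (fun y => smooth_step (- r^-1 * y ord0 i + (2 + r^-1 * x0 ord0 i))).
apply.
- apply: (@smooth_gen_coord i (fun t => smooth_step (r^-1 * t + _))) => k.
  by apply: Ck_affine; exact: smooth1_smooth_step.
- apply: (@smooth_gen_coord i (fun t => smooth_step (- r^-1 * t + _))) => k.
  by apply: Ck_affine; exact: smooth1_smooth_step.
Qed.

Lemma box_cutoff_ge0 x0 r y : 0 <= box_cutoff x0 r y.
Proof. by apply: prodr_ge0 => i _; rewrite mulr_ge0// smooth_step_ge0. Qed.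

Lemma box_cutoff_le1 x0 r y : box_cutoff x0 r y <= 1.
Proof.
apply: prodr_ile1 => i _; rewrite mulr_ge0 ?smooth_step_ge0//=.
by rewrite mulr_ile1 ?smooth_step_ge0 ?smooth_step_le1.
Qed.

Lemma box_cutoff_eq1 x0 r y : 0 < r -> `|x0 - y| <= r -> box_cutoff x0 r y = 1.
Proof.
move=> r0 xy; apply: big1 => i _.
have := le_trans (rV_norm_coord (x0 - y) i) xy.
rewrite !mxE ler_norml => /andP[h1 h2].
have r1 : r^-1 * r = 1 by rewrite mulVf// gt_eqF.
have r'0 : 0 <= r^-1 by rewrite invr_ge0 ltW.
have {}h1 := ler_wpM2l r'0 h1; have {}h2 := ler_wpM2l r'0 h2.
by rewrite !smooth_step_eq1 ?mulr1//; nra.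
Qed.

Lemma box_cutoff_eq0 x0 r y : 0 < r -> 2 * r < `|x0 - y| -> box_cutoff x0 r y = 0.
Proof.
move=> r0 xy.
have [i hi] : exists i, 2 * r < `|(x0 - y) ord0 i|.
  apply/not_existsP => h; move: xy; rewrite ltNge => /negP; apply.
  apply: rV_norm_le; first by rewrite mulr_ge0// ltW.
  by move=> i; rewrite leNgt; apply/negP; exact: h.
rewrite /box_cutoff (bigD1 i)//=.
suff -> : smooth_step (r^-1 * y ord0 i + (2 - r^-1 * x0 ord0 i)) *
           smooth_step (- r^-1 * y ord0 i + (2 + r^-1 * x0 ord0 i)) = 0 by rewrite mul0r.
have r1 : r^-1 * r = 1 by rewrite mulVf// gt_eqF.
have r'0 : 0 < r^-1 by rewrite invr_gt0.
move: hi; rewrite !mxE real_ltr_normr ?num_real// => /orP[] hi.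
- move: hi; rewrite -(ltr_pM2l r'0) => hi; rewrite smooth_step_eq0 ?mul0r//.
  by nra.
- move: hi; rewrite -(ltr_pM2l r'0) => hi; rewrite [X in _ * X]smooth_step_eq0 ?mulr0//.
  by nra.
Qed.

(** Finitely many box cutoffs, each equal to 1 on a ball of radius r around a point of [K], are
    combined into 1 - prod (1 - cutoff). This is 1 wherever one cutoff is 1 and 0 wherever all are
    0; as 2r = e, the support stays in the thickening of radius e. *)
Lemma smooth_cutoff K U : compact K -> open U -> K `<=` U ->
  exists psi, [/\ test_function U psi, forall x, 0 <= psi x <= 1 &
    forall x, K x -> psi x = 1].
Proof.
move=> cK oU KU; have [e e0 eU] := compact_sub_open_thicken cK oU KU.
have r0 : 0 < e / 2 by rewrite divr_gt0.
set r := e / 2 in r0.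
move: (cK); rewrite compact_cover => /(_ _ K (fun x => ball x r)) [].
- by move=> x _; exact: ball_open.
- by move=> x Kx; exists x => //; exact: ballxx.
move=> D0 DK0 KD0.
pose D : seq 'rV[R]_n := finmap.enum_fset D0.
have DK x : x \in D -> K x by move=> xD; have := DK0 x xD; rewrite inE.
have KD y : K y -> exists2 x, x \in D & `|x - y| < r.
  by move=> Ky; have [x xD xy] := KD0 _ Ky; exists x => //; move: xy; rewrite rV_ballE.
pose psi y := 1 - \prod_(x <- D) (1 - box_cutoff x r y).
have sup : [set y | psi y != 0] `<=` thicken K e.
  move=> y /= psiy; apply/thickenP; apply: contrapT => h.
  have : psi y = 0.
    rewrite /psi big1_seq ?subrr// => x /= xD.
    rewrite box_cutoff_eq0 ?subr0// ltNge; apply/negP => xy; apply: h; exists x.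
      exact: DK.
    by rewrite (le_trans xy)// /r mulrC divfK.
  by move/eqP; rewrite (negbTE psiy).
have csup : closure [set y | psi y != 0] `<=` thicken K e.
  rewrite [X in _ `<=` X](iffLR (closure_id _)); first exact: closure_subset.
  by apply: compact_rV_closed; exact: compact_thicken.
have b01 x y : 0 <= 1 - box_cutoff x r y <= 1.
  by rewrite subr_ge0 box_cutoff_le1 lerBlDr lerDl box_cutoff_ge0.
exists psi; split.
- split.
  + apply: smooth_gen_smooth.
    have Fsm x : smooth_gen (fun y => 1 - box_cutoff x r y).
      rewrite (_ : (fun y => _) = cst 1 + cst (-1) * box_cutoff x r).
        apply: smooth_gen_add; first exact: smooth_gen_cst.
        by apply: smooth_gen_mul; [exact: smooth_gen_cst|exact: smooth_gen_box_cutoff].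
      by apply/funext => y; rewrite !fctE mulN1r.
    rewrite (_ : psi = cst 1 + cst (-1) * (fun y => \prod_(x <- D) (1 - box_cutoff x r y))).
      apply: smooth_gen_add; first exact: smooth_gen_cst.
      by apply: smooth_gen_mul; [exact: smooth_gen_cst|exact: smooth_gen_prod].
    by apply/funext => y; rewrite !fctE mulN1r.
  + apply: subclosed_compact csup; first exact: closed_closure.
    exact: compact_thicken.
  + exact: subset_trans eU.
- move=> y; rewrite /psi subr_ge0 lerBlDr lerDl; apply/andP; split.
    by apply: prodr_ile1 => i _; exact: b01.
  by apply: prodr_ge0 => i _; case/andP: (b01 i y).
- move=> y Ky; have [x xD xy] := KD _ Ky.
  by rewrite /psi (big_rem x)//= box_cutoff_eq1 ?subrr ?mul0r ?subr0// ltW.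
Qed.

End smooth_cutoff.

(** * Borel sets and Borel functions on R^n *)

Section rV_borel.
Context {R : realType} {n : nat}.
Implicit Types A K U : set 'rV[R]_n.

Lemma open_measurable_rV U : open U -> measurable U.
Proof. by move=> oU; exact: sub_sigma_algebra. Qed.

Lemma closed_measurable_rV A : closed A -> measurable A.
Proof.
move=> cA; rewrite -[A]setCK; apply: measurableC; apply: open_measurable_rV.
exact: closed_openC.
Qed.

Lemma compact_measurable_rV K : compact K -> measurable K.
Proof. by move=> cK; apply: closed_measurable_rV; exact: compact_rV_closed. Qed.

Lemma continuous_measurable_rV (f : 'rV[R]_n -> R) :
  continuous f -> measurable_fun setT f.
Proof.
move=> cf; apply: (measurability _ (measurable_realfun.RGenOpens.measurableE R)).
move=> _ [_ [a [b ->] <-]]; rewrite setTI; apply: open_measurable_rV.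
by apply: open_comp; [move=> x _; exact: cf|exact: interval_open].
Qed.

Lemma measurable_rV_shift (h : 'rV[R]_n) : measurable_fun setT (fun x : 'rV[R]_n => x + h).
Proof.
apply: measurable_rV => i.
rewrite (_ : (fun t => _) = (fun x : 'rV[R]_n => x ord0 i + h ord0 i)).
  by apply: measurable_funD => //; exact: measurable_rV_coord.
by apply/funext => x; rewrite mxE.
Qed.

Lemma measurable_preimage_shift h A : measurable A ->
  measurable ((fun x : 'rV[R]_n => x + h) @^-1` A).
Proof.
by move=> mA; rewrite -[X in measurable X]setTI; exact: measurable_rV_shift.
Qed.

End rV_borel.

(** * Translation invariance and finiteness of Lebesgue measure *)

Section lebesgue_translation.
Context {R : realType}.

Lemma lebesgue_measure_shift (c : R) (A : set R) : measurable A ->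
  lebesgue_measure ((fun x => x + c) @^-1` A) = lebesgue_measure A.
Proof.
move=> mA.
pose f : R -> measurableTypeR R := fun x => x + c.
have mf : measurable_fun setT f by apply: measurable_funD.
rewrite -[LHS]/(pushforward lebesgue_measure f A).
apply/esym/lebesgue_measure_unique => //=.
move=> _ [[a b]] _ <-; rewrite /pushforward /=.
rewrite (_ : f @^-1` _ = `]a - c, b - c]%classic); last first.
  by apply/seteqP; split => x /=; rewrite !in_itv /= ltrBlDr lerBrDr.
by rewrite !lebesgue_measure_itv /= !lte_fin ltrD2r; case: ifP => // _; congr (_%:E); lra.
Qed.

Lemma lebesgue_rV_shift n (h : 'rV[R]_n) A : measurable A ->
  lebesgue_rV n ((fun x => x + h) @^-1` A) = lebesgue_rV n A.
Proof.
elim: n h A => [|n IH] h A mA.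
  by congr (lebesgue_rV 0 _); apply/funext => x /=; rewrite (thinmx0 h) addr0.
have h0 : exists p : R * 'rV[R]_n, h = rV_cons p.
  exists (h ord0 ord0, rsubmx (h : 'rV[R]_(1 + n))); apply/rowP => i.
  rewrite /rV_cons; case: (@split_ordP 1 n i) => j ->{i}.
    apply: etrans _ (esym (row_mxEl _ _ _ _)).
    by rewrite [j]ord1 mxE eqxx; congr (h _ _); exact: val_inj.
  by apply: etrans _ (esym (row_mxEr _ _ _ _)); rewrite mxE.
case: h0 => -[t v] ->.
pose S (p : measurableTypeR R * 'rV[R]_n) : measurableTypeR R * 'rV[R]_n :=
  ((p.1 : R) + t, p.2 + v).
have mS : measurable_fun setT S.
  apply: measurable_fun_pair; first exact: measurable_funD.
  by apply: (measurableT_comp (measurable_rV_shift v)); exact: measurable_snd.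
have consS p : rV_cons (S p) = rV_cons p + rV_cons (t, v) :> 'rV[R]_n.+1.
  by rewrite /rV_cons /= [RHS](add_row_mx p.1%:M) raddfD.
rewrite /= /lebesgue_cons /pushforward -comp_preimage.
rewrite (_ : _ \o _ = @rV_cons R n \o S); last by apply/funext => p; rewrite /= consS.
rewrite comp_preimage.
have mB : measurable (@rV_cons R n @^-1` A).
  by rewrite -[X in measurable X]setTI; exact: measurable_rV_cons.
set B := _ @^-1` A in mB *.
(* The image of the product measure under the shift agrees with the product measure on rectangles,
   by the one-dimensional case and the induction hypothesis. *)
have := @product_measure_unique _ _ _ _ _ (@lebesgue_measure R) (lebesgue_rV n)
  (measure_function_pushforward__canonical__measure_function_Measure
    (lebesgue_measure \x lebesgue_rV n)%E mS) _ B mB.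
move=> /(_ _)/esym; apply.
move=> C D mC mD; rewrite /pushforward /=.
change ((lebesgue_measure \x lebesgue_rV n)%E
  (((fun x : R => x + t)%R @^-1` C : set (measurableTypeR R)) `*` ((fun x => x + v)%R @^-1` D)) =
  lebesgue_measure C * lebesgue_rV n D)%E.
have mC' : measurable ((fun x : R => x + t) @^-1` C : set (measurableTypeR R)).
  by rewrite -[X in measurable X]setTI; apply: measurable_funD.
rewrite product_measure1E//; last exact: measurable_preimage_shift.
by congr (_ * _)%E; [exact: lebesgue_measure_shift|exact: IH].
Qed.

Lemma lebesgue_rV_le_box n (A : set 'rV[R]_n) (r : R) : 0 <= r ->
  measurable A -> A `<=` [set x | `|x| <= r] ->
  (lebesgue_rV n A <= ((2 * r) ^+ n)%:E)%E.
Proof.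
move=> r0 mA Ar.
have := @lebesgue_rV_box R n (fun=> - r) (fun=> r).
rewrite big_const_ord iter_mulr_1 opprK (_ : r + r = 2 * r); last lra.
move=> <-; last by move=> i; lra.
apply: le_measure; rewrite ?inE//.
  apply: closed_measurable_rV.
  rewrite (_ : [set _ | _] = [set x : 'rV[R]_n | `|x| <= r]); first exact: closed_norm_le.
  apply/seteqP; split=> [x /= h|x /= h i]; last first.
    by rewrite in_itv /= -ler_norml (le_trans (rV_norm_coord _ _)).
  by apply: rV_norm_le => // i; have := h i; rewrite in_itv /= -ler_norml.
by move=> x /Ar /= h i; rewrite in_itv /= -ler_norml (le_trans (rV_norm_coord _ _)).
Qed.

Lemma lebesgue_rV_bounded n (A : set 'rV[R]_n) : measurable A -> bounded_set A ->
  (lebesgue_rV n A < +oo)%E.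
Proof.
move=> mA [M [_ /(_ (Num.max 0 M + 1))]].
have M1 : M < Num.max 0 M + 1 by rewrite ltr_pwDr// le_max lexx orbT.
move=> /(_ M1) AM.
apply: (le_lt_trans (@lebesgue_rV_le_box n A (Num.max 0 M + 1) _ mA _)).
- by rewrite addr_ge0// le_max lexx.
- by move=> x /AM.
- exact: ltry.
Qed.

Lemma lebesgue_rV_compact n (K : set 'rV[R]_n) : compact K -> (lebesgue_rV n K < +oo)%E.
Proof.
by move=> cK; apply: lebesgue_rV_bounded; [exact: compact_measurable_rV|exact: compact_bounded].
Qed.

End lebesgue_translation.

Lemma sub_measure_fin_num {d} {T : measurableType d} {R : realType}
    (m : {measure set T -> \bar R}) A B : measurable A -> measurable B -> A `<=` B ->
  (m B < +oo)%E -> m A \is a fin_num.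
Proof.
move=> mA mB AB mBoo; rewrite ge0_fin_numE// (le_lt_trans _ mBoo)//.
by apply: le_measure => //; rewrite inE.
Qed.

Lemma decreasing_to_empty_lt {d} {T : measurableType d} {R : realType}
    (mu : {measure set T -> \bar R}) (F : nat -> set T) (e : R) :
  (mu (F 0%N) < +oo)%E -> (forall k, measurable (F k)) -> nonincreasing_seq F ->
  \bigcap_k F k = set0 -> 0 < e -> exists k, (mu (F k) < e%:E)%E.
Proof.
move=> F0 mF niF F_0 e0.
have : mu \o F @ \oo --> 0%E.
  by rewrite -(measure0 mu) -F_0; apply: nonincreasing_cvg_mu => //; rewrite F_0.
move=> /fine_cvgP[] [N1 _ FN1] /cvgr0Pnorm_lt /(_ e e0) [N2 _ FN2].
exists (maxn N1 N2); have := FN2 (maxn N1 N2) (leq_maxr _ _).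
have fin : mu (F (maxn N1 N2)) \is a fin_num by apply: FN1; exact: leq_maxl.
by rewrite /= ger0_norm ?fine_ge0// -lte_fin fineK.
Qed.

(** * Approximation of Borel sets by closed and open sets *)

Section regularity.
Context {R : realType} {n : nat}.
Variable mu : {measure set 'rV[R]_n -> \bar R}.
Hypothesis mu_fin : (mu setT < +oo)%E.
Implicit Types B C O : set 'rV[R]_n.

Let mu_lty B : measurable B -> (mu B < +oo)%E.
Proof. by move=> mB; apply: le_lt_trans mu_fin; apply: le_measure; rewrite ?inE. Qed.

Let regular B := forall e : R, 0 < e -> exists C O,
  [/\ closed C, open O, C `<=` B, B `<=` O & (mu (O `\` C) < e%:E)%E].

Let regular_open O : open O -> regular O.
Proof.
move=> oO e e0.
(* Closed inner approximations: the points at distance at least 1 / (k + 1) from the complement of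
   [O]. *)
pose C k := ~` thicken_open (~` O) k.+1%:R^-1.
have cC k : closed (C k) by apply: open_closedC; exact: open_thicken_open.
have [|||||k ke] := @decreasing_to_empty_lt _ _ _ mu (fun k => O `\` C k) e.
- by apply: mu_lty; apply: measurableD; [exact: open_measurable_rV|exact: closed_measurable_rV].
- by move=> k; apply: measurableD; [exact: open_measurable_rV|exact: closed_measurable_rV].
- move=> k l kl; apply/subsetPset => x [Ox /contrapT[y Oy /= xy]].
  split => //; apply; exists y => //=; apply: lt_le_trans xy _.
  by rewrite lef_pV2 ?posrE// ler_nat ltnS.
- apply/seteqP; split => // x H.
  have Ox : O x by have [] := H 0%N I.
  have /nbhs_ballP[r /= r0 xrO] : nbhs x O by exact: open_nbhs_nbhs.
  have [k kr] : exists k, k.+1%:R^-1 < r.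
    exists (Num.truncn r^-1); rewrite invf_plt ?posrE//.
    exact: truncnS_gt.
  have [_ /contrapT[y Oy /= xy]] := H k I; apply: Oy; apply: xrO.
  by rewrite rV_ballE /= distrC (lt_trans xy).
- exact: e0.
exists (C k), O; split => // x Cx; apply: contrapT => nOx; apply: Cx.
by exists x => //=; rewrite subrr normr0 invr_gt0.
Qed.

Let regularC B : regular B -> regular (~` B).
Proof.
move=> rB e e0; have [C [ O [cC oO CB BO]]] := rB e e0.
exists (~` O), (~` C); split; [exact: open_closedC|exact: closed_openC|exact: subsetC|exact: subsetC|].
by rewrite setDE setCK setIC -setDE.
Qed.

Let regular_bigcup (F : nat -> set 'rV[R]_n) :
  (forall k, regular (F k)) -> regular (\bigcup_k F k).
Proof.
move=> rF e e0.
have e20 k : 0 < e / 2 / (2 ^ k.+1)%:R by rewrite !divr_gt0// ltr0n expn_gt0.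
have /choice[C /choice[ O CO] ] : forall k, exists C O, [/\ closed C, open O, C `<=` F k, F k `<=` O &
    (mu (O `\` C) < (e / 2 / (2 ^ k.+1)%:R)%:E)%E].
  by move=> k; exact: rF.
pose U := \bigcup_k O k; pose D k := \big[setU/set0]_(i < k) C i.
have oU : open U by apply: bigcup_open => k _; have [] := CO k.
have cD k : closed (D k) by apply: closed_bigsetU => i _; have [] := CO i.
have mU := open_measurable_rV oU.
have mC k : measurable (C k) by apply: closed_measurable_rV; have [] := CO k.
have mO k : measurable (O k) by apply: open_measurable_rV; have [] := CO k.
have mCC : measurable (\bigcup_k C k) by exact: bigcup_measurable.
have mD k : measurable (D k) by exact: closed_measurable_rV.
(* An infinite union of closed sets need not be closed. Only finitely many are kept, and continuity
   from above makes the loss smaller than e / 2; the other half is spent on the geometric errors of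
   the open sets. *)
have [|||||k ke] := @decreasing_to_empty_lt _ _ _ mu (fun k => (\bigcup_k C k) `\` D k) (e / 2).
- by apply: mu_lty; exact: measurableD.
- by move=> k; exact: measurableD.
- move=> k l kl; apply/subsetPset; apply: setDS.
  exact: subset_bigsetU.
- apply/seteqP; split => // x H.
  have [[i _ Cix] _] := H 0%N I.
  have [_] := H i.+1 I; apply.
  by rewrite /D big_ord_recr /=; right.
- by rewrite divr_gt0.
exists (D k), U; split => //.
- apply: subset_trans (_ : \bigcup_k C k `<=` _).
    by rewrite /D -bigcup_mkord; move=> x [i _ Cx]; exists i.
  by apply: subset_bigcup => i _; have [] := CO i.
- by apply: subset_bigcup => i _; have [] := CO i.
have sub : U `\` D k `<=` (\bigcup_k (O k `\` C k)) `|` ((\bigcup_k C k) `\` D k).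
  move=> x [[i _ Oix] nD]; have [Cx|nC] := pselect ((\bigcup_k C k) x); first by right.
  by left; exists i => //; split => // Cix; apply: nC; exists i.
have mOC i : measurable (O i `\` C i) by exact: measurableD.
have mbig : measurable (\bigcup_k (O k `\` C k)) by exact: bigcup_measurable.
apply: (@le_lt_trans _ _ (mu ((\bigcup_k (O k `\` C k)) `|` ((\bigcup_k C k) `\` D k)))).
  by apply: le_measure => //; rewrite inE; [exact: measurableD|apply: measurableU => //; exact: measurableD].
rewrite (le_lt_trans (measureU2 _ _ _))//; first exact: measurableD.
rewrite [e]splitr EFinD; apply: lee_ltD => //.
- by rewrite ge0_fin_numE// mu_lty.
- apply: (@le_trans _ _ (\sum_(i <oo) mu (O i `\` C i))%E); last first.
    apply: le_trans (epsilon_trick0 xpredT _); last by rewrite divr_ge0// ltW.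
    by apply: lee_nneseries => // i _; have [_ _ _ _ CO5] := CO i; apply: ltW.
  exact: measure_sigma_subadditive.
Qed.

(** The sets that can be approximated from both sides form a sigma-algebra containing the open
    sets. *)
Lemma borel_regular B (e : R) : measurable B -> 0 < e -> exists C O,
  [/\ closed C, open O, C `<=` B, B `<=` O & (mu (O `\` C) < e%:E)%E].
Proof.
move=> mB; apply: (_ : regular B).
apply: (@smallest_sub _ (sigma_algebra setT) (@open 'rV[R]_n) regular) mB => //.
split.
- by apply: regular_open; exact: open0.
- by move=> A rA; rewrite setTD; exact: regularC.
- by move=> F rF; exact: regular_bigcup.
Qed.

End regularity.

(** * Locally finite signed measures on a compact set *)

Section scalar_measures.
Context {R : realType} {n : nat}.
Implicit Types (Omega K A B : set 'rV[R]_n) (nu : set 'rV[R]_n -> R).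

Definition locally_finite_smeasure Omega nu := forall K, compact K -> K `<=` Omega ->
  forall F : nat -> set 'rV[R]_n, (forall k, measurable (F k)) ->
    (forall k, F k `<=` K) -> trivIset setT F ->
    (fun m => \sum_(k < m) nu (F k)) @ \oo --> nu (\bigcup_k F k).

(** Countable additivity on a sequence of empty sets makes a constant series converge, so its term
    is 0. *)
Lemma locally_finite_smeasure0 Omega nu : locally_finite_smeasure Omega nu -> nu set0 = 0.
Proof.
move=> nuO; have {nuO} := nuO set0 (@compact0 _) (@sub0set _ _) (fun=> set0)
  (fun=> measurable0) (fun=> @subset_refl _ set0) (@trivIset_set0 _ _ _).
rewrite bigcup0// => H.
have : series (fun=> nu set0) @ \oo --> nu set0.
  by apply: cvg_trans H; apply: near_eq_cvg; near=> m; rewrite /series /= big_mkord.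
move=> /cvgP /cvg_series_cvg_0 /cvg_lim => /(_ (@Rhausdorff _)).
by rewrite lim_cst//; exact: Rhausdorff.
Unshelve. all: by end_near. Qed.

Lemma locally_finite_smeasureN Omega nu : locally_finite_smeasure Omega nu ->
  locally_finite_smeasure Omega (fun B => - nu B).
Proof.
move=> H K cK KO F mF FK tF.
rewrite (_ : (fun m => _) = - (fun m => \sum_(k < m) nu (F k))).
  by apply: cvgN; exact: H cK KO F mF FK tF.
by apply/funext => m; rewrite sumrN fctE.
Qed.

Lemma locally_finite_vmeasure_coord Omega (lam : set 'rV[R]_n -> 'rV[R]_n) i :
  locally_finite_vmeasure Omega lam ->
  locally_finite_smeasure Omega (fun B => lam B ord0 i).
Proof.
move=> H K cK KO F mF FK tF.
rewrite (_ : (fun m => _) =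
    (fun v : 'rV[R]_n => v ord0 i) \o (fun m => \sum_(k < m) lam (F k))).
  by apply: continuous_cvg; [exact: coord_continuous|exact: H cK KO F mF FK tF].
by apply/funext => m /=; rewrite summxE.
Qed.

Section jordan_on_compact.
Variables (Omega K : set 'rV[R]_n) (nu : set 'rV[R]_n -> R).
Hypothesis nuO : locally_finite_smeasure Omega nu.
Hypotheses (cK : compact K) (KO : K `<=` Omega).

(** Intersecting with [K] makes a globally defined charge out of a set function that is meaningful
    only on relatively compact sets, so that the Hahn decomposition applies. *)
Definition charge_on A : \bar R := (nu (A `&` K))%:E.

Let mK : measurable K := compact_measurable_rV cK.

Let charge_on0 : charge_on set0 = 0%E.
Proof. by rewrite /charge_on set0I (locally_finite_smeasure0 nuO). Qed.

Let charge_on_fin A : measurable A -> charge_on A \is a fin_num.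
Proof. by []. Qed.

Let charge_on_sigma_additive : semi_sigma_additive charge_on.
Proof.
move=> F mF tF _; rewrite /charge_on setI_bigcupl.
have := nuO cK KO (F := fun k => F k `&` K).
have mFK k : measurable (F k `&` K) by exact: measurableI.
move=> /(_ mFK (fun k => @subIsetr _ _ _) _) H.
rewrite (_ : (fun m => _) = EFin \o (fun m => \sum_(k < m) nu (F k `&` K))).
  by apply: cvg_EFin => //; [exact: nearW|apply: H; exact: trivIset_setIr].
by apply/funext => m /=; rewrite big_mkord sumEFin.
Qed.

HB.instance Definition _ := isCharge.Build _ _ _ charge_on
  charge_on0 charge_on_fin charge_on_sigma_additive.

Lemma jordan_on_compact : exists (p q : {finite_measure set 'rV[R]_n -> \bar R}) P,
  [/\ measurable P, forall A, measurable A -> p A = (nu (A `&` P `&` K))%:E,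
   forall A, measurable A -> q A = (- nu ((A `\` P) `&` K))%:E &
   forall A, measurable A -> (nu (A `&` K))%:E = (p A - q A)%E].
Proof.
have [P [N PN]] := Hahn_decomposition charge_on.
have [[mP _] [mN _] PNT PN0] := PN.
exists (jordan_pos PN), (jordan_neg PN), P; split => // A mA.
- by have := jordan_posE PN A; rewrite cjordan_posE /crestr0 mem_set.
- have := jordan_negE PN A; rewrite cjordan_negE /crestr0 mem_set// /crestr /charge_on => H.
  apply: etrans H _; rewrite (_ : A `\` P = A `&` N)//.
  rewrite setDE; congr (_ `&` _); apply/seteqP; split => x Px.
    by have : [set: 'rV[R]_n] x by []; rewrite -PNT => -[].
  by move=> Px'; have : set0 x by rewrite -PN0.
- apply: etrans (jordan_decomp PN mA) _; rewrite /cadd; congr (_ + _)%E.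
  by rewrite /= /cscale /= mulN1e.
Qed.

End jordan_on_compact.

Import HBNNSimple.

(** The integral is a supremum over simple functions below the integrand. Such a function vanishes
    outside [K], so its nonzero levels lie in [K]. No measure axiom is required of [m1] and [m2],
    which lets variations be replaced by measures. *)
Lemma integral_eq_on_compact (m1 : set 'rV[R]_n -> \bar R) (m2 : set 'rV[R]_n -> \bar R)
    D K (f : 'rV[R]_n -> \bar R) :
  (forall B, measurable B -> B `<=` K -> m1 B = m2 B) ->
  (forall x, D x -> ~ K x -> f x = 0%E) ->
  (\int[m1]_(x in D) f x = \int[m2]_(x in D) f x)%E.
Proof.
move=> m12 f0.
have key (g : 'rV[R]_n -> \bar R) : (forall x, ~ K x -> g x = 0%E) ->
  ereal_sup [set sintegral m1 h | h in
    [set h : {nnsfun 'rV[R]_n >-> R} | forall x, ((h x)%:E <= g x)%E]] =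
  ereal_sup [set sintegral m2 h | h in
    [set h : {nnsfun 'rV[R]_n >-> R} | forall x, ((h x)%:E <= g x)%E]].
  move=> g0; congr ereal_sup; apply: eq_imagel => h /= hg.
  rewrite /sintegral; apply: eq_fsbigr => r _.
  have [->|r0] := eqVneq r 0; first by rewrite !mul0e.
  congr (_ * _)%E; apply: m12; first exact: measurable_sfunP.
  move=> x /= hx; apply: contrapT => /g0 gx0.
  have := hg x; rewrite gx0 hx lee_fin => r_le0.
  have : 0 <= h x by [].
  by rewrite hx => r_ge0; move: r0; rewrite eq_le r_le0 r_ge0.
rewrite /integral; congr (_ - _)%E; apply: key => x Kx.
- rewrite funeposE patchE; case: ifPn => [|_]; last by rewrite maxxx.
  by rewrite inE => Dx; rewrite f0// maxxx.
- rewrite funenegE patchE; case: ifPn => [|_]; last by rewrite oppe0 maxxx.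
  by rewrite inE => Dx; rewrite f0// oppe0 maxxx.
Qed.

End scalar_measures.

(** * Signed integrals through Jordan decompositions *)

Section signed_integrals.
Context {R : realType} {n : nat}.
Implicit Types (Omega K A B : set 'rV[R]_n) (nu : set 'rV[R]_n -> R) (phi : 'rV[R]_n -> R).

(** The supremum defining the positive variation of [B] is attained on the intersection of [B] with
    the positive set of a Hahn decomposition, and that of the negative one on the remainder. *)
Lemma pos_variation_jordan Omega K nu :
  locally_finite_smeasure Omega nu -> compact K -> K `<=` Omega ->
  exists p q : {measure set 'rV[R]_n -> \bar R},
    [/\ (p K < +oo)%E, (q K < +oo)%E & forall B, measurable B -> B `<=` K ->
    [/\ pos_variation Omega nu B = p B, pos_variation Omega (fun B => - nu B) B = q B &
        (nu B)%:E = (p B - q B)%E]].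
Proof.
move=> nuO cK KO; have [p0 [q0 [P [mP pE0 qE0 nuE0]]]] := jordan_on_compact nuO cK KO.
have mK := compact_measurable_rV cK.
pose p : {measure set 'rV[R]_n -> \bar R} := p0.
pose q : {measure set 'rV[R]_n -> \bar R} := q0.
have pE A : measurable A -> p A = (nu (A `&` P `&` K))%:E := @pE0 A.
have qE A : measurable A -> q A = (- nu ((A `\` P) `&` K))%:E := @qE0 A.
have nuE A : measurable A -> (nu (A `&` K))%:E = (p A - q A)%E := @nuE0 A.
have qfin A : measurable A -> q A \is a fin_num by move=> /qE ->.
exists p, q; split; [by rewrite pE// ltry|by rewrite qE// ltry|].
move=> B mB BK.
have nuB A : measurable A -> A `<=` B -> (nu A)%:E = (p A - q A)%E.
  by move=> mA AB; rewrite -nuE//; congr (nu _)%:E; apply/esym/setIidPl; apply: subset_trans BK.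
have rcB A : A `<=` B -> relatively_compact Omega A.
  by move=> AB; exists K; split => //; exact: subset_trans AB BK.
split; last exact: nuB.
- apply/eqP; rewrite eq_le; apply/andP; split.
    apply: ge_ereal_sup => _ [A [mA _ AB] <-].
    rewrite nuB//; apply: (@le_trans _ _ (p A)).
      by rewrite geeDl// oppe_le0.
    by apply: le_measure; rewrite ?inE.
  apply: ereal_sup_ubound; exists (B `&` P).
    split; [exact: measurableI|apply: rcB; exact: subIsetl|exact: subIsetl].
  by rewrite pE//; congr (nu _)%:E; apply/esym/setIidPl => x [/BK].
- apply/eqP; rewrite eq_le; apply/andP; split.
    apply: ge_ereal_sup => _ [A [mA _ AB] <-].
    rewrite EFinN nuB// fin_num_oppeB ?qfin//; apply: (@le_trans _ _ (q A)).
      by rewrite geeDr// oppe_le0.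
    by apply: le_measure; rewrite ?inE.
  apply: ereal_sup_ubound; exists (B `\` P).
    split; [exact: measurableD|apply: rcB; exact: subDsetl|exact: subDsetl].
  by rewrite qE//; congr (- nu _)%:E; apply/esym/setIidPl => x [/BK].
Qed.

Lemma bounded_integrable_compact (mu : {measure set 'rV[R]_n -> \bar R}) K phi M :
  measurable K -> (mu K < +oo)%E -> measurable_fun setT phi ->
  (forall x, `|phi x| <= M) -> mu.-integrable K (EFin \o phi).
Proof.
move=> mK muK mphi phiM; apply: measurable_bounded_integrable => //.
  exact: measurable_funTS.
by exists M; split; [exact: num_real|move=> r Mr x _ /=; rewrite (le_trans (phiM x))// ltW].
Qed.

(** If p - q = P - Q on subsets of [K], then P + q = p + Q there. Integrating this equality of
    finite measures shows that any decomposition computes the signed integral. *)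
Lemma signed_integralE Omega K nu (p q : {measure set 'rV[R]_n -> \bar R}) phi M :
  locally_finite_smeasure Omega nu -> compact K -> K `<=` Omega ->
  (p K < +oo)%E -> (q K < +oo)%E ->
  (forall B, measurable B -> B `<=` K -> (nu B)%:E = (p B - q B)%E) ->
  measurable_fun setT phi -> (forall x, `|phi x| <= M) ->
  (forall x, ~ K x -> phi x = 0) ->
  (signed_integral Omega nu phi =
    \int[p]_(x in K) (phi x)%:E - \int[q]_(x in K) (phi x)%:E)%E.
Proof.
move=> nuO cK KO pK qK nupq mphi phiM phi0.
have mK := compact_measurable_rV cK.
have [P [Q [PK QK PQ]]] := pos_variation_jordan nuO cK KO.
have shrink (m : {measure set 'rV[R]_n -> \bar R}) :
    (\int[m]_(x in Omega) (phi x)%:E = \int[m]_(x in K) (phi x)%:E)%E.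
  rewrite [LHS]integral_mkcond [RHS]integral_mkcond; apply: eq_integral => x _.
  rewrite !patchE; case: ifPn => xO; case: ifPn => xK //.
    by rewrite phi0// => Kx; move: xK; rewrite mem_set.
  by move: xK; rewrite inE => /KO Ox; move: xO; rewrite mem_set.
have mphiK : measurable_fun K (EFin \o phi).
  by apply/measurable_EFinP; exact: measurable_funTS.
have int (m : {measure set 'rV[R]_n -> \bar R}) : (m K < +oo)%E ->
    m.-integrable K (EFin \o phi).
  by move=> mKoo; exact: bounded_integrable_compact phiM.
rewrite /signed_integral.
rewrite (@integral_eq_on_compact _ _ _ P Omega K); last 2 first.
- by move=> B mB BK; have [] := PQ B mB BK.
- by move=> x _ /phi0 ->.
rewrite (@integral_eq_on_compact _ _ (pos_variation Omega (fun B => - nu B)) Q Omega K); last 2 first.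
- by move=> B mB BK; have [] := PQ B mB BK.
- by move=> x _ /phi0 ->.
rewrite !shrink.
have fin (m : {measure set 'rV[R]_n -> \bar R}) : (m K < +oo)%E ->
    (\int[m]_(x in K) (phi x)%:E)%E \is a fin_num.
  by move=> mKoo; apply: integrable_fin_num => //; exact: int.
have E : (\int[P]_(x in K) (phi x)%:E + \int[q]_(x in K) (phi x)%:E =
          \int[p]_(x in K) (phi x)%:E + \int[Q]_(x in K) (phi x)%:E)%E.
  have e1 := integral_measure_add mK (int _ PK) (int _ qK).
  have e2 := integral_measure_add mK (int _ pK) (int _ QK).
  apply: etrans (esym e1) (etrans _ e2).
  apply: (@integral_eq_on_compact _ _ _ _ K K) => [B mB BK|x Kx /(_ Kx)//].
  apply: etrans (measure_addE _ _ _) (etrans _ (esym (measure_addE _ _ _))).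
  suff : (P B + q B = p B + Q B)%E by [].
  have [_ _ nuPQ] := PQ B mB BK; have := nupq B mB BK; rewrite nuPQ.
  have fB (m : {measure set 'rV[R]_n -> \bar R}) : (m K < +oo)%E -> m B \is a fin_num.
    exact: sub_measure_fin_num.
  have pB := fB p pK; have qB := fB q qK; have PB := fB P PK; have QB := fB Q QK.
  rewrite -(fineK pB) -(fineK qB) -(fineK PB) -(fineK QB) -!EFinB -!EFinD => -[H].
  by congr EFin; lra.
move: E; rewrite -(fineK (fin _ PK)) -(fineK (fin _ QK)) -(fineK (fin _ pK)) -(fineK (fin _ qK)).
by rewrite -!EFinB -!EFinD => -[H]; congr EFin; lra.
Qed.

End signed_integrals.

(** * Integrals as averages of superlevel sets *)

Section layer_cake.
Context {R : realType}.

(* The predicate [b j] may be either [j + 1 <= t] or [j + 1 < t]. *)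
Lemma count_bounds (b : nat -> bool) (t : R) m : 0 <= t ->
  (forall j, b j -> j.+1%:R <= t) -> (forall j, ~~ b j -> t <= j.+1%:R) ->
  Num.min m%:R (t - 1) <= \sum_(j < m) (b j)%:R <= t.
Proof.
move=> t0 bt nbt.
have Sm k : \sum_(j < k) (b j)%:R <= k%:R :> R.
  rewrite (_ : k%:R = \sum_(j < k) 1); last by rewrite sumr_const card_ord.
  by apply: ler_sum => j _; case: (b j).
elim: m => [|m /andP[IH1 IH2]]; first by rewrite big_ord0 t0 ge_min lexx.
rewrite big_ord_recr /=; have := Sm m.
case: (boolP (b m)) => [/bt|/nbt]; rewrite -natr1 ?addr0 => h Smm.
- apply/andP; split; last by rewrite (le_trans _ h)// lerD2r.
  rewrite ge_min lerD2r; apply/orP; left; apply: le_trans IH1.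
  by rewrite le_min lexx lerBrDr.
- rewrite IH2 andbT; apply: le_trans IH1.
  by rewrite le_min !ge_min lexx orbT andbT lerBlDr h orbT.
Qed.

Context {d} {T : measurableType d}.
Variables (p : {measure set T -> \bar R}) (K : set T) (phi : T -> R).
Hypotheses (mK : measurable K) (pK : (p K < +oo)%E) (mphi : measurable_fun setT phi).
Hypothesis phi01 : forall x, 0 <= phi x <= 1.

Definition layer (m j : nat) := [set x | j.+1%:R / m.+1%:R <= phi x].

Lemma measurable_superlevel s : measurable [set x | s <= phi x].
Proof.
rewrite (_ : mkset _ = phi @^-1` `[s, +oo[%classic).
  by rewrite -[X in measurable X]setTI; exact: mphi.
by apply/seteqP; split => x /=; rewrite in_itv /= andbT.
Qed.

(** The average of the indicators of the layers rounds [phi] down to a multiple of 1 / (m + 1),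
    hence differs from it by at most 1 / (m + 1) pointwise. *)
Lemma layer_integral m :
  m.+1%:R^-1 * \sum_(j < m.+1) fine (p (K `&` layer m j)) <=
    fine (\int[p]_(x in K) (phi x)%:E) <=
  m.+1%:R^-1 * \sum_(j < m.+1) fine (p (K `&` layer m j)) + m.+1%:R^-1 * fine (p K).
Proof.
have m0 : 0 < m.+1%:R :> R by [].
have m'0 : 0 <= m.+1%:R^-1 :> R by rewrite invr_ge0.
have mL j : measurable (layer m j) by exact: measurable_superlevel.
pose g x := m.+1%:R^-1 * \sum_(j < m.+1) (\1_(layer m j) x : R).
have gphi x : g x <= phi x <= g x + m.+1%:R^-1.
  have /andP[p0 p1] := phi01 x.
  have /andP[h1 h2] := @count_bounds (fun j => x \in layer m j) (m.+1%:R * phi x) m.+1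
    ltac:(by rewrite mulr_ge0) ltac:(by move=> j; rewrite inE /layer /= ler_pdivrMr// mulrC)
    ltac:(by move=> j; apply: contraNT; rewrite -ltNge => h;
          rewrite inE /layer /= ler_pdivrMr// mulrC ltW).
  (* Since [phi] is at most 1, the minimum in the counting bound is its second argument. *)
  have h3 : m.+1%:R * phi x - 1 <= \sum_(j < m.+1) (\1_(layer m j) x : R).
    by apply: le_trans h1; rewrite le_min lexx andbT lerBlDr (le_trans (ler_piMr _ p1))// lerDl.
  apply/andP; split; first by rewrite /g ler_pdivrMl.
  by rewrite /g -[X in _ + X]mulr1 -mulrDr ler_pdivlMl// -lerBlDr.
have g0 x : 0 <= g x by rewrite mulr_ge0// sumr_ge0.
have mg : measurable_fun setT g.
  by apply: measurable_funM => //; apply: measurable_sum => j; exact: measurable_indic.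
have mE (f : T -> R) : measurable_fun setT f -> measurable_fun K (EFin \o f).
  by move=> mf; apply/measurable_EFinP; exact: measurable_funTS.
have pfin A : measurable A -> p (K `&` A) \is a fin_num.
  move=> mA; rewrite ge0_fin_numE// (le_lt_trans _ pK)// le_measure ?inE//.
  exact: measurableI.
have intg : (\int[p]_(x in K) (g x)%:E)%E =
    (m.+1%:R^-1 * \sum_(j < m.+1) fine (p (K `&` layer m j)))%:E.
  under eq_integral do rewrite /g EFinM.
  rewrite ge0_integralZl//; last 2 first.
  - by apply: mE; apply: measurable_sum => j; exact: measurable_indic.
  - by move=> x _; rewrite lee_fin sumr_ge0.
  rewrite EFinM; congr (_ * _)%E.
  under eq_integral do rewrite -sumEFin.
  rewrite ge0_integral_sum//; last by move=> j; apply: mE; exact: measurable_indic.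
  rewrite -sumEFin; apply: eq_bigr => j _.
  by rewrite integral_indic// setIC fineK// pfin.
have phiM x : `|phi x| <= 1 by case/andP: (phi01 x) => p0 p1; rewrite ger0_norm.
have intphi : p.-integrable K (EFin \o phi).
  apply: measurable_bounded_integrable => //; first exact: measurable_funTS.
  by exists 1; split; [exact: num_real|move=> r /ltW r1 x _ /=; exact: le_trans r1].
have finphi := integrable_fin_num mK intphi.
rewrite -!lee_fin fineK// -intg; apply/andP; split.
  apply: ge0_le_integral => //;
    try (by move=> x _; rewrite lee_fin; case/andP: (phi01 x));
    try (by move=> x _; rewrite lee_fin; case/andP: (gphi x));
    by apply: mE.
rewrite EFinD -intg EFinM fineK; last by rewrite ge0_fin_numE.
rewrite -(integral_cst p mK) -ge0_integralD//; [|by move=> x _; rewrite lee_fin|exact: mE].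
apply: ge0_le_integral => //;
  try (by move=> x _; rewrite lee_fin; case/andP: (phi01 x));
  try (by move=> x _; rewrite -EFinD lee_fin; case/andP: (gphi x));
  try (by move=> x _; rewrite -EFinD lee_fin addr_ge0);
  try (by apply: mE).
by apply: (mE (fun x => g x + m.+1%:R^-1)); exact: measurable_funD.
Qed.

End layer_cake.

(** * Test functions and their partial derivatives *)

Section test_function_facts.
Context {R : realType} {n : nat}.
Implicit Types (Omega K U : set 'rV[R]_n) (phi : 'rV[R]_n -> R).

Lemma test_function_continuous Omega phi : test_function Omega phi -> continuous phi.
Proof. by case=> /(_ [::]) []. Qed.

Lemma test_function_derivable Omega phi x i : test_function Omega phi ->
  derivable phi x (delta_mx ord0 i).
Proof. by case=> /(_ [::]) []. Qed.

Lemma test_function_partial_continuous Omega phi i : test_function Omega phi ->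
  continuous (partial i phi).
Proof. by case=> /(_ [:: i]) []. Qed.

Definition support_set phi := closure [set x | phi x != 0].

Lemma test_function_out Omega phi x : test_function Omega phi ->
  ~ support_set phi x -> phi x = 0.
Proof.
move=> _ nx; apply/eqP/negPn/negP => h; apply: nx.
exact: subset_closure.
Qed.

Lemma test_function_compact Omega phi : test_function Omega phi -> compact (support_set phi).
Proof. by case. Qed.

Lemma test_function_sub Omega phi : test_function Omega phi -> support_set phi `<=` Omega.
Proof. by case. Qed.

Lemma partial_out Omega phi i x : test_function Omega phi ->
  ~ support_set phi x -> partial i phi x = 0.
Proof.
move=> tphi nx; rewrite /partial.
rewrite (@near_eq_derive _ _ _ _ (cst 0)); first exact: derive_cst.
have : nbhs x (~` support_set phi).
  by apply: open_nbhs_nbhs; split => //; apply: closed_openC; exact: closed_closure.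
by apply: filterS => y /(test_function_out tphi).
Qed.

Lemma continuous_compact_support_bounded K phi : continuous phi -> compact K ->
  (forall x, ~ K x -> phi x = 0) -> exists M, forall x, `|phi x| <= M.
Proof.
move=> cphi cK phi0.
have /compact_bounded [M [_ HM]] : compact (phi @` K).
  by apply: continuous_compact => //; exact: continuous_subspaceT.
exists (`|M| + 1) => x; have [Kx|/phi0 ->] := pselect (K x); last first.
  by rewrite normr0 addr_ge0.
by apply: HM; [rewrite (le_lt_trans (ler_norm M))// ltrDl|exists x].
Qed.

Lemma test_function_bounded Omega phi : test_function Omega phi ->
  exists M, forall x, `|phi x| <= M.
Proof.
move=> tphi; apply: continuous_compact_support_bounded.
- exact: test_function_continuous tphi.
- exact: test_function_compact tphi.
- by move=> x; exact: test_function_out tphi.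
Qed.

Lemma partial_bounded Omega phi i : test_function Omega phi ->
  exists M, forall x, `|partial i phi x| <= M.
Proof.
move=> tphi; apply: continuous_compact_support_bounded.
- exact: test_function_partial_continuous tphi.
- exact: test_function_compact tphi.
- by move=> x; exact: partial_out tphi.
Qed.

End test_function_facts.

(** * Signed integrals as limits over superlevel sets *)

Section signed_integral_layers.
Context {R : realType} {n : nat}.
Implicit Types (Omega K : set 'rV[R]_n) (phi : 'rV[R]_n -> R).

(** Subtracting the layer bounds for the two Jordan parts leaves an error of at most (p K + q K) /
    (m + 1). The statement itself mentions only [nu], so bounds on sets pass to integrals without
    reference to a decomposition. *)
Lemma signed_integral_cvg_layers Omega nu phi :
  locally_finite_smeasure Omega nu -> test_function Omega phi ->
  (forall x, 0 <= phi x <= 1) ->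
  (fun m => m.+1%:R^-1 * \sum_(j < m.+1) nu (layer phi m j)) @ \oo -->
    fine (signed_integral Omega nu phi).
Proof.
move=> nuO tphi phi01.
have cK := test_function_compact tphi; have KO := test_function_sub tphi.
have [M phiM] := test_function_bounded tphi.
have [p [q [pK qK pq]]] := pos_variation_jordan nuO cK KO.
have mphi := continuous_measurable_rV (test_function_continuous tphi).
have mK := compact_measurable_rV cK.
set K := support_set phi in cK KO mK pK qK pq *.
rewrite (signed_integralE nuO cK KO pK qK _ mphi phiM); last 2 first.
- by move=> B mB BK; have [] := pq B mB BK.
- by move=> x; exact: test_function_out tphi.
have int (m : {measure set 'rV[R]_n -> \bar R}) : (m (K) < +oo)%E ->
    (\int[m]_(x in K) (phi x)%:E)%E \is a fin_num.
  by move=> mKoo; exact: (integrable_fin_num mK (bounded_integrable_compact mK mKoo mphi phiM)).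
rewrite fineB ?int//.
apply/cvgrPdist_lt => e e0.
pose C := fine (p K) + fine (q K) + 1.
have C0 : 0 < C by rewrite ltr_pwDr// addr_ge0// fine_ge0.
near=> m.
have LK j : layer phi m j `<=` K.
  move=> x; rewrite /layer /= => h; apply: contrapT => /(test_function_out tphi) phix.
  by move: h; rewrite phix leNgt divr_gt0.
have mL j : measurable (layer phi m j) by exact: measurable_superlevel.
have finB (m' : {measure set 'rV[R]_n -> \bar R}) j : (m' K < +oo)%E ->
    m' (layer phi m j) \is a fin_num.
  by move=> mK'; rewrite ge0_fin_numE// (le_lt_trans _ mK')// le_measure// inE.
have nuL j : nu (layer phi m j) =
    fine (p (K `&` layer phi m j)) - fine (q (K `&` layer phi m j)).
  rewrite (setIidr (LK j)); have [_ _] := pq _ (mL j) (LK j).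
  rewrite -(@fineK _ (p _)) ?finB// -(@fineK _ (q _)) ?finB//.
  by rewrite -EFinB => -[].
under eq_bigr do rewrite nuL.
rewrite sumrB mulrBr.
have /andP[p1 p2] := layer_integral mK pK mphi phi01 m.
have /andP[q1 q2] := layer_integral mK qK mphi phi01 m.
have mC : m.+1%:R^-1 * C < e.
  rewrite -ltr_pdivlMr//; near: m.
  by have := near_infty_natSinv_lt (PosNum (divr_gt0 e0 C0)).
rewrite /C !mulrDr mulr1 in mC.
have m1 : 0 < m.+1%:R^-1 :> R by rewrite invr_gt0.
move: p1 p2 q1 q2 mC.
set Pk := _ * fine (p K); set Qk := _ * fine (q K); set P := _ * _; set Q := _ * _.
have Pk0 : 0 <= Pk by rewrite mulr_ge0 ?fine_ge0// ltW.
have Qk0 : 0 <= Qk by rewrite mulr_ge0 ?fine_ge0// ltW.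
move: m1; set mi := _^-1 => m1.
by move=> *; rewrite ltr_norml; apply/andP; split; lra.
Unshelve. all: by end_near. Qed.

(* Slicing along superlevel sets turns estimates of [v . lam] on sets into
   estimates of [v . lam] tested against a cutoff function. *)
Lemma signed_integral_between Omega lam (v : 'I_n -> R) phi (a b : R) :
  locally_finite_vmeasure Omega lam -> test_function Omega phi ->
  (forall x, 0 <= phi x <= 1) ->
  (forall s, 0 < s <= 1 ->
    a <= \sum_i v i * lam [set x | s <= phi x] ord0 i <= b) ->
  a <= \sum_i v i * fine (signed_integral Omega (fun B => lam B ord0 i) phi) <= b.
Proof.
move=> lamO tphi phi01 ab.
pose S m := m.+1%:R^-1 * \sum_(j < m.+1) \sum_i v i * lam (layer phi m j) ord0 i.
have Sab m : a <= S m <= b.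
  have m1 : 0 < m.+1%:R :> R by [].
  rewrite /S ler_pdivlMl// ler_pdivrMl//.
  have H (j : 'I_m.+1) : a <= \sum_i v i * lam (layer phi m j) ord0 i <= b.
    by apply: ab; rewrite divr_gt0//= ler_pdivrMr// mul1r ler_nat.
  have cs c : m.+1%:R * c = \sum_(j < m.+1) c by rewrite sumr_const card_ord mulr_natl.
  rewrite !cs.
  by apply/andP; split; apply: ler_sum => j _; case/andP: (H j).
have cS : S @ \oo --> \sum_i v i * fine (signed_integral Omega (fun B => lam B ord0 i) phi).
  rewrite (_ : S = fun m => \sum_i v i *
      (m.+1%:R^-1 * \sum_(j < m.+1) lam (layer phi m j) ord0 i)); last first.
    apply/funext => m; rewrite /S exchange_big mulr_sumr; apply: eq_bigr => i _.
    by rewrite -mulr_sumr mulrCA.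
  apply: cvg_big => [|i _]; first exact: add_continuous.
  apply: cvgMl_tmp.
  apply: signed_integral_cvg_layers => //.
  exact: locally_finite_vmeasure_coord.
apply/andP; split.
  by apply: (cvgr_to_ge cS); near=> m; case/andP: (Sab m).
by apply: (cvgr_to_le cS); near=> m; case/andP: (Sab m).
Unshelve. all: by end_near. Qed.

End signed_integral_layers.

(** * The Euclidean norm and its duality *)

Section euclidean_norm.
Context {R : realType} {n : nat}.
Implicit Types u v w : 'rV[R]_n.

Definition dotv u v := \sum_i u ord0 i * v ord0 i.

Lemma dotvDr u v w : dotv u (v + w) = dotv u v + dotv u w.
Proof. by rewrite /dotv -big_split; apply: eq_bigr => i _; rewrite mxE mulrDr. Qed.

Lemma dotv_sumr (I : Type) (r : seq I) u (F : I -> 'rV[R]_n) :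
  dotv u (\sum_(j <- r) F j) = \sum_(j <- r) dotv u (F j).
Proof.
rewrite /dotv exchange_big; apply: eq_bigr => i _.
by rewrite summxE mulr_sumr.
Qed.

Lemma dotv_continuous u : continuous (dotv u).
Proof.
rewrite /dotv; elim: (index_enum _) => [|i r IH].
  by under eq_fun do rewrite big_nil; exact: cst_continuous.
under eq_fun do rewrite big_cons.
move=> v; apply: (@continuousD _ _ _ (fun w : 'rV[R]_n => u ord0 i * w ord0 i)); last exact: IH.
apply: (@continuousM _ _ (cst (u ord0 i)) (fun w : 'rV[R]_n => w ord0 i)).
  exact: cst_continuous.
exact: coord_continuous.
Qed.

Lemma enorm_ge0 v : 0 <= enorm v. Proof. exact: sqrtr_ge0. Qed.

Lemma enorm_sqr v : enorm v ^+ 2 = \sum_i v ord0 i ^+ 2.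
Proof. by rewrite sqr_sqrtr// sumr_ge0// => i _; exact: sqr_ge0. Qed.

Lemma enorm0 : enorm (0 : 'rV[R]_n) = 0.
Proof. by rewrite /enorm big1 ?sqrtr0// => i _; rewrite mxE expr0n. Qed.

Lemma enorm_coord v i : `|v ord0 i| <= enorm v.
Proof.
rewrite -sqrtr_sqr ler_sqrt; last by rewrite sumr_ge0// => j _; exact: sqr_ge0.
by rewrite (bigD1 i)//= lerDl sumr_ge0// => j _; exact: sqr_ge0.
Qed.

Lemma enorm_le_sum v : enorm v <= \sum_i `|v ord0 i|.
Proof.
have S0 : 0 <= \sum_i `|v ord0 i| by exact: sumr_ge0.
rewrite -(@ler_pXn2r _ 2)// ?nnegrE ?enorm_ge0// enorm_sqr.
rewrite [leRHS]expr2 mulr_suml; apply: ler_sum => i _.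
rewrite -real_normK ?num_real// expr2; apply: ler_wpM2l => //.
by rewrite (bigD1 i)//= lerDl sumr_ge0.
Qed.

Lemma dotv_le u v : dotv u v <= enorm u * enorm v.
Proof.
have : 0 <= \sum_i (enorm v * u ord0 i - enorm u * v ord0 i) ^+ 2.
  by apply: sumr_ge0 => i _; exact: sqr_ge0.
(* Cauchy-Schwarz: the sum of squares factors as 2 |u| |v| (|u| |v| - u.v); the case |u| |v| = 0 is
   separate. *)
have -> : \sum_i (enorm v * u ord0 i - enorm u * v ord0 i) ^+ 2 =
    2 * (enorm u * enorm v) * (enorm u * enorm v - dotv u v).
  transitivity (\sum_i (enorm v ^+ 2 * u ord0 i ^+ 2 + enorm u ^+ 2 * v ord0 i ^+ 2
      - 2 * (enorm u * enorm v) * (u ord0 i * v ord0 i))).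
    by apply: eq_bigr => i _; ring.
  rewrite sumrB big_split /= -!mulr_sumr -!enorm_sqr -/(dotv u v); ring.
have [uv0|] := ltP 0 (enorm u * enorm v).
  by rewrite pmulr_rge0 ?subr_ge0// mulr_gt0.
move=> uv0 _; have /eqP : enorm u * enorm v = 0.
  by apply/eqP; rewrite eq_le uv0 mulr_ge0// enorm_ge0.
have z w : enorm w = 0 -> forall i, w ord0 i = 0.
  by move=> w0 i; apply/eqP; rewrite -normr_le0 -w0 enorm_coord.
rewrite mulf_eq0 => /orP[] /eqP /[dup] w0 /z wz; rewrite w0 ?mul0r ?mulr0 /dotv big1// => i _;
  by rewrite wz ?mul0r ?mulr0.
Qed.

(** A norming vector turns the norm of a value of a vector measure into a linear expression, which
    passes through countable sums and limits. *)
Lemma enorm_dotv v : exists2 u, enorm u <= 1 & dotv u v = enorm v.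
Proof.
have [v0|v0] := eqVneq (enorm v) 0.
  exists 0; first by rewrite enorm0.
  by rewrite v0 /dotv big1// => i _; rewrite mxE mul0r.
have E w (c : R) : dotv (c *: w) v = c * dotv w v.
  by rewrite /dotv mulr_sumr; apply: eq_bigr => i _; rewrite mxE mulrA.
have vv : dotv v v = enorm v ^+ 2.
  by rewrite enorm_sqr; apply: eq_bigr => i _; rewrite expr2.
exists ((enorm v)^-1 *: v); last by rewrite E vv expr2 mulKf.
rewrite -(@ler_pXn2r _ 2)// ?nnegrE ?enorm_ge0// enorm_sqr expr1n.
under eq_bigr do rewrite mxE exprMn.
by rewrite -mulr_sumr -enorm_sqr -exprMn mulVf// expr1n.
Qed.

End euclidean_norm.

(** * The total variation is a Borel measure *)

Section total_variation_measure.
Context {R : realType} {n : nat}.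
Variables (Omega : set 'rV[R]_n) (lam : set 'rV[R]_n -> 'rV[R]_n).
Hypothesis lamO : locally_finite_vmeasure Omega lam.
Implicit Types (A B E F K U : set 'rV[R]_n) (phi : 'rV[R]_n -> R).

Let TV := Defs.total_variation Omega lam.

Lemma vmeasure0 : lam set0 = 0.
Proof.
apply/rowP => i; rewrite mxE.
have H := locally_finite_smeasure0 (@locally_finite_vmeasure_coord _ _ Omega lam i lamO).
exact: H.
Qed.

Lemma total_variation_ge0 E : (0 <= TV E)%E.
Proof.
apply: ereal_sup_ubound; exists 0%N, (fun=> set0).
by split => [[]//|[]//|]; rewrite big_ord0.
Qed.

Lemma le_total_variation A B : A `<=` B -> (TV A <= TV B)%E.
Proof.
move=> AB; apply: le_ereal_sup => _ [m [F [F1 tF ->]]].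
exists m, F; split => // k; have [mF rF FA] := F1 k.
by split => //; exact: subset_trans AB.
Qed.

Lemma enorm_le_total_variation B E : measurable B -> relatively_compact Omega B ->
  B `<=` E -> ((enorm (lam B))%:E <= TV E)%E.
Proof.
move=> mB rB BE; apply: ereal_sup_ubound; exists 1%N, (fun=> B).
split => //; last by rewrite big_ord_recl big_ord0 addr0.
by move=> i j _ _ _; rewrite !ord1.
Qed.

(** On [K] each coordinate splits into two finite measures, and the Euclidean norm is at most the
    sum of the absolute coordinates; disjointness of the pieces bounds everything by the masses of
    [K]. *)
Lemma total_variation_compact K : compact K -> K `<=` Omega -> (TV K < +oo)%E.
Proof.
move=> cK KO.
have /choice[p /choice[q pq]] : forall i, exists p q : {measure set 'rV[R]_n -> \bar R},
    [/\ (p K < +oo)%E, (q K < +oo)%E & forall B, measurable B -> B `<=` K ->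
    (lam B ord0 i)%:E = (p B - q B)%E].
  move=> i; have [p [q [pK qK pq]]] :=
    pos_variation_jordan (@locally_finite_vmeasure_coord _ _ Omega lam i lamO) cK KO.
  by exists p, q; split => // B mB BK; have [] := pq B mB BK.
apply: (@le_lt_trans _ _ (\sum_i (p i K + q i K))%E); last first.
  apply/lte_sum_pinfty => i _; have [pK qK _] := pq i.
  by rewrite lte_add_pinfty.
apply: ge_ereal_sup => _ [m [F [F1 tF ->]]].
apply: (@le_trans _ _ (\sum_(k < m) \sum_i (p i (F k) + q i (F k)))%E).
  rewrite -sumEFin; apply: lee_sum => k _; have [mF rF FK] := F1 k.
  apply: (@le_trans _ _ (\sum_i `|lam (F k) ord0 i|)%:E).
    by rewrite lee_fin enorm_le_sum.
  rewrite -sumEFin; apply: lee_sum => i _; have [pK qK pqi] := pq i.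
  rewrite -abse_EFin pqi//; apply: le_trans (lee_abs_sub _ _) _.
  by rewrite !gee0_abs.
rewrite exchange_big; apply: lee_sum => i _; rewrite big_split /=.
have mK := compact_measurable_rV cK.
have key (m' : {measure set 'rV[R]_n -> \bar R}) : (\sum_(k < m) m' (F k) <= m' K)%E.
  rewrite -measure_semi_additive_ord//.
  - apply: le_measure; rewrite ?inE//.
      by apply: bigsetU_measurable => k _; have [] := F1 k.
    apply: (big_ind (fun X => X `<=` K)) => // [X Y XK YK|k _]; last by have [] := F1 k.
    by rewrite subUset.
  - by move=> k; have [] := F1 k.
  - by apply: bigsetU_measurable => k _; have [] := F1 k.
by rewrite leeD.
Qed.

Lemma total_variation_superadditive A B : A `&` B = set0 ->
  (TV A + TV B <= TV (A `|` B))%E.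
Proof.
move=> AB.
have [->|Tfin] := eqVneq (TV (A `|` B)) +oo%E; first exact: leey.
have fin E : E `<=` A `|` B -> TV E \is a fin_num.
  move=> EAB; rewrite ge0_fin_numE ?total_variation_ge0//.
  by rewrite (le_lt_trans (le_total_variation EAB))// ltey.
rewrite -leeBrDr ?fin//; apply: ge_ereal_sup => _ [m1 [F1 [F1a F1b ->]]].
rewrite leeBrDr ?fin// addeC -leeBrDr//; apply: ge_ereal_sup => _ [m2 [F2 [F2a F2b ->]]].
rewrite leeBrDr//; apply: ereal_sup_ubound.
(* The two finite families are concatenated; pieces from different families are disjoint because [A]
   and [B] are. *)
exists (m2 + m1)%N, (fun k => match fintype.split k with inl i => F2 i | inr j => F1 j end); split.
- move=> k; case: (fintype.split k) => j.
    by have [? ? ?] := F2a j; split => //; apply: subset_trans (@subsetUr _ _ _).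
  by have [? ? ?] := F1a j; split => //; apply: subset_trans (@subsetUl _ _ _).
- move=> k l _ _; rewrite -{2}(splitK k) -{2}(splitK l).
  case: (fintype.split k) => i; case: (fintype.split l) => j /=.
  + by move=> h; rewrite (F2b i j).
  + move=> [x [Fx1 Fx2]]; exfalso; suff : set0 x by []; rewrite -AB; split.
      by have [_ _] := F1a j; apply.
    by have [_ _] := F2a i; apply.
  + move=> [x [Fx1 Fx2]]; exfalso; suff : set0 x by []; rewrite -AB; split.
      by have [_ _] := F1a i; apply.
    by have [_ _] := F2a j; apply.
  + by move=> h; rewrite (F1b i j).
- rewrite -EFinD; congr EFin; rewrite big_split_ord /=; congr (_ + _).
    by apply: eq_bigr => i _; rewrite (unsplitK (inl i)).
  by apply: eq_bigr => i _; rewrite (unsplitK (inr i)).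
Qed.

Lemma total_variation_set0 : TV set0 = 0%E.
Proof.
apply/eqP; rewrite eq_le total_variation_ge0 andbT.
apply: ge_ereal_sup => _ [m [F [F1 tF ->]]].
rewrite lee_fin big1// => k _; have [_ _] := F1 k; rewrite subset0 => ->.
by rewrite vmeasure0 enorm0.
Qed.

(** The norm is not additive, so each piece [F k] is first paired with its norming vector [u k]. The
    resulting linear expression can be summed over the pieces of [F k] in the [E i], where each term
    is at most a norm. *)
Lemma total_variation_sigma_subadditive (E : nat -> set 'rV[R]_n) :
  (forall k, measurable (E k)) -> trivIset setT E ->
  (TV (\bigcup_k E k) <= \sum_(k <oo) TV (E k))%E.
Proof.
move=> mE tE; apply: ge_ereal_sup => _ [m [F [F1 tF ->]]].
have /choice[u uP] : forall k, exists u : 'rV[R]_n, enorm u <= 1 /\ dotv u (lam (F k)) = enorm (lam (F k)).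
  by move=> k; have [u u1 u2] := enorm_dotv (lam (F k)); exists u.
pose S N := \sum_(i < N) \sum_(k < m) dotv (u k) (lam (F k `&` E i)).
have cS : S @ \oo --> \sum_(k < m) enorm (lam (F k)).
  rewrite (_ : S = fun N => \sum_(k < m) dotv (u k) (\sum_(i < N) lam (F k `&` E i))); last first.
    by apply/funext => N; rewrite /S exchange_big; apply: eq_bigr => k _; rewrite dotv_sumr.
  apply: cvg_big => [|k _]; first exact: add_continuous.
  have [_ <-] := uP k; apply: continuous_cvg; first exact: dotv_continuous.
  have [mF [K [cK KO FK]] FE] := F1 k.
  rewrite [X in lam X](_ : F k = \bigcup_i (F k `&` E i)); last first.
    by rewrite -setI_bigcupr; apply/esym/setIidPl.
  apply: (lamO cK KO).
  - by move=> i; exact: measurableI.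
  - by move=> i x [/FK].
  - exact: trivIset_setIl.
have SE N : ((S N)%:E <= \sum_(k <oo) TV (E k))%E.
  apply: (@le_trans _ _ (\sum_(i < N) TV (E i))%E); last first.
    rewrite -(big_mkord xpredT (fun i => TV (E i))).
    by apply: nneseries_lim_ge => i _ _; exact: total_variation_ge0.
  rewrite -sumEFin; apply: lee_sum => i _.
  apply: (@le_trans _ _ (\sum_(k < m) enorm (lam (F k `&` E i)))%:E).
    rewrite lee_fin; apply: ler_sum => k _; apply: le_trans (dotv_le _ _) _.
    by have [u1 _] := uP k; rewrite ler_piMl// enorm_ge0.
  apply: ereal_sup_ubound; exists m, (fun k => F k `&` E i); split => //.
    move=> k; have [mF [K [cK KO FK]] FE] := F1 k.
    split; [exact: measurableI| |exact: subIsetr].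
    by exists K; split => // x [/FK].
  exact: trivIset_setIr.
have [->|Tfin] := eqVneq (\sum_(k <oo) TV (E k))%E +oo%E; first exact: leey.
have fin : (\sum_(k <oo) TV (E k))%E \is a fin_num.
  by rewrite ge0_fin_numE ?ltey// nneseries_ge0// => *; exact: total_variation_ge0.
rewrite -(fineK fin) lee_fin; apply: (cvgr_to_le cS).
by near=> N; rewrite -lee_fin fineK.
Unshelve. all: by end_near. Qed.

Lemma total_variation_semi_sigma_additive : semi_sigma_additive TV.
Proof.
move=> E mE tE mUE.
have -> : TV (\bigcup_k E k) = (\sum_(k <oo) TV (E k))%E.
  apply/eqP; rewrite eq_le total_variation_sigma_subadditive//=.
  apply: lime_le; first by apply: is_cvg_nneseries => *; exact: total_variation_ge0.
  near=> N; rewrite big_mkord.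
  apply: (@le_trans _ _ (TV (\big[setU/set0]_(i < N) E i))).
    elim: (N) => [|N' IH]; first by rewrite !big_ord0 total_variation_ge0.
    rewrite !big_ord_recr /=; apply: le_trans (total_variation_superadditive _).
      by rewrite leeD.
    rewrite -bigcup_mkord; apply/seteqP; split => // x [[i /= iN Eix] EN].
    have iE : i = N' by apply: tE => //; exists x.
    by move: iN; rewrite iE ltnn.
  by apply: le_total_variation; rewrite -bigcup_mkord; move=> x [i _ Ex]; exists i.
apply/cvg_closeP; split; last by rewrite closeE.
by apply: is_cvg_nneseries => *; exact: total_variation_ge0.
Unshelve. all: by end_near. Qed.

HB.instance Definition _ := isMeasure.Build _ _ _ TV
  total_variation_set0 total_variation_ge0 total_variation_semi_sigma_additive.

Definition total_variation_measure : {measure set 'rV[R]_n -> \bar R} := TV.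

(** The superlevel sets of [phi] at positive heights are relatively compact subsets of [U], so the
    bound holds for the measure of each of them and hence for their average. *)
Lemma signed_integral_le_total_variation (v : 'rV[R]_n) phi U :
  test_function Omega phi -> (forall x, 0 <= phi x <= 1) ->
  enorm v <= 1 -> [set x | phi x != 0] `<=` U ->
  ((\sum_i v ord0 i * fine (signed_integral Omega (fun B => lam B ord0 i) phi))%:E <= TV U)%E.
Proof.
move=> tphi phi01 v1 phiU.
have [->|Tfin] := eqVneq (TV U) +oo%E; first exact: leey.
have fin : TV U \is a fin_num by rewrite ge0_fin_numE ?ltey// total_variation_ge0.
rewrite -(fineK fin) lee_fin.
have bnd s : 0 < s -> `|dotv v (lam [set x | s <= phi x])| <= fine (TV U).
  move=> s0; have sphi x : s <= phi x -> phi x != 0.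
    by move=> sx; rewrite gt_eqF// (lt_le_trans s0).
  have H : enorm (lam [set x | s <= phi x]) <= fine (TV U).
    rewrite -lee_fin fineK//; apply: enorm_le_total_variation.
    - apply: measurable_superlevel.
      exact: continuous_measurable_rV (test_function_continuous tphi).
    - exists (support_set phi); split;
        [exact: test_function_compact tphi|exact: test_function_sub tphi|].
      by move=> x /sphi h; rewrite /support_set; apply: subset_closure.
    - by move=> x /sphi; exact: phiU.
  have dotv1 (w x : 'rV[R]_n) : enorm w <= 1 -> dotv w x <= enorm x.
    by move=> w1; rewrite (le_trans (dotv_le w x))// ler_piMl// enorm_ge0.
  have dotvN x : - dotv v x = dotv (- v) x.
    by rewrite /dotv -sumrN; apply: eq_bigr => i _; rewrite mxE mulNr.
  have v1' : enorm (- v) <= 1.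
    suff -> : enorm (- v) = enorm v by [].
    by rewrite /enorm; congr Num.sqrt; apply: eq_bigr => i _; rewrite mxE sqrrN.
  by apply: le_trans H; rewrite ler_norml lerNl dotvN !dotv1.
have bnd' s : 0 < s <= 1 ->
    - fine (TV U) <= \sum_i v ord0 i * lam [set x | s <= phi x] ord0 i <= fine (TV U).
  by move=> /andP[s0 _]; rewrite -ler_norml; exact: bnd.
by have /andP[] := signed_integral_between lamO tphi phi01 bnd'.
Qed.

End total_variation_measure.

(** * Translated test functions and differentiation under the integral *)

Section translations.
Context {R : realType} {n : nat}.
Implicit Types (Omega K U W : set 'rV[R]_n) (phi : 'rV[R]_n -> R) (h : 'rV[R]_n).

Let mu := @lebesgue_rV R n.

Lemma continuous_shift h : continuous (fun y : 'rV[R]_n => y + h).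
Proof.
by move=> x; apply: (@continuousD _ _ _ id (cst h)); [exact: cvg_id|exact: cst_continuous].
Qed.

Lemma derive_translate phi h v x :
  'D_v (fun y => phi (y + h)) x = 'D_v phi (x + h).
Proof. by rewrite /derive /=; do 2 f_equal; apply/funext => t /=; rewrite addrA. Qed.

Lemma derivable_translate phi h v x :
  derivable phi (x + h) v -> derivable (fun y => phi (y + h)) x v.
Proof.
rewrite /derivable /=.
by under [X in _ -> cvg (X @ _)]eq_fun do rewrite -addrA.
Qed.

Lemma partial_translate phi h i :
  partial i (fun y => phi (y + h)) = fun y => partial i phi (y + h).
Proof. by apply/funext => x; exact: derive_translate. Qed.

Lemma smooth_translate phi h : smooth phi -> smooth (fun y => phi (y + h)).
Proof.
move=> sphi s /=.
have -> : foldr (@partial R n) (fun y => phi (y + h)) s =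
    fun y => foldr (@partial R n) phi s (y + h).
  by elim: s => //= i s ->; rewrite partial_translate.
have [c d] := sphi s; split => [x|x i]; last exact/derivable_translate/d.
have -> : (fun y => foldr (@partial R n) phi s (y + h)) =
    foldr (@partial R n) phi s \o (fun y => y + h) by [].
by apply: continuous_comp; [exact: continuous_shift|exact: c].
Qed.

Lemma translate_neq0 phi h :
  [set x | phi (x + h) != 0] = (fun x => x - h) @` [set x | phi x != 0].
Proof.
apply/seteqP; split => [x /= px|_ [x /= px <-]]; last by rewrite /= subrK.
by exists (x + h) => //; rewrite addrK.
Qed.

Lemma compact_translate K h : compact K -> compact ((fun x => x - h) @` K).
Proof.
move=> cK; apply: continuous_compact => //.
by apply: continuous_subspaceT => x; exact: continuous_shift.
Qed.

Lemma test_function_translate Omega Omega' phi h : test_function Omega phi ->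
  (forall x, support_set phi x -> Omega' (x - h)) ->
  test_function Omega' (fun y => phi (y + h)).
Proof.
move=> tphi sub; have [sphi cphi _] := tphi.
have cl : closure [set x | phi (x + h) != 0] `<=` (fun x => x - h) @` support_set phi.
  rewrite translate_neq0 [X in _ `<=` X](iffLR (closure_id _)).
    by apply: closure_subset; apply: image_subset; exact: subset_closure.
  by apply: compact_rV_closed; apply: compact_translate; exact: cphi.
split; first exact: smooth_translate.
  apply: subclosed_compact cl; first exact: closed_closure.
  exact: compact_translate.
by move=> x /cl [y /sub ? <-].
Qed.

Lemma test_functionW Omega Omega' phi : Omega `<=` Omega' ->
  test_function Omega phi -> test_function Omega' phi.
Proof. by move=> OO' [? ? sO]; split => //; exact: subset_trans OO'. Qed.

Lemma integrable_compact_support W K phi M : measurable W -> compact K -> measurable_fun setT phi ->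
  (forall x, `|phi x| <= M) -> (forall x, ~ K x -> phi x = 0) ->
  mu.-integrable W (EFin \o phi).
Proof.
move=> mW cK mphi phiM phi0; have mK := compact_measurable_rV cK.
apply: (@integrableS _ _ _ _ setT) => //.
rewrite (_ : EFin \o phi = (EFin \o phi) \_ K).
  rewrite -integrable_mkcond//; apply: bounded_integrable_compact phiM => //.
  exact: lebesgue_rV_compact.
apply/funext => x; rewrite patchE; case: ifPn => // /negP; rewrite inE => nK.
by rewrite /= phi0.
Qed.

Lemma integrable_test_function Omega W phi : measurable W -> test_function Omega phi ->
  mu.-integrable W (EFin \o phi).
Proof.
move=> mW tphi; have [M phiM] := test_function_bounded tphi.
apply: (integrable_compact_support mW (test_function_compact tphi) _ phiM).
  exact: continuous_measurable_rV (test_function_continuous tphi).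
by move=> x; exact: test_function_out tphi.
Qed.

Lemma integrable_partial Omega W phi i : measurable W -> test_function Omega phi ->
  mu.-integrable W (EFin \o partial i phi).
Proof.
move=> mW tphi; have [M phiM] := partial_bounded i tphi.
apply: (integrable_compact_support mW (test_function_compact tphi) _ phiM).
  exact: continuous_measurable_rV (test_function_partial_continuous tphi).
by move=> x; exact: partial_out tphi.
Qed.

Lemma is_derive_translated_integral W phi i (a : R) :
  measurable W -> test_function setT phi ->
  is_derive a (1 : R) (fun t => \int[mu]_(y in W) phi (y + t *: delta_mx ord0 i))
    (\int[mu]_(y in W) partial i phi (y + a *: delta_mx ord0 i)).
Proof.
move=> mW tphi.
pose e : 'rV[R]_n := delta_mx ord0 i.
pose f (t : R) (y : 'rV[R]_n) := phi (y + t *: e).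
have quo (t : R) (y : 'rV[R]_n) :
    (fun h : R => h^-1 *: (((f ^~ y) \o shift t) (h *: 1) - f t y)) =
    (fun h : R => h^-1 *: ((phi \o shift (y + t *: e)) (h *: e) - phi (y + t *: e))).
  by apply/funext => h; rewrite /f /= [h *: 1]mulr1 scalerDl addrCA.
have df (t : R) y : derivable (f ^~ y) t 1.
  by rewrite /derivable quo; exact: (@test_function_derivable _ _ setT phi (y + t *: e) i tphi).
have d1f (t : R) y : partial1of2 f t y = partial i phi (y + t *: e).
  by rewrite partial1of2E /partial /derive quo.
have [M HM] := partial_bounded i tphi.
have M0 : 0 <= M by apply: le_trans (HM 0).
(* For t within 1 of [a], the translates vanish outside the support thickened by |a| + 1; a constant
   on this compact set dominates all derivatives. *)
pose K := thicken (support_set phi) (`|a| + 1).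
have cK : compact K by apply: compact_thicken; exact: test_function_compact tphi.
have mK := compact_measurable_rV cK.
have Ia : `]a - 1, a + 1[%classic a.
  by rewrite /= in_itv /= ltrDl ltr01 andbT ltrBlDr ltrDl.
have intf t : `]a - 1, a + 1[%classic t -> mu.-integrable W (EFin \o f t).
  move=> _; apply: (@integrable_test_function setT) => //.
  exact: test_function_translate tphi _.
have intG : mu.-integrable W (EFin \o (fun y => M * \1_K y)).
  apply: (integrable_compact_support mW cK (M := M)).
  - by apply: measurable_funM => //; exact: measurable_indic.
  - by move=> x; rewrite ger0_norm ?mulr_ge0// ler_piMr// indicE; case: (_ \in _).
  - by move=> x Kx; rewrite indicE memNset// mulr0.
have e1 : `|e| <= 1.
  apply: rV_norm_le => // j; rewrite mxE eqxx /=; case: (_ == _); rewrite ?normr1 ?normr0//.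
have Gub t y : `]a - 1, a + 1[%classic t -> W y -> `|partial1of2 f t y| <= M * \1_K y.
  rewrite /= in_itv /= => /andP[ta1 ta2] _; rewrite d1f.
  have [Ky|nKy] := pselect (K y); first by rewrite indicE mem_set// mulr1.
  rewrite (partial_out i tphi) ?normr0 ?mulr_ge0// => sy; apply: nKy.
  apply/thickenP; exists (y + t *: e) => //.
  rewrite (addrC y) addrK normrZ; apply: (@le_trans _ _ (`|t| * 1)).
    exact: ler_wpM2l.
  rewrite mulr1 -[t](subrK a) (le_trans (ler_normD _ _))// addrC lerD2l.
  by rewrite ler_norml; apply/andP; split; lra.
have G0 y : 0 <= M * \1_K y by rewrite mulr_ge0.
have H1 := derivable_under_integral mW Ia intf (fun t y _ _ => df t y) G0 intG Gub.
have H2 := differentiation_under_integral mW Ia intf (fun t y _ _ => df t y) G0 intG Gub.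
apply: DeriveDef; first exact: H1.
rewrite -derive1E H2; apply: eq_Rintegral => y _; exact: d1f.
Qed.

Lemma integral_translate phi h : mu.-integrable setT (EFin \o phi) ->
  \int[mu]_y phi (y + h) = \int[mu]_y phi y.
Proof.
move=> iphi; rewrite /Rintegral; congr fine.
have mh := measurable_rV_shift h.
have muE A : measurable A -> pushforward mu (fun y : 'rV[R]_n => y + h) A = mu A.
  by move=> mA; exact: lebesgue_rV_shift.
have mphi : measurable_fun setT (EFin \o phi) by case/integrableP: iphi.
pose mu' : {measure set 'rV[R]_n -> \bar R} :=
  measure_function_pushforward__canonical__measure_function_Measure mu mh.
have E (f : 'rV[R]_n -> \bar R) : (\int[mu']_y f y = \int[mu]_y f y)%E.
  by apply: (@integral_eq_on_compact _ _ _ _ setT setT) => // B mB _; exact: muE.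
transitivity (\int[mu']_y (phi y)%:E)%E; last exact: E.
have mabs f : measurable_fun setT f -> (forall y, 0 <= f y)%E ->
    (\int[mu']_y f y = \int[mu]_y f (y + h)%R)%E.
  by move=> mf f0; apply: ge0_integral_pushforward.
rewrite integralE [RHS]integralE; congr (_ - _)%E.
  rewrite mabs//; last exact: measurable_funepos.
  by apply: eq_integral => y _; rewrite !funeposE.
rewrite mabs//; last exact: measurable_funeneg.
by apply: eq_integral => y _; rewrite !funenegE.
Qed.

(** By translation invariance the integral of the translate is constant in the parameter, so its
    derivative vanishes. This makes the zero measure a gradient of the full domain. *)
Lemma integral_partial_eq0 phi i : test_function setT phi ->
  \int[mu]_y partial i phi y = 0.
Proof.
move=> tphi; have := is_derive_translated_integral i 0 measurableT tphi.
rewrite (_ : (fun t => _) = cst (\int[mu]_y phi y)); last first.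
  by apply/funext => t; apply: integral_translate; exact: integrable_test_function tphi.
move=> [_]; rewrite derive_cst => ->.
by apply: eq_Rintegral => y _; rewrite scale0r addr0.
Qed.

End translations.

(** * Points that leave a set under a coordinate translation *)

Section jump_estimate.
Context {R : realType} {n : nat}.
Implicit Types (Omega K Q W : set 'rV[R]_n).

Let mu := @lebesgue_rV R n.

Lemma Rintegral_indic W A : measurable W -> measurable A ->
  \int[mu]_(x in W) (\1_A x : R) = fine (mu (A `&` W)).
Proof. by move=> mW mA; rewrite /Rintegral integral_indic. Qed.

Lemma signed_integral_norm_le Omega lam i phi Q :
  locally_finite_vmeasure Omega lam -> test_function Omega phi ->
  (forall x, 0 <= phi x <= 1) -> [set x | phi x != 0] `<=` Q ->
  (Defs.total_variation Omega lam Q < +oo)%E ->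
  `|fine (signed_integral Omega (fun B => lam B ord0 i) phi)| <=
    fine (Defs.total_variation Omega lam Q).
Proof.
move=> lamO tphi phi01 phiQ TQ.
have Tfin : Defs.total_variation Omega lam Q \is a fin_num.
  by rewrite ge0_fin_numE// total_variation_ge0.
have key (c : R) : `|c| = 1 -> c * fine (signed_integral Omega (fun B => lam B ord0 i) phi) <=
    fine (Defs.total_variation Omega lam Q).
  move=> c1; pose v : 'rV[R]_n := c *: delta_mx ord0 i.
  have vj j : v ord0 j = if j == i then c else 0.
    by rewrite !mxE eqxx /=; case: (j == i); rewrite ?mulr1 ?mulr0.
  have v1 : enorm v <= 1.
    apply: le_trans (enorm_le_sum _) _; rewrite (bigD1 i)//= vj eqxx c1.
    by rewrite big1 ?addr0// => j ji; rewrite vj (negbTE ji) normr0.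
  have := signed_integral_le_total_variation lamO tphi phi01 v1 phiQ.
  rewrite -(fineK Tfin) lee_fin (bigD1 i)//= vj eqxx big1 ?addr0// => j ji.
  by rewrite vj (negbTE ji) mul0r.
rewrite ler_norml lerNl -mulN1r key ?normrN1//=.
by rewrite -[leLHS]mul1r key// normr1.
Qed.

Definition jump_set Q W (h : 'rV[R]_n) :=
  [set x | [/\ Q x, W x, Q (x + h) & ~ W (x + h)]].

(** With [psi] close to the indicator of the jump set, g s = int_W psi (y + s e) is nearly the
    volume of the jump set at s = 0 and nearly 0 at s = - t. Its derivative is a gradient integral
    bounded by the variation in [Q], so the mean value theorem compares the two. *)
Lemma jump_estimate Omega K Q W lam i t :
  is_gradient_measure Omega W lam -> measurable W ->
  open Q -> Q `<=` Omega -> compact K -> Q `<=` K ->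
  (Defs.total_variation Omega lam Q < +oo)%E ->
  (forall x s, Q x -> Q (x + t *: delta_mx ord0 i) -> 0 <= s <= 1 ->
     Q (x + (s * t) *: delta_mx ord0 i)) ->
  (mu (jump_set Q W (t *: delta_mx ord0 i)) <=
   (`|t| * fine (Defs.total_variation Omega lam Q))%:E)%E.
Proof.
move=> [lamO gradW] mW oQ QO cK QK TQ convQ.
set e : 'rV[R]_n := delta_mx ord0 i; set T := fine _.
set E := jump_set _ _ _.
have mQ := open_measurable_rV oQ; have mK := compact_measurable_rV cK.
have mQt : measurable ((fun x : 'rV[R]_n => x + t *: e) @^-1` Q) by exact: measurable_preimage_shift.
have mWt : measurable ((fun x : 'rV[R]_n => x + t *: e) @^-1` W) by exact: measurable_preimage_shift.
have EE : E = (Q `&` W) `&`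
    (((fun x : 'rV[R]_n => x + t *: e) @^-1` Q) `\` ((fun x : 'rV[R]_n => x + t *: e) @^-1` W)).
  by apply/seteqP; split => [x [? ? ? ?]|x [[? ?] [? ?]]]; split.
have mE : measurable E.
  by rewrite EE; apply: measurableI; [exact: measurableI|exact: measurableD].
have muK := lebesgue_rV_compact cK.
have muQ : (mu Q < +oo)%E by apply: le_lt_trans muK; apply: le_measure; rewrite ?inE.
apply/lee_addgt0Pr => eps eps0.
have e20 : 0 < eps / 2 by rewrite divr_gt0.
(* Regularity is stated for finite measures, hence the restriction of Lebesgue measure to [Q]. *)
have [|C [ O [cC oO CE EO muOC]]] := @borel_regular _ _ (mrestr mu mQ) _ E (eps / 2) mE e20.
  by rewrite -[X in (X < _)%E]/(mu (setT `&` Q)) setTI.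
have {}muOC : (mu ((O `\` C) `&` Q) < (eps / 2)%:E)%E := muOC.
pose U := O `&` (Q `&` ((fun x : 'rV[R]_n => x + t *: e) @^-1` Q)).
have oU : open U.
  apply: openI => //; apply: openI => //; apply: open_comp => // x _.
  exact: continuous_shift.
have CU : C `<=` U by move=> x Cx; have [? ? ? _] := CE _ Cx; split; [exact: EO (CE _ Cx)|split].
have cC' : compact C.
  by apply: (subclosed_compact_rV cC cK) => x /CE [] /QK.
have mC := compact_measurable_rV cC'; have mU := open_measurable_rV oU.
have mO := open_measurable_rV oO.
have [psi [tpsi psi01 psi1]] := smooth_cutoff cC' oU CU.
have tpsiT := test_functionW (@subsetT _ U) tpsi.
have suppU x : support_set psi x -> U x by exact: (test_function_sub tpsi).
have muUC : (mu (U `\` C) <= (eps / 2)%:E)%E.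
  apply: le_trans (ltW muOC); apply: le_measure; rewrite ?inE.
  - exact: measurableD.
  - by apply: measurableI => //; exact: measurableD.
  - by move=> x [[Ox [Qx _]] nCx].
pose g (s : R) := \int[mu]_(y in W) psi (y + s *: e).
pose g' (s : R) := \int[mu]_(y in W) partial i psi (y + s *: e).
have dg (s : R) : is_derive s (1 : R) g (g' s) by exact: is_derive_translated_integral.
(* The support of [psi] lies in [Q] together with its translate by [t]; the segment condition
   [convQ] keeps all intermediate translates inside [Q]. *)
have g'T s : 0 <= s <= 1 -> `|g' (- t * s)| <= T.
  move=> s01.
  have sup x : support_set psi x -> Q (x - (- t * s) *: e).
    by move=> /suppU [_ [Qx Qxt]]; rewrite -scaleNr mulNr opprK mulrC; exact: convQ.
  have ts : test_function Omega (fun y => psi (y + (- t * s) *: e)).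
    by apply: (test_function_translate tpsi) => x /sup /QO.
  have := gradW _ ts i; rewrite partial_translate => H.
  have -> : g' (- t * s) = - fine (signed_integral Omega (fun B => lam B ord0 i)
      (fun y => psi (y + (- t * s) *: e))).
    by rewrite H fineN opprK.
  rewrite normrN; apply: signed_integral_norm_le => // x /= hx.
  rewrite -(addrK ((- t * s) *: e) x); apply: sup.
  exact: subset_closure.
have mvt : `|g 0 - g (- t)| <= `|t| * T.
  (* Rescaling to the unit interval treats both signs of [t] at once. *)
  pose k (s : R) := g (- t * s).
  have dk (s : R) : is_derive s (1 : R) k (g' (- t * s) * (- t)).
    have da : is_derive s (1 : R) (fun s : R => - t * s) (- t).
      rewrite (_ : (fun s : R => - t * s) = - t *: id)//.
      by apply: is_derive_eq; rewrite -[_ *: _]/(_ * _) mulr1.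
    exact: (@is_derive1_comp _ g (fun s : R => - t * s) s _ _ (dg _) da).
  have [|c] := @MVT R k (fun s => g' (- t * s) * (- t)) 0 1 ltr01 (fun s _ => dk s).
    apply: continuous_subspaceT => s.
    by apply/differentiable_continuous/derivable1_diffP; have [] := dk s.
  rewrite in_itv /= => /andP[c0 c1].
  rewrite /k mulr0 mulr1 subr0 mulr1 distrC => ->.
  by rewrite normrM normrN mulrC ler_wpM2l// g'T// !ltW.
have ipsi W' : measurable W' -> mu.-integrable W' (EFin \o psi).
  by move=> mW'; exact: integrable_test_function tpsi.
have g0 : fine (mu C) <= g 0.
  have -> : fine (mu C) = \int[mu]_(x in W) (\1_C x : R).
    rewrite Rintegral_indic// (_ : C `&` W = C)//.
    by apply/setIidPl => x /CE [].
  have -> : g 0 = \int[mu]_(x in W) psi x.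
    by apply: eq_Rintegral => x _; rewrite scale0r addr0.
  apply: le_Rintegral => //.
  - apply: (integrable_compact_support mW cC' (M := 1)).
    + exact: measurable_indic.
    + by move=> x; rewrite indicE; case: (_ \in _); rewrite ?normr1 ?normr0.
    + by move=> x nC; rewrite indicE memNset.
  - exact: ipsi.
  - move=> x _; rewrite indicE; case: (boolP (x \in C)); rewrite ?inE; first by move/psi1 ->.
    by move=> _; case/andP: (psi01 x).
(* After the change of variable x -> x + t e the integrand is the indicator of [W] at x + t e times
   [psi x]. It vanishes on [C], whose points leave [W]. *)
have gt : g (- t) <= fine (mu (U `\` C)).
  pose f x := (\1_W x : R) * psi (x - t *: e).
  have -> : g (- t) = \int[mu]_x f x.
    rewrite /g /f [LHS]Rintegral_mkcond; apply: eq_Rintegral => x _.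
    rewrite patchE indicE scaleNr; case: ifPn => _ /=; first by rewrite mul1r.
    by rewrite mul0r.
  have tst : test_function setT (fun y => psi (y + - (t *: e))).
    exact: test_function_translate tpsi _.
  have iF : mu.-integrable setT (EFin \o f).
    have [M HM] := test_function_bounded tst.
    apply: (integrable_compact_support measurableT (test_function_compact tst) (M := M)).
    - apply: measurable_funM; first exact: measurable_indic.
      exact: continuous_measurable_rV (test_function_continuous tst).
    - move=> x; rewrite /f normrM indicE; case: (_ \in _); rewrite ?normr1 ?normr0 ?mul1r ?mul0r//.
      exact: le_trans (HM x).
    - by move=> x nx; rewrite /f (test_function_out tst nx) mulr0.
  rewrite -(integral_translate (t *: e) iF).
  have -> : fine (mu (U `\` C)) = \int[mu]_x (\1_(U `\` C) x : R).
    by rewrite Rintegral_indic ?setIT//; exact: measurableD.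
  have mft : measurable_fun setT (fun y : 'rV[R]_n => f (y + t *: e)).
    case/integrableP: iF => /measurable_EFinP mf _.
    exact: (measurableT_comp mf (measurable_rV_shift (t *: e))).
  have le1 x : 0 <= f (x + t *: e) <= (\1_(U `\` C) x : R).
    rewrite /f addrK; have /andP[p0 p1] := psi01 x.
    rewrite mulr_ge0//=.
    have [sx|nsx] := pselect (support_set psi x); last first.
      by rewrite (test_function_out tpsi nsx) mulr0.
    have Ux := suppU _ sx.
    have [Cx|nCx] := pselect (C x).
      have [_ _ _ nW] := CE _ Cx.
      by rewrite [X in X * _]indicE memNset// mul0r.
    rewrite [in leRHS]indicE mem_set//; apply: le_trans p1.
    by rewrite ler_piMl// indicE; case: (_ \in _).
  have iU : mu.-integrable setT (EFin \o (fun x => \1_(U `\` C) x : R)).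
    apply: (integrable_compact_support measurableT cK (M := 1)).
    - by apply: measurable_indic; exact: measurableD.
    - by move=> x; rewrite indicE; case: (_ \in _); rewrite ?normr1 ?normr0.
    - by move=> x nK; rewrite indicE memNset// => -[[_ [/QK]]].
  apply: le_Rintegral => //.
  - apply: (integrable_compact_support measurableT cK (M := 1)) => //.
    + move=> x; have /andP[f0 f1] := le1 x; rewrite ger0_norm// (le_trans f1)//.
    + move=> x nK; apply/eqP; rewrite eq_le; have /andP[f0 f1] := le1 x; rewrite f0 andbT.
      apply: le_trans f1 _; rewrite indicE memNset// => -[[_ [/QK]]]//.
  - by move=> x _; case/andP: (le1 x).
have Cfin : mu C \is a fin_num.
  rewrite ge0_fin_numE//; apply: le_lt_trans muK; apply: le_measure; rewrite ?inE//.
  by move=> x /CE [] /QK.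
have UCfin : mu (U `\` C) \is a fin_num.
  by rewrite ge0_fin_numE// (le_lt_trans muUC)// ltry.
apply: (@le_trans _ _ (mu (C `|` (U `\` C)))).
  apply: le_measure; rewrite ?inE//; first by apply: measurableU => //; exact: measurableD.
  move=> x Ex; have [Cx|nCx] := pselect (C x); [by left|right; split => //].
  by have [? ? ? _] := Ex; split; [exact: EO|split].
have mUC : measurable (U `\` C) by exact: measurableD.
apply: le_trans (measureU2 mu mC mUC) _.
apply: (@le_trans _ _ ((fine (mu C))%:E + (fine (mu (U `\` C)))%:E)%E).
  by rewrite !fineK.
rewrite -!EFinD lee_fin.
have := muUC; rewrite -(fineK UCfin) lee_fin => h1.
have := le_trans (ler_norm _) mvt => h2.
move: g0 gt h1 h2; lra.
Qed.

End jump_estimate.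

Lemma le_measure_bigsetU {d} {T : measurableType d} {R : realType}
    (m : {measure set T -> \bar R}) (I : Type) (s : seq I) (F : I -> set T) :
  (forall i, measurable (F i)) ->
  (m (\big[setU/set0]_(i <- s) F i) <= \sum_(i <- s) m (F i))%E.
Proof.
move=> mF; elim: s => [|i s IH]; first by rewrite !big_nil measure0.
rewrite !big_cons; apply: le_trans (measureU2 _ _ _) _ => //.
  exact: bigsetU_measurable.
by rewrite leeD2l.
Qed.

(** * Open and closed cubes *)

Section cubes.
Context {R : realType} {n : nat}.
Implicit Types (Omega K Q W : set 'rV[R]_n) (c h x : 'rV[R]_n).

Let mu := @lebesgue_rV R n.

Definition cube c (d : R) := [set x : 'rV[R]_n | forall i, c ord0 i < x ord0 i < c ord0 i + d].

Definition closed_cube c (d : R) :=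
  [set x : 'rV[R]_n | forall i, x ord0 i \in `[c ord0 i, c ord0 i + d]].

Lemma cube_sub_closed c d : cube c d `<=` closed_cube c d.
Proof. by move=> x h i; rewrite in_itv /=; have /andP[/ltW -> /ltW ->] := h i. Qed.

Lemma compact_closed_cube c d : compact (closed_cube c d).
Proof. exact: (@rV_compact _ _ (fun i => `[c ord0 i, c ord0 i + d]%classic)) (fun i => @segment_compact _ _ _). Qed.

Lemma open_cube c d : open (cube c d).
Proof.
rewrite openE => x xQ.
have H i : nbhs x [set y : 'rV[R]_n | c ord0 i < y ord0 i < c ord0 i + d].
  apply: open_nbhs_nbhs; split; last exact: xQ.
  rewrite (_ : mkset _ = (fun y : 'rV[R]_n => y ord0 i) @^-1`
      `]c ord0 i, c ord0 i + d[%classic).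
    by apply: open_comp => [y _|]; [exact: coord_continuous|exact: interval_open].
  by apply/seteqP; split => y /=; rewrite in_itv.
exact: (filter_forall (nbhs_filter x) H).
Qed.

Lemma lebesgue_closed_cube c d : 0 <= d -> mu (closed_cube c d) = (d ^+ n)%:E.
Proof.
move=> d0; rewrite /mu /closed_cube lebesgue_rV_box; last by move=> i; rewrite lerDl.
under eq_bigr do rewrite addrC addKr.
by rewrite prodr_const card_ord.
Qed.

Lemma lebesgue_cube_boundary c d : 0 <= d -> mu (closed_cube c d `\` cube c d) = 0%E.
Proof.
move=> d0.
(* The boundary is covered by the 2n faces, boxes with one degenerate side and thus of measure 0. *)
pose lo (p : 'I_n * bool) j := if j == p.1 then c ord0 j + (if p.2 then d else 0) else c ord0 j.
pose hi (p : 'I_n * bool) j := if j == p.1 then c ord0 j + (if p.2 then d else 0) else c ord0 j + d.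
pose face p := [set x : 'rV[R]_n | forall j, x ord0 j \in `[lo p j, hi p j]].
have face0 p : mu (face p) = 0%E.
  rewrite /mu /face lebesgue_rV_box; last first.
    by move=> j; rewrite /lo /hi; case: eqP => // _; rewrite lerDl.
  by rewrite (bigD1 p.1)//= /lo /hi eqxx subrr mul0r.
have mface p : measurable (face p).
  apply: compact_measurable_rV; apply: (@rV_compact _ _ (fun j => `[lo p j, hi p j]%classic)) => j.
  exact: segment_compact.
have mcl : measurable (closed_cube c d) by apply: compact_measurable_rV; exact: compact_closed_cube.
have mop : measurable (cube c d) by apply: open_measurable_rV; exact: open_cube.
apply/eqP; rewrite eq_le measure_ge0 andbT.
apply: (@le_trans _ _ (mu (\big[setU/set0]_p face p))).
  apply: le_measure; rewrite ?inE; [exact: measurableD|exact: bigsetU_measurable|].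
  move=> x [xc nx]; have [i ni] : exists i, ~ (c ord0 i < x ord0 i < c ord0 i + d).
    by apply/existsNP.
  have := xc i; rewrite in_itv /= => /andP[x1 x2].
  have : x ord0 i = c ord0 i \/ x ord0 i = c ord0 i + d.
    move: ni => /negP; rewrite negb_and -!leNgt => /orP[h|h]; [left|right];
      by apply/eqP; rewrite eq_le ?x1 ?x2 ?andbT.
  have mem b : x ord0 i = c ord0 i + (if b then d else 0) -> (\big[setU/set0]_p face p) x.
    move=> xi; rewrite -bigcup_seq; exists (i, b); first by rewrite /= mem_index_enum.
    move=> j; rewrite /lo /hi /=; case: eqP => [->|_]; last exact: xc.
    by rewrite in_itv /= -xi lexx.
  by case=> xi; [apply: (mem false); rewrite addr0|exact: (mem true)].
apply: le_trans (le_measure_bigsetU _ _ mface) _.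
by rewrite big1// => p _; exact: face0.
Qed.

Lemma lebesgue_cube c d : 0 <= d -> mu (cube c d) = (d ^+ n)%:E.
Proof.
move=> d0; rewrite -(lebesgue_closed_cube c d0).
have mop : measurable (cube c d) by apply: open_measurable_rV; exact: open_cube.
have mcl : measurable (closed_cube c d) by apply: compact_measurable_rV; exact: compact_closed_cube.
have mD : measurable (closed_cube c d `\` cube c d) by exact: measurableD.
have H := measureU mu mop mD (setDIK _ _).
rewrite (setDUK (@cube_sub_closed c d)) in H; rewrite [RHS]H.
rewrite -[LHS]adde0; congr (_ + _)%E.
exact: esym (lebesgue_cube_boundary c d0).
Qed.

Lemma cube_convex c d i t x (s : R) : cube c d x -> cube c d (x + t *: delta_mx ord0 i) ->
  0 <= s <= 1 -> cube c d (x + (s * t) *: delta_mx ord0 i).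
Proof.
move=> xQ xtQ /andP[s0 s1] j; have := xQ j; have := xtQ j; rewrite !mxE eqxx /=.
case: (j == i); rewrite ?mulr1 ?mulr0 ?addr0//.
set X := x _ _; set C := c _ _ => /andP[h1 h2] /andP[h3 h4].
have E1 : X + s * t - C = (1 - s) * (X - C) + s * (X + t - C) by ring.
have E2 : C + d - (X + s * t) = (1 - s) * (C + d - X) + s * (C + d - (X + t)) by ring.
have cvx (u v : R) : 0 < u -> 0 < v -> 0 < (1 - s) * u + s * v.
  move=> u0 v0; have [->|s0'] := eqVneq s 0; first by rewrite subr0 mul1r mul0r addr0.
  by rewrite ltr_wpDl ?mulr_ge0 ?subr_ge0// ?mulr_gt0// ?ltW// lt_neqAle eq_sym s0'.
by rewrite -subr_gt0 E1 -[X in _ && X]subr_gt0 E2 !cvx ?subr_gt0.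
Qed.

Lemma cube_step c d h x i : cube c d x -> cube c d (x + h) -> `|h ord0 i| < d.
Proof.
move=> /(_ i) /andP[h1 h2] /(_ i); rewrite mxE => /andP[h3 h4].
by rewrite ltr_norml; apply/andP; split; lra.
Qed.

End cubes.

(** * The relative isoperimetric inequality on a cube *)

Section relative_isoperimetric.
Context {R : realType} {n : nat}.
Variables (Omega W : set 'rV[R]_n) (lam : set 'rV[R]_n -> 'rV[R]_n).
Hypotheses (gradW : is_gradient_measure Omega W lam) (mW : measurable W).
Variables (c : 'rV[R]_n) (d : R).
Hypotheses (d0 : 0 < d) (QO : cube c d `<=` Omega).
Hypothesis TQ : (Defs.total_variation Omega lam (cube c d) < +oo)%E.

Let mu := @lebesgue_rV R n.
Let Q := cube c d.
Let T := fine (Defs.total_variation Omega lam Q).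

Let T0 : 0 <= T. Proof. by apply: fine_ge0; exact: total_variation_ge0. Qed.

Let mQ : measurable Q. Proof. by apply: open_measurable_rV; exact: open_cube. Qed.

Let measurable_jump_set h : measurable (jump_set Q W h).
Proof.
have mQt : measurable ((fun x : 'rV[R]_n => x + h) @^-1` Q) by exact: measurable_preimage_shift.
have mWt : measurable ((fun x : 'rV[R]_n => x + h) @^-1` W) by exact: measurable_preimage_shift.
rewrite (_ : jump_set Q W h = (Q `&` W) `&`
    (((fun x : 'rV[R]_n => x + h) @^-1` Q) `\` ((fun x : 'rV[R]_n => x + h) @^-1` W))).
  by apply: measurableI; [exact: measurableI|exact: measurableD].
by apply/seteqP; split => [x [? ? ? ?]|x [[? ?] [? ?]]]; split.
Qed.

(* A jump along [h] forces a jump along one of the coordinate segments of the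
   staircase path from [x] to [x + h]. *)
Lemma jump_set_le h : (mu (jump_set Q W h) <= (n%:R * d * T)%:E)%E.
Proof.
have [[x0 [Qx0 _ Qx0h _]]|/nonemptyPn ->] := pselect (jump_set Q W h !=set0); last first.
  by rewrite measure0 lee_fin !mulr_ge0// ltW.
have hd i : `|h ord0 i| < d := cube_step i Qx0 Qx0h.
pose hp (k : nat) : 'rV[R]_n := \row_j (if (j < k)%N then h ord0 j else 0).
have hp0 : hp 0%N = 0 by apply/rowP => j; rewrite !mxE.
have hpn : hp n = h by apply/rowP => j; rewrite mxE ltn_ord.
have hpS (i : 'I_n) : hp i.+1 = hp i + h ord0 i *: delta_mx ord0 i.
  apply/rowP => j; rewrite !mxE eqxx /= ltnS.
  have [<-|ji] := eqVneq j i; first by rewrite leqnn ltnn add0r mulr1.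
  by rewrite mulr0 addr0 leq_eqVlt (inj_eq val_inj) (negbTE ji).
pose E (i : 'I_n) := (fun x : 'rV[R]_n => x + hp i) @^-1` jump_set Q W (h ord0 i *: delta_mx ord0 i).
have mE i : measurable (E i) by exact: measurable_preimage_shift.
apply: (@le_trans _ _ (mu (\big[setU/set0]_i E i))).
  apply: le_measure; rewrite ?inE//; first exact: bigsetU_measurable.
  move=> x [Qx Wx Qxh nWxh]; apply: contrapT => nE.
  have Qk k : Q (x + hp k).
    move=> j; have := Qx j; have := Qxh j; rewrite !mxE.
    by case: ifP; rewrite ?addr0.
  have WW k : (k <= n)%N -> W (x + hp k).
    elim: k => [_|k IH kn]; first by rewrite hp0 addr0.
    apply: contrapT => nW; apply: nE; rewrite -bigcup_seq.
    exists (Ordinal kn); first by rewrite /= mem_index_enum.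
    have hpE := hpS (Ordinal kn); rewrite /= in hpE.
    by split; rewrite -?addrA -?hpE//; exact/IH/ltnW.
  by apply: nWxh; rewrite -hpn; exact: WW.
apply: le_trans (le_measure_bigsetU _ _ mE) _.
rewrite (_ : (n%:R * d * T)%:E = (\sum_(i < n) (d * T)%:E)%E); last first.
  by rewrite sumEFin sumr_const card_ord -mulrA mulr_natl.
apply: lee_sum => i _; rewrite /E.
apply: (@le_trans _ _ (mu (jump_set Q W (h ord0 i *: delta_mx ord0 i)))).
  by rewrite le_eqVlt; apply/orP; left; apply/eqP; exact: lebesgue_rV_shift.
apply: (@le_trans _ _ (`|h ord0 i| * T)%:E).
  have H := @jump_estimate _ _ Omega (closed_cube c d) Q W lam i (h ord0 i) gradW mW
    (@open_cube _ _ c d) QO (@compact_closed_cube _ _ c d) (@cube_sub_closed _ _ c d) TQ.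
  by apply: H => x s; exact: cube_convex.
by rewrite lee_fin ler_wpM2r// ltW.
Qed.

(** For fixed x in [W], the shifts h that send x into [Q] minus [W] have the volume of that set.
    Exchanging the integrals gives the integral over h of the volume of the jump set; only |h| <= d
    contributes, a box of volume (2d)^n. *)
Lemma measure_mul_le :
  (mu (Q `&` W) * mu (Q `\` W) <= ((2 * d) ^+ n * (n%:R * d * T))%:E)%E.
Proof.
pose A := Q `&` W; pose B := Q `\` W.
have mA : measurable A by exact: measurableI.
have mB : measurable B by exact: measurableD.
pose Z := [set p : 'rV[R]_n * 'rV[R]_n | A p.1 /\ B (p.1 + p.2)].
have madd : measurable_fun setT (fun p : 'rV[R]_n * 'rV[R]_n => p.1 + p.2).
  apply: measurable_rV => i.
  rewrite (_ : (fun p => _) = (fun p : 'rV[R]_n * 'rV[R]_n => p.1 ord0 i + p.2 ord0 i)).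
    apply: measurable_funD.
      exact: (measurableT_comp (measurable_rV_coord i) measurable_fst).
    exact: (measurableT_comp (measurable_rV_coord i) measurable_snd).
  by apply/funext => p; rewrite mxE.
have mZ : measurable Z.
  rewrite (_ : Z = (fst @^-1` A) `&` ((fun p : 'rV[R]_n * 'rV[R]_n => p.1 + p.2) @^-1` B))//.
  apply: measurableI; rewrite -[X in measurable X]setTI; first exact: measurable_fst.
  exact: madd.
have := indic_fubini_tonelli mu mu mZ.
rewrite indic_fubini_tonelli_FE// indic_fubini_tonelli_GE// => FT.
have FE : (\int[mu]_x (mu \o xsection Z) x = mu A * mu B)%E.
  rewrite (_ : (mu \o xsection Z) = fun x => ((\1_A x)%:E * mu B)%E).
    rewrite ge0_integralZr//; first by rewrite integral_indic// setIT.
    by apply/measurable_EFinP; exact: measurable_indic.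
  apply/funext => x /=; rewrite indicE.
  have [Ax|nAx] := pselect (A x).
    rewrite mem_set// mul1e -(lebesgue_rV_shift x mB); congr (mu _).
    apply/seteqP; split => y; rewrite /xsection /= inE /=; first by case; rewrite addrC.
    by rewrite addrC.
  rewrite memNset// mul0e (_ : xsection Z x = set0) ?measure0//.
  by apply/seteqP; split => // y; rewrite /xsection /= inE => -[].
rewrite -[leLHS]FE FT.
pose D := [set h : 'rV[R]_n | `|h| <= d].
have mD : measurable D by apply: closed_measurable_rV; exact: closed_norm_le.
have nd0 : 0 <= n%:R * d * T by rewrite !mulr_ge0// ltW.
apply: (@le_trans _ _ (\int[mu]_h ((n%:R * d * T) * \1_D h)%:E)%E).
  apply: ge0_le_integral => //;
    try (by move=> h _; rewrite lee_fin mulr_ge0);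
    try (by apply/measurable_EFinP; apply: measurable_funM => //; exact: measurable_indic);
    try exact: measurable_fun_ysection.
  move=> h _ /=.
  have yZ : ysection Z h = jump_set Q W h.
    apply/seteqP; split => x; rewrite /ysection /= inE; first by move=> [[? ?] [? ?]]; split.
    by move=> [? ? ? ?]; split.
  rewrite yZ indicE; have [Dh|nDh] := pselect (D h).
    by rewrite mem_set// mulr1; exact: jump_set_le.
  rewrite memNset// mulr0 (_ : jump_set Q W h = set0) ?measure0//.
  apply/seteqP; split => // x [Qx _ Qxh _]; apply: nDh.
  by apply: rV_norm_le => [|i]; rewrite ltW//; exact: (cube_step i Qx Qxh).
under eq_integral do rewrite EFinM.
rewrite ge0_integralZl//; last by apply/measurable_EFinP; exact: measurable_indic.
rewrite integral_indic// setIT (mulrC (_ ^+ n)) [leRHS]EFinM lee_wpmul2l ?lee_fin//.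
by apply: lebesgue_rV_le_box => //; exact: ltW.
Qed.

(** Let a and b be the two volumes. Then min a b times (a + b) is at most 2ab, and a + b = d^n
    cancels the same power in the product bound; the factor 2 raises 2^n to 2^(n+1). *)
Lemma relative_isoperimetric :
  Num.min (fine (mu (Q `&` W))) (fine (mu (Q `\` W))) <= 2 ^+ n.+1 * (n%:R * d) * T.
Proof.
have muQ : mu Q = (d ^+ n)%:E by apply: lebesgue_cube; exact: ltW.
have fin A : measurable A -> A `<=` Q -> mu A \is a fin_num.
  move=> mA AQ; rewrite ge0_fin_numE//; apply: (@le_lt_trans _ _ (mu Q)).
    by apply: le_measure; rewrite ?inE.
  by rewrite muQ ltry.
have finA : mu (Q `&` W) \is a fin_num by apply: fin => //; exact: measurableI.
have finB : mu (Q `\` W) \is a fin_num by apply: fin => //; exact: measurableD.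
have sum : fine (mu (Q `&` W)) + fine (mu (Q `\` W)) = d ^+ n.
  rewrite -fineD//; apply: (@EFin_inj R); rewrite -muQ fineK; last by rewrite fin_numD finA finB.
  rewrite addeC; apply/esym; exact: measureDI.
have := measure_mul_le; move: sum.
rewrite -(fineK finA) -(fineK finB) -EFinM lee_fin /=.
set a := fine _; set b := fine _ => ab prod.
have a0 : 0 <= a by exact: fine_ge0.
have b0 : 0 <= b by exact: fine_ge0.
have dn0 : 0 < d ^+ n by exact: exprn_gt0.
have : Num.min a b * d ^+ n <= 2 * (a * b).
  rewrite -ab; have [ab'|ba'] := leP a b; nra.
move=> H; rewrite -(ler_pM2r dn0); apply: le_trans H _.
apply: le_trans (ler_wpM2l _ prod) _ => //.
by rewrite exprMn exprS le_eqVlt; apply/orP; left; apply/eqP; ring.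
Qed.

End relative_isoperimetric.

Lemma sum_measure_le {d} {T : measurableType d} {R : realType}
    (m : {measure set T -> \bar R}) (I : choiceType) (s : seq I) (F : I -> set T) K :
  uniq s -> (forall i, measurable (F i)) -> measurable K ->
  (forall i, i \in s -> F i `<=` K) -> trivIset setT F ->
  (\sum_(i <- s) m (F i) <= m K)%E.
Proof.
move=> us mF mK FK tF.
apply: (@le_trans _ _ (m (\big[setU/set0]_(i <- s) F i))).
  elim: s us {FK} => [|i s IH] /=; first by rewrite !big_nil.
  move=> /andP[iNs us]; rewrite !big_cons measureU//.
  - by rewrite leeD2l// IH.
  - exact: bigsetU_measurable.
  - rewrite -bigcup_seq; apply/seteqP; split => // x [Fix [j /= js Fjx]].
    have ij : i = j by apply: tF => //; exists x.
    by move: iNs; rewrite ij js.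
apply: le_measure; rewrite ?inE//; first exact: bigsetU_measurable.
by rewrite -bigcup_seq => x [i /= /FK]; apply.
Qed.

(** * A grid of cubes covering a bounded set *)

Section grid.
Context {R : realType} {n : nat}.

Definition grid_corner (L d : R) m (z : {ffun 'I_n -> 'I_m}) : 'rV[R]_n :=
  \row_i (- L + d * (z i)%:R).

Lemma grid_cover (L : R) m (x : 'rV[R]_n) : 0 < L -> `|x| <= L ->
  exists z : {ffun 'I_n -> 'I_m.+1},
    closed_cube (grid_corner L (2 * L / m.+1%:R) z) (2 * L / m.+1%:R) x.
Proof.
move=> L0 xL; set d := 2 * L / _.
have d0 : 0 < d by rewrite divr_gt0// mulr_gt0.
have xi i : 0 <= (x ord0 i + L) / d.
  rewrite divr_ge0// ?(ltW d0)//.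
  by have := le_trans (rV_norm_coord x i) xL; rewrite ler_norml => /andP[? _]; lra.
(* The index is capped at [m] because a coordinate equal to L belongs to the last closed cube. *)
pose z := [ffun i => inord (minn m (Num.truncn ((x ord0 i + L) / d))) : 'I_m.+1].
exists z => i; rewrite mxE ffunE inordK ?ltnS ?geq_minl// in_itv /=.
have := truncn_itv (xi i); set t := Num.truncn _ => /andP[t1 t2].
have {}t1 : d * t%:R <= x ord0 i + L by rewrite mulrC -ler_pdivlMr.
have {}t2 : x ord0 i + L < d * t.+1%:R by rewrite mulrC -ltr_pdivrMr.
have xm : x ord0 i + L <= d * m.+1%:R.
  rewrite /d divfK//; have := le_trans (rV_norm_coord x i) xL.
  by rewrite ler_norml => /andP[_ ?]; lra.
have [mt|tm] := leqP m t.
  have mt' : d * m%:R <= d * t%:R by rewrite ler_pM2l// ler_nat.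
  by move: xm; rewrite -natr1 mulrDr mulr1 => xm; apply/andP; split; lra.
by move: t2; rewrite -natr1 mulrDr mulr1 => t2; apply/andP; split; lra.
Qed.

Lemma grid_cubes_disjoint (L d : R) m : 0 < d ->
  trivIset setT (fun z : {ffun 'I_n -> 'I_m} => cube (grid_corner L d z) d).
Proof.
move=> d0 z z' _ _ [x [xz xz']]; apply/ffunP => i; apply/val_inj => /=.
have := xz i; have := xz' i; rewrite !mxE => /andP[a1 a2] /andP[b1 b2].
have lt (p q : nat) : - L + d * p%:R < x ord0 i -> x ord0 i < - L + d * q%:R + d -> (p <= q)%N.
  move=> h1 h2; rewrite -ltnS -(ltr_nat R) -natr1 -(ltr_pM2l d0) mulrDr mulr1; lra.
by apply/eqP; rewrite eqn_leq !lt.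
Qed.

Lemma cube_thicken K c d r (x : 'rV[R]_n) : 0 <= r -> d <= r -> K x -> closed_cube c d x ->
  closed_cube c d `<=` thicken K r.
Proof.
move=> r0 dr Kx xc y yc; apply/thickenP; exists x => //; apply: rV_norm_le => // i.
have := xc i; have := yc i; rewrite !mxE !in_itv /= => /andP[? ?] /andP[? ?].
by rewrite ler_norml; apply/andP; split; lra.
Qed.

End grid.

(** * Total boundedness in measure *)

Section total_boundedness.
Context {R : realType} {n : nat}.
Variable Omega : set 'rV[R]_n.
Hypotheses (Omega_open : open Omega) (Omega_bnd : bounded_set Omega).
Variables (W : nat -> set 'rV[R]_n) (lam : nat -> set 'rV[R]_n -> 'rV[R]_n).
Hypotheses (mW : forall k, measurable (W k)) (WO : forall k, W k `<=` Omega).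
Hypothesis gradW : forall k, is_gradient_measure Omega (W k) (lam k).
Hypothesis TV_bnd : forall K, compact K -> K `<=` Omega ->
  exists C : R, forall k, (Defs.total_variation Omega (lam k) K <= C%:E)%E.

Let mu := @lebesgue_rV R n.
Let mOmega : measurable Omega := open_measurable_rV Omega_open.

Lemma compact_inner_approximation (e : R) : 0 < e ->
  exists K, [/\ compact K, K `<=` Omega & (mu (Omega `\` K) < e%:E)%E].
Proof.
move=> e0.
have muO : (mrestr mu mOmega setT < +oo)%E.
  by rewrite -[X in (X < _)%E]/(mu (setT `&` Omega)) setTI; exact: lebesgue_rV_bounded.
have [C [U [cC oU CO OU HU]]] := borel_regular muO mOmega e0.
have {}HU : (mu ((U `\` C) `&` Omega) < e%:E)%E := HU.
have cC' : compact C.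
  apply: bounded_closed_compact => //.
  by have [M [Mr HM]] := Omega_bnd; exists M; split => // r Mr' x /CO; exact: HM.
exists C; split => //; apply: le_lt_trans HU; apply: le_measure; rewrite ?inE.
- by apply: measurableD => //; exact: closed_measurable_rV.
- apply: measurableI => //; apply: measurableD; first exact: open_measurable_rV.
  exact: closed_measurable_rV.
- by move=> x [Ox nC]; split => //; split => //; exact: OU.
Qed.

(* On each cube of a fine grid the relative isoperimetric inequality makes [W k]
   almost empty or almost full; the colour records which. *)
Lemma coloring (e : R) : 0 < e ->
  exists (I : finType) (col : nat -> {ffun I -> bool}),
    forall k l, col k = col l -> (mu (W k `+` W l) <= e%:E)%E.
Proof.
move=> e0; have e20 : 0 < e / 2 by rewrite divr_gt0.
have [K0 [cK0 K0O muK0]] := compact_inner_approximation e20.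
have [r r0 rO] := compact_sub_open_thicken cK0 Omega_open K0O.
pose K := thicken K0 r.
have cK : compact K by exact: compact_thicken.
have mK := compact_measurable_rV cK.
have [C0 HC0] := TV_bnd cK rO.
pose C := Num.max 0 C0.
have C_ge0 : 0 <= C by rewrite le_max lexx.
have HC k : (Defs.total_variation Omega (lam k) K <= C%:E)%E.
  by apply: le_trans (HC0 k) _; rewrite lee_fin le_max lexx orbT.
have [M [_ HM]] := Omega_bnd.
pose L := `|M| + 1.
have L0 : 0 < L by rewrite ltr_wpDl.
have OL x : Omega x -> `|x| <= L.
  by apply: HM; rewrite (le_lt_trans (ler_norm M))// ltrDl.
(* The isoperimetric constant for a cube of side 2L / (m + 1); it tends to 0 with the side, which is
   why a fine enough grid works. *)
pose B (m : nat) : R := 2 ^+ n.+1 * (n%:R * (2 * L / m.+1%:R)).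
have [m [dr BC]] : exists m : nat, 2 * L / m.+1%:R <= r /\ 2 * (B m * C) <= e / 2.
  have A0 : 0 < r / (2 * L) by rewrite divr_gt0// mulr_gt0.
  (* The added 1 keeps the divisor positive even when the variation bound is 0. *)
  pose D := 2 * (2 ^+ n.+1 * (n%:R * (2 * L)) * C) + 1.
  have D0 : 0 < D by rewrite ltr_wpDl// !mulr_ge0// ?exprn_ge0// ltW.
  have A1 : 0 < e / 2 / D by rewrite divr_gt0.
  have [N1 _ H1] := near_infty_natSinv_lt (PosNum A0).
  have [N2 _ H2] := near_infty_natSinv_lt (PosNum A1).
  exists (maxn N1 N2); split.
    have /= h := H1 _ (leq_maxl N1 N2).
    by rewrite mulrC -ler_pdivlMr ?mulr_gt0// ltW.
  have /= h := H2 _ (leq_maxr N1 N2); set u := _^-1 in h *.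
  have u0 : 0 < u by rewrite invr_gt0.
  have {}h : D * u < e / 2 by rewrite mulrC -ltr_pdivlMr.
  apply: ltW; apply: lt_trans h.
  have -> : 2 * (B (maxn N1 N2) * C) = 2 * (2 ^+ n.+1 * (n%:R * (2 * L)) * C) * u.
    by rewrite /B -/u; set p := 2 ^+ n.+1; ring.
  by rewrite /D (mulrDl _ 1 u) mul1r ltrDl.
set d := 2 * L / m.+1%:R in dr.
have d0 : 0 < d by rewrite divr_gt0// mulr_gt0.
pose I := {ffun 'I_n -> 'I_m.+1}.
pose Q (z : I) := cube (grid_corner L d z) d.
pose cQ (z : I) := closed_cube (grid_corner L d z) d.
have mQ z : measurable (Q z) by apply: open_measurable_rV; exact: open_cube.
have mcQ z : measurable (cQ z) by apply: compact_measurable_rV; exact: compact_closed_cube.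
(* Cubes that meet [K0] lie in its thickening [K], since their side is at most [r]; there the
   variations are bounded uniformly in the sequence. *)
pose good (z : I) := `[< (cQ z `&` K0) !=set0 >].
pose col k := [ffun z : I => fine (mu (Q z `&` W k)) <= fine (mu (Q z `\` W k))].
exists I, col => k l kl.
have goodK z : good z -> cQ z `<=` K.
  move=> /asboolP[x [xc Kx]]; apply: cube_thicken xc => //; exact: ltW.
pose T j z := fine (Defs.total_variation Omega (lam j) (Q z)).
have TQ j z : good z -> (Defs.total_variation Omega (lam j) (Q z) < +oo)%E.
  move=> gz; apply: le_lt_trans (ltry C); apply: le_trans (HC j).
  by apply: le_total_variation; apply: subset_trans (goodK z gz); exact: cube_sub_closed.
have finQ z A : measurable A -> A `<=` Q z -> mu A \is a fin_num.
  move=> mA AQ; rewrite ge0_fin_numE//; apply: (@le_lt_trans _ _ (mu (Q z))).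
    by apply: le_measure; rewrite ?inE.
  by rewrite [X in (X < _)%E](lebesgue_cube (grid_corner L d z) (ltW d0)) ltry.
have iso j z : good z -> Num.min (fine (mu (Q z `&` W j))) (fine (mu (Q z `\` W j))) <= B m * T j z.
  move=> gz; apply: (relative_isoperimetric (gradW j)) => //; last exact: TQ.
  apply: subset_trans (@cube_sub_closed _ _ _ _) _.
  by apply: subset_trans (goodK z gz) _.
have mD : measurable (W k `+` W l) by apply: measurableU; exact: measurableD.
(* Equal colours mean that both sets have their smaller part on the same side, so inside the cube
   their symmetric difference lies in the union of the two smaller parts. *)
have cubeD z : good z -> (mu (Q z `&` (W k `+` W l)) <= (B m * (T k z + T l z))%:E)%E.
  move=> gz.
  have mIk j : measurable (Q z `&` W j) by exact: measurableI.
  have mDk j : measurable (Q z `\` W j) by exact: measurableD.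
  have fI j : mu (Q z `&` W j) \is a fin_num by apply: (finQ z) => //; exact: subIsetl.
  have fD j : mu (Q z `\` W j) \is a fin_num by apply: (finQ z) => //; exact: subDsetl.
  have := iso k z gz; have := iso l z gz.
  have : col k z = col l z by rewrite kl.
  rewrite !ffunE; set ak := fine (mu (Q z `&` W k)); set bk := fine (mu (Q z `\` W k)).
  set al := fine (mu (Q z `&` W l)); set bl := fine (mu (Q z `\` W l)).
  have [abk|abk] := leP ak bk => /esym abl hl hk.
    rewrite (min_idPl abl) in hl.
    apply: (@le_trans _ _ (mu ((Q z `&` W k) `|` (Q z `&` W l)))).
      apply: le_measure; rewrite ?inE; [exact: measurableI|exact: measurableU|].
      by move=> x [Qx [[Wx _]|[Wx _]]]; [left|right].
    apply: le_trans (measureU2 mu (mIk k) (mIk l)) _.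
    apply: (@le_trans _ _ (ak%:E + al%:E)%E); first by rewrite !fineK.
    by rewrite -EFinD lee_fin mulrDr lerD.
  move/negbT: abl; rewrite -ltNge => /ltW abl; rewrite (min_idPr abl) in hl.
  apply: (@le_trans _ _ (mu ((Q z `\` W k) `|` (Q z `\` W l)))).
    apply: le_measure; rewrite ?inE; [exact: measurableI|exact: measurableU|].
    by move=> x [Qx [[Wx nWx]|[Wx nWx]]]; [right|left].
  apply: le_trans (measureU2 mu (mDk k) (mDk l)) _.
  apply: (@le_trans _ _ (bk%:E + bl%:E)%E); first by rewrite !fineK.
  by rewrite -EFinD lee_fin mulrDr lerD.
(* The open cubes are disjoint, so the variations add up to at most [C] however many cubes there
   are. *)
have sumT j : \sum_(z <- enum I | good z) T j z <= C.
  rewrite -big_filter -lee_fin -sumEFin.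
  have lamO : locally_finite_vmeasure Omega (lam j) by case: (gradW j).
  apply: le_trans (HC j).
  have := @sum_measure_le _ _ _ (total_variation_measure lamO) I [seq z <- enum I | good z] Q K.
  rewrite filter_uniq ?enum_uniq// => /(_ isT mQ mK) H.
  apply: le_trans (H _ _).
  - rewrite big_filter [leRHS]big_filter; apply: lee_sum => z gz.
    by rewrite /T fineK// ge0_fin_numE ?TQ// total_variation_ge0.
  - move=> z; rewrite mem_filter => /andP[gz _].
    by apply: subset_trans (goodK z gz); exact: cube_sub_closed.
  - exact: grid_cubes_disjoint.
pose S1 := \big[setU/set0]_(z <- [seq z <- enum I | good z]) (Q z `&` (W k `+` W l)).
pose S2 := \big[setU/set0]_(z <- [seq z <- enum I | good z]) (cQ z `\` Q z).
have mS1 : measurable S1 by apply: bigsetU_measurable => z _; exact: measurableI.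
have mS2 : measurable S2 by apply: bigsetU_measurable => z _; exact: measurableD.
have mK0 : measurable (Omega `\` K0).
  by apply: measurableD => //; exact: compact_measurable_rV.
(* The error splits into the volume outside [K0], the good open cubes, and the null boundaries of
   the good cubes. *)
have cover : W k `+` W l `<=` (Omega `\` K0) `|` (S1 `|` S2).
  move=> x Dx.
  have Ox : Omega x by case: Dx => -[/WO].
  have [K0x|] := pselect (K0 x); last by left.
  right; have [z xz] := grid_cover m L0 (OL x Ox); rewrite -/d in xz.
  have gz : good z by apply/asboolP; exists x.
  have zs : z \in [seq z <- enum I | good z] by rewrite mem_filter gz mem_enum.
  have [Qx|nQx] := pselect (Q z x); [left; rewrite /S1|right; rewrite /S2];
    by rewrite -bigcup_seq; exists z.
apply: (@le_trans _ _ (mu ((Omega `\` K0) `|` (S1 `|` S2)))).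
  by apply: le_measure; rewrite ?inE//; do 2 apply: measurableU => //.
have mS12 : measurable (S1 `|` S2) by exact: measurableU.
apply: le_trans (measureU2 mu mK0 mS12) _.
rewrite [in leRHS](splitr e) EFinD; apply: leeD; first exact: ltW.
apply: le_trans (measureU2 mu mS1 mS2) _.
have S20 : (mu S2 <= 0)%E.
  apply: le_trans (le_measure_bigsetU _ _ _) _; first by move=> z; exact: measurableD.
  by rewrite big1// => z _; exact: (lebesgue_cube_boundary _ (ltW d0)).
apply: (@le_trans _ _ (mu S1 + 0)%E); first by rewrite leeD2l.
rewrite adde0.
apply: le_trans (le_measure_bigsetU _ _ _) _; first by move=> z; exact: measurableI.
rewrite big_filter.
apply: (@le_trans _ _ (\sum_(z <- enum I | good z) (B m * (T k z + T l z))%:E)%E).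
  by apply: lee_sum => z gz; exact: cubeD.
rewrite sumEFin lee_fin -mulr_sumr big_split /=; apply: le_trans BC.
rewrite mulrCA; apply: ler_wpM2l.
  by rewrite /B !mulr_ge0// ?exprn_ge0// ?invr_ge0// ltW.
by rewrite mulr_natl mulr2n lerD.
Qed.

End total_boundedness.

(** * Cauchy subsequences and their upper limit sets *)

Section symmetric_difference_distance.
Context {d} {T : measurableType d} {R : realType} (mu : {measure set T -> \bar R}).

(** Otherwise the complements of all fibres belong to [U], and so does their finite intersection,
    which is empty. *)
Lemma ultrafilter_finite_fiber (U : set_system nat) (I : finType) (col : nat -> I) :
  UltraFilter U -> exists i, U [set k | col k = i].
Proof.
move=> UU; apply: contrapT => nex.
have H i : U [set k | col k <> i].
  have [Ui|//] := in_ultra_setVsetC [set k | col k = i] UU.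
  by exfalso; apply: nex; exists i.
have UF : Filter U by exact: filter_filter.
by have [k /(_ (col k))] := filter_ex (filter_forall UF H).
Qed.

(** The ultrafilter selects a large colour class at every scale at once, for all components, and so
    replaces repeated extraction and a diagonal argument. The index [s j] is taken in the classes of
    scales 0 to j and beyond j. *)
Lemma totally_bounded_cauchy_subsequence N (W : nat -> 'I_N -> set T) :
  (forall i (e : R), 0 < e -> exists (I : finType) (col : nat -> I),
     forall k l, col k = col l -> (mu (W k i `+` W l i) <= e%:E)%E) ->
  exists s : nat -> nat, (forall j, (j <= s j)%N) /\
    forall i j l, (j <= l)%N ->
      (mu (W (s j) i `+` W (s l) i) <= ((2 ^ j.+1)%:R^-1)%:E)%E.
Proof.
move=> HW.
have [U [UU sU]] := ultraFilterLemma eventually_filter.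
have UF : Filter U by exact: filter_filter.
have e0 j : 0 < (2 ^ j.+1)%:R^-1 :> R by rewrite invr_gt0 ltr0n expn_gt0.
have /choice[A HA] : forall j, exists A, U A /\ forall i k l, A k -> A l ->
    (mu (W k i `+` W l i) <= ((2 ^ j.+1)%:R^-1)%:E)%E.
  move=> j.
  have /choice[A HA] : forall i, exists A, U A /\ forall k l, A k -> A l ->
      (mu (W k i `+` W l i) <= ((2 ^ j.+1)%:R^-1)%:E)%E.
    move=> i; have [I [col Hcol]] := HW i _ (e0 j).
    have [t Ut] := ultrafilter_finite_fiber col UU.
    by exists [set k | col k = t]; split => // k l /= kt lt; apply: Hcol; rewrite kt lt.
  exists [set k | forall i, A i k]; split.
    by apply: (filter_forall UF) => i; have [] := HA i.
  by move=> i k l Ak Al; have [_] := HA i; apply.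
have /choice[s Hs] : forall j, exists k, (forall i : 'I_j.+1, A i k) /\ (j <= k)%N.
  move=> j; apply: (@filter_ex _ U); apply: filterI.
    by apply: (filter_forall UF) => i; have [] := HA i.
  by apply: sU; exists j.
exists s; split => [j|i j l jl]; first by have [] := Hs j.
have [_] := HA j; apply.
  by have [/(_ ord_max)] := Hs j.
by have [/(_ (Ordinal (jl : (j < l.+1)%N)))] := Hs l.
Qed.

Variable V : nat -> set T.
Hypothesis mV : forall j, measurable (V j).
Hypothesis VV : forall j, (mu (V j `+` V j.+1) <= ((2 ^ j.+1)%:R^-1)%:E)%E.

(** The points whose membership still changes after index m. The bounds 2^-(m+i+1) sum to 2^-m, and
    off this set the sequence is constant from m on. *)
Let D m := \bigcup_i (V (m + i)%N `+` V (m + i).+1).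

Let mD m : measurable (D m).
Proof.
by apply: bigcup_measurable => i _; apply: measurableU; exact: measurableD.
Qed.

Let muD m : (mu (D m) <= ((2 ^ m)%:R^-1)%:E)%E.
Proof.
apply: (@le_trans _ _ (\sum_(i <oo) mu (V (m + i)%N `+` V (m + i).+1))%E).
  apply: measure_sigma_subadditive => //.
  by move=> i; apply: measurableU; exact: measurableD.
have c0 : 0 <= (2 ^ m)%:R^-1 :> R by rewrite invr_ge0.
apply: le_trans (epsilon_trick0 xpredT c0).
apply: lee_nneseries => // i _; apply: le_trans (VV _) _.
by rewrite lee_fin -addnS expnD natrM invfM.
Qed.

Lemma lim_sup_set_eq m x : ~ D m x -> forall l, (m <= l)%N -> V l x <-> lim_sup_set V x.
Proof.
move=> nD.
have step i : V (m + i)%N x <-> V (m + i).+1 x.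
  split=> h; apply: contrapT => nh; apply: nD; exists i => //; by [left|right].
have const i : V (m + i)%N x <-> V m x.
  by elim: i => [|i IH]; rewrite ?addn0// addnS -step.
move=> l ml; rewrite -(subnKC ml) const; split=> [Vm|].
  move=> k _; exists (m + k)%N; first by rewrite /= leq_addl.
  exact/const.
by move=> /(_ m I) [k /= mk]; rewrite -(subnKC mk) const.
Qed.

Lemma lim_sup_set_measurable : measurable (lim_sup_set V).
Proof.
by apply: bigcap_measurable => // m _; apply: bigcup_measurable.
Qed.

Lemma lim_sup_set_dist m : (mu (V m `+` lim_sup_set V) <= ((2 ^ m)%:R^-1)%:E)%E.
Proof.
apply: le_trans (muD m); apply: le_measure; rewrite ?inE//.
  by apply: measurableU; apply: measurableD => //; exact: lim_sup_set_measurable.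
move=> x Vx; apply: contrapT => /lim_sup_set_eq /(_ m (leqnn m)).
by case: Vx => -[h1 h2] [h3 h4]; [apply: h2; exact: h3|apply: h2; exact: h4].
Qed.

Lemma ae_eventually_lim_sup_set :
  {ae mu, forall x, exists m, forall l, (m <= l)%N -> V l x <-> lim_sup_set V x}.
Proof.
exists (\bigcap_m D m); split.
- exact: bigcapT_measurable.
- apply/eqP; rewrite eq_le measure_ge0 andbT.
  apply/lee_addgt0Pr => e e0; rewrite add0e.
  have [m _ /(_ m (leqnn m)) /= me] := near_infty_natSinv_expn_lt (PosNum e0).
  apply: (@le_trans _ _ (mu (D m))).
    by apply: le_measure; rewrite ?inE//; [exact: bigcapT_measurable|exact: bigcap_inf].
  apply: le_trans (muD m) _; rewrite lee_fin natrX; apply: ltW.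
  by move: me; rewrite div1r.
- move=> x /= nx m _; apply: contrapT => nD; apply: nx; exists m.
  exact: lim_sup_set_eq.
Qed.

End symmetric_difference_distance.

(** * From a content on compact sets to a Borel measure *)

Section content.
Context {R : realType} {n : nat}.
Implicit Types (A B K O U V X : set 'rV[R]_n).
Variables (Omega : set 'rV[R]_n) (c : set 'rV[R]_n -> R).
Hypotheses (c0 : c set0 = 0)
  (le_c : forall K K', compact K -> compact K' -> K `<=` K' -> K' `<=` Omega ->
     c K <= c K')
  (c_subadditive : forall K K', compact K -> compact K' ->
     K `<=` Omega -> K' `<=` Omega -> c (K `|` K') <= c K + c K')
  (c_superadditive : forall K K', compact K -> compact K' ->
     K `<=` Omega -> K' `<=` Omega -> K `&` K' = set0 ->
     c K + c K' <= c (K `|` K')).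

Definition inner_content O : \bar R :=
  ereal_sup [set (c K)%:E | K in [set K | compact K /\ K `<=` O `&` Omega]].

Definition outer_content A : \bar R :=
  ereal_inf [set inner_content O | O in [set O | open O /\ A `<=` O]].

Lemma content_le_inner K O : compact K -> K `<=` Omega -> K `<=` O ->
  ((c K)%:E <= inner_content O)%E.
Proof.
move=> cK KO KU; apply: ereal_sup_ubound; exists K => //; split => // x Kx.
by split; [exact: KU|exact: KO].
Qed.

Lemma inner_content_ge0 O : (0 <= inner_content O)%E.
Proof. by rewrite -[0%E]/(0%:E) -c0; apply: content_le_inner => //; exact: compact0. Qed.

Lemma outer_content_ge0 A : (0 <= outer_content A)%E.
Proof. by apply: le_ereal_inf_tmp => _ [ O _ <-]; exact: inner_content_ge0. Qed.

Lemma outer_le_inner_content A O : open O -> A `<=` O ->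
  (outer_content A <= inner_content O)%E.
Proof. by move=> oO AO; apply: ereal_inf_lbound; exists O. Qed.

Lemma inner_content0 : inner_content set0 = 0%E.
Proof.
apply/eqP; rewrite eq_le inner_content_ge0 andbT.
apply: ge_ereal_sup => _ [K [_ K0] <-].
have -> : K = set0 by apply/seteqP; split => // x /K0[].
by rewrite c0.
Qed.

Lemma outer_content0 : outer_content set0 = 0%E.
Proof.
apply/eqP; rewrite eq_le outer_content_ge0 andbT -inner_content0.
by apply: outer_le_inner_content => //; exact: open0.
Qed.

Lemma le_outer_content : {homo outer_content : A B / A `<=` B >-> (A <= B)%E}.
Proof.
move=> A B AB; apply: le_ereal_inf_tmp => _ [ O [oO BO] <-].
by apply: outer_le_inner_content => // x /AB /BO.
Qed.

Lemma content_le_sum (O : nat -> set 'rV[R]_n) m K : (forall i, open (O i)) ->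
  compact K -> K `<=` Omega -> K `<=` \big[setU/set0]_(i < m) O i ->
  ((c K)%:E <= \sum_(i < m) inner_content (O i))%E.
Proof.
move=> oO; elim: m K => [|m IH] K cK KO.
  by rewrite !big_ord0 => K0; rewrite (_ : K = set0) ?c0//; apply/seteqP; split.
rewrite !big_ord_recr/=; set A := \big[setU/set0]_(i < m) O i => KA.
have oA : open A.
  by rewrite /A; elim/big_ind: _ => // ? ? ? ?; exact: openU.
(* [K] is split in two: a compact part near [K] minus [A], kept inside the last open set by the
   neighbourhood [V], and the compact remainder [K] minus [V], which lies in [A]. *)
have cKA : compact (K `\` A).
  apply: (subclosed_compact_rV _ cK); last by move=> x [].
  by apply: closedI; [exact: compact_rV_closed|exact: open_closedC].
have KAO : K `\` A `<=` O m by move=> x [/KA[Ax /(_ Ax)|]].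
have [V [oV KAV cV VO]] := compact_sub_open_nbhs cKA (oO m) KAO.
have cK1 : compact (K `\` V).
  apply: (subclosed_compact_rV _ cK); last by move=> x [].
  by apply: closedI; [exact: compact_rV_closed|exact: open_closedC].
have cK2 : compact (K `&` closure V).
  apply: (subclosed_compact_rV _ cV); last by move=> x [].
  by apply: closedI; [exact: compact_rV_closed|exact: closed_closure].
have KE : K = (K `\` V) `|` (K `&` closure V).
  apply/seteqP; split => [x Kx|x [[]|[]]//].
  have [Vx|nVx] := pselect (V x); last by left.
  by right; split => //; exact: subset_closure.
apply: (@le_trans _ _ (c (K `\` V) + c (K `&` closure V))%:E).
  by rewrite lee_fin {1}KE; apply: c_subadditive => // x [/KO].
rewrite EFinD; apply: leeD.
  apply: IH => // [x [/KO]//|x [Kx nVx]].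
  by apply: contrapT => nAx; apply: nVx; exact: KAV.
by apply: content_le_inner => // x []; [move=> /KO|move=> _ /VO].
Qed.

Lemma inner_content_sigma_subadditive (O : nat -> set 'rV[R]_n) :
  (forall i, open (O i)) ->
  (inner_content (\bigcup_i O i) <= \sum_(i <oo) inner_content (O i))%E.
Proof.
move=> oO; apply: ge_ereal_sup => _ [K [cK KO] <-].
have KU : K `<=` \bigcup_i O i by move=> x /KO[].
have := cK; rewrite compact_cover => /(_ nat setT O (fun i _ => oO i) KU)[D _ KD].
have KO' : K `<=` Omega by move=> x /KO[].
pose M := (\max_(i <- finmap.enum_fset D) i)%N.+1.
apply: (@le_trans _ _ (\sum_(0 <= i < M) inner_content (O i))%E).
  rewrite big_mkord.
  apply: content_le_sum => // x /KD[i /= iD Oi].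
  rewrite -bigcup_mkord; exists i => //=; rewrite ltnS.
  by apply: leq_bigmax_seq.
apply: nneseries_lim_ge => k *; exact: inner_content_ge0.
Qed.

Lemma outer_content_sigma_subadditive : sigma_subadditive outer_content.
Proof.
move=> F; have [[i ioo]|/forallNP Foo] :=
  pselect (exists i, outer_content (F i) = +oo%E).
  rewrite (eseries_pinfty _ _ ioo) ?leey// => k _.
  by rewrite -ltNye (lt_le_trans _ (outer_content_ge0 _)).
apply/lee_addgt0Pr => e e0.
apply: le_trans (epsilon_trick _ _ (ltW e0)); last first.
  by move=> k; exact: outer_content_ge0.
have /choice[ O PO] k : exists O, [/\ open O, F k `<=` O &
    (inner_content O <= outer_content (F k) + (e / (2 ^ k.+1)%:R)%:E)%E].
  have ek : 0 < e / (2 ^ k.+1)%:R by rewrite divr_gt0// ltr0n expn_gt0.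
  have ffin : outer_content (F k) \is a fin_num.
    by rewrite ge0_fin_numE ?outer_content_ge0// ltey; apply/eqP/Foo.
  have [_ [ O [oO FO] <-] lO] := lb_ereal_inf_adherent ek ffin.
  by exists O; split => //; exact: ltW.
apply: (@le_trans _ _ (inner_content (\bigcup_i O i))).
  apply: outer_le_inner_content; first by apply: bigcup_open => i _; case: (PO i).
  by apply: subset_bigcup => i _; case: (PO i).
apply: le_trans (inner_content_sigma_subadditive _) _; first by move=> i; case: (PO i).
apply: lee_nneseries => k _; first by move=> _; exact: inner_content_ge0.
by case: (PO k).
Qed.

HB.instance Definition _ := isOuterMeasure.Build R _ outer_content
  outer_content0 outer_content_ge0 le_outer_content
  outer_content_sigma_subadditive.

(** Given an open [V] around [X], exhaust the intersection of [U] and [V] by a compact [K], and then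
    the open set [V] minus [K] by a compact [K']. Superadditivity on these disjoint sets gives the
    splitting inequality. *)
Lemma open_caratheodory U : open U -> outer_content.-caratheodory U.
Proof.
move=> oU; apply: le_caratheodory_measurable => X.
apply: le_ereal_inf_tmp => _ [V [oV XV] <-].
have [->|Voo] := eqVneq (inner_content V) +oo%E; first exact: leey.
have fin A : A `<=` V -> outer_content A \is a fin_num.
  move=> AV; rewrite ge0_fin_numE ?outer_content_ge0//.
  apply: (@le_lt_trans _ _ (inner_content V)); last by rewrite ltey.
  exact: outer_le_inner_content.
rewrite -leeBrDr; last by apply: fin => x [] /XV.
apply: (@le_trans _ _ (inner_content (U `&` V))).
  apply: outer_le_inner_content; first exact: openI.
  by move=> x [/XV Vx Ux].
apply: ge_ereal_sup => _ [K [cK KUV] <-].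
rewrite leeBrDr; last by apply: fin => x [] /XV.
rewrite addeC -leeBrDr//.
apply: (@le_trans _ _ (inner_content (V `\` K))).
  apply: outer_le_inner_content.
    apply: openI => //; apply: closed_openC; exact: compact_rV_closed.
  by move=> x [/XV Vx nU]; split => // /KUV[[/nU]].
apply: ge_ereal_sup => _ [K' [cK' KVK] <-].
rewrite leeBrDr// -EFinD addrC.
have KO : K `<=` Omega by move=> x /KUV[].
have KO' : K' `<=` Omega by move=> x /KVK[].
apply: (@le_trans _ _ (c (K `|` K'))%:E).
  rewrite lee_fin; apply: c_superadditive => //.
  by apply/seteqP; split => // x [Kx /KVK[[_ /(_ Kx)]]].
apply: content_le_inner; first exact: compactU.
  by move=> x [/KO|/KO'].
by move=> x [/KUV[[]]|/KVK[[]]].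
Qed.

Lemma measurable_caratheodory A : measurable A -> outer_content.-caratheodory A.
Proof.
move: A; apply: smallest_sub; last exact: open_caratheodory.
split.
- exact: caratheodory_measurable_set0.
- by move=> A cA; rewrite setTD; exact: caratheodory_measurable_setC.
- by move=> F cF; exact: caratheodory_measurable_bigcup.
Qed.

Lemma outer_content_semi_sigma_additive :
  semi_sigma_additive (outer_content : set 'rV[R]_n -> \bar R).
Proof.
move=> F mF tF mUF.
apply: (@caratheodory_measure_sigma_additive R 'rV[R]_n outer_content F) => //.
- by move=> k; exact: measurable_caratheodory.
- exact: measurable_caratheodory.
Qed.

(** Only one-sided comparisons on compact and on open sets are asserted, since the content may be
    strictly smaller than the measure on a compact set. *)
Lemma content_extension : exists m : {measure set 'rV[R]_n -> \bar R},
  (forall K, compact K -> K `<=` Omega -> ((c K)%:E <= m K)%E) /\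
  (forall U K, open U -> U `<=` K -> compact K -> K `<=` Omega ->
     (m U <= (c K)%:E)%E).
Proof.
pose m : {measure set 'rV[R]_n -> \bar R} :=
  HB.pack outer_content (isMeasure.Build _ _ _ outer_content outer_content0
    outer_content_ge0 outer_content_semi_sigma_additive).
exists m; split.
  move=> K cK KO; apply: le_ereal_inf_tmp => _ [ O [oO KU] <-].
  exact: content_le_inner.
move=> U K oU UK cK KO.
apply: le_trans (outer_le_inner_content oU (@subset_refl _ U)) _.
apply: ge_ereal_sup => _ [K' [cK' KU'] <-]; rewrite lee_fin.
by apply: le_c => // x /KU'[/UK].
Qed.

End content.

(** * Limits of measures along an ultrafilter *)

Lemma ultrafilter_bounded_cvg {R : realType} (U : set_system nat) (u : nat -> R) (C : R) :
  UltraFilter U -> (forall k, `|u k| <= C) -> cvg (u k @[k --> U]).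
Proof.
move=> UU uC; have UF : ProperFilter U by exact: ultra_proper.
have := @segment_compact R (- C) C (u k @[k --> U]) _ _.
case=> [|l [_ ul]].
  by apply: nearW => k /=; rewrite in_itv /= -ler_norml.
apply/cvg_ex; exists l => A lA.
have [//|UA] := in_ultra_setVsetC [set k | A (u k)] UU.
by have [x []] := ul (~` A) A UA lA.
Qed.

(* Each [p k] need only behave as a measure inside each compact subset of [Omega]. *)
Definition locally_bounded_measures {R : realType} {n : nat} (Omega : set 'rV[R]_n)
    (p : nat -> set 'rV[R]_n -> \bar R) :=
  forall K, compact K -> K `<=` Omega -> exists C : R, forall k,
    exists q : {measure set 'rV[R]_n -> \bar R}, (q K <= C%:E)%E /\
      forall B, measurable B -> B `<=` K -> p k B = q B.

Section ultralimit_of_measures.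
Context {R : realType} {n : nat}.
Implicit Types (B K S V : set 'rV[R]_n) (phi : 'rV[R]_n -> R).
Variables (Omega : set 'rV[R]_n) (U : set_system nat) (UU : UltraFilter U).
Variable p : nat -> set 'rV[R]_n -> \bar R.
Hypothesis Omega_open : open Omega.
Hypothesis pK : locally_bounded_measures Omega p.

Let UF : ProperFilter U := ultra_proper.

Let c K : R := lim (fine (p k K) @[k --> U]).

Let c_cvg K : compact K -> K `<=` Omega -> fine (p k K) @[k --> U] --> c K.
Proof.
move=> cK KO; have [C pC] := pK cK KO.
apply: (@ultrafilter_bounded_cvg R U _ C UU) => k.
have [q [qC ->//]] := pC k; last exact: compact_measurable_rV.
have qf : q K \is a fin_num by rewrite ge0_fin_numE// (le_lt_trans qC)// ltry.
by rewrite ger0_norm ?fine_ge0// -lee_fin fineK.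
Qed.

Let c0 : c set0 = 0.
Proof.
have p0 k : p k set0 = 0%E.
  by have [C /(_ k)[q [_ ->//]]] := pK (@compact0 _) (@sub0set _ Omega).
rewrite /c; under eq_fun do rewrite p0.
exact: lim_cst.
Qed.

Let le_c K K' : compact K -> compact K' -> K `<=` K' -> K' `<=` Omega -> c K <= c K'.
Proof.
move=> cK cK' KK' KO'; have KO := subset_trans KK' KO'.
apply: ler_cvg_to (c_cvg cK KO) (c_cvg cK' KO') _; apply: nearW => k.
have [C /(_ k)[q [qC pq]]] := pK cK' KO'.
have mK := compact_measurable_rV cK; have mK' := compact_measurable_rV cK'.
have qf : (q K' < +oo)%E by rewrite (le_lt_trans qC)// ltry.
have qKK : (q K <= q K')%E by apply: le_measure => //; rewrite inE.
by rewrite !pq// fine_le// ge0_fin_numE// (le_lt_trans qKK).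
Qed.

Let p_union K K' k : compact K -> compact K' -> K `|` K' `<=` Omega ->
  fine (p k (K `|` K')) <= fine (p k K) + fine (p k K') /\
  (K `&` K' = set0 -> fine (p k K) + fine (p k K') <= fine (p k (K `|` K'))).
Proof.
move=> cK cK' KKO; have [C /(_ k)[q [qC pq]]] := pK (compactU cK cK') KKO.
have mK := compact_measurable_rV cK; have mK' := compact_measurable_rV cK'.
have mKK := measurableU _ _ mK mK'.
have qf B : measurable B -> B `<=` K `|` K' -> q B \is a fin_num.
  by move=> mB BK; apply: sub_measure_fin_num BK _ => //; exact: le_lt_trans qC (ltry C).
rewrite (pq (K `|` K'))// (pq K)// (pq K')// -!lee_fin EFinD !fineK ?qf//.
by split => [|KK0]; [exact: measureU2|rewrite measureU].
Qed.

Let c_subadditive K K' : compact K -> compact K' -> K `<=` Omega -> K' `<=` Omega ->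
  c (K `|` K') <= c K + c K'.
Proof.
move=> cK cK' KO KO'.
have KKO : K `|` K' `<=` Omega by move=> x [/KO|/KO'].
apply: ler_cvg_to (c_cvg (compactU cK cK') KKO) (cvgD (c_cvg cK KO) (c_cvg cK' KO')) _.
by apply: nearW => k; have [] := p_union k cK cK' KKO.
Qed.

Let c_superadditive K K' : compact K -> compact K' -> K `<=` Omega -> K' `<=` Omega ->
  K `&` K' = set0 -> c K + c K' <= c (K `|` K').
Proof.
move=> cK cK' KO KO' KK0.
have KKO : K `|` K' `<=` Omega by move=> x [/KO|/KO'].
apply: ler_cvg_to (cvgD (c_cvg cK KO) (c_cvg cK' KO')) (c_cvg (compactU cK cK') KKO) _.
by apply: nearW => k; have [_] := p_union k cK cK' KKO; apply.
Qed.

(** Both the limit of the integrals and the integral against the extension are squeezed between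
    layer sums. The two sums differ by at most a shift of one layer, whose cost is the mass of [S]
    divided by the number of layers. *)
Lemma ultralimit_measure : exists m : {measure set 'rV[R]_n -> \bar R},
  (forall K, compact K -> K `<=` Omega -> (m K < +oo)%E) /\
  forall S phi, compact S -> S `<=` Omega -> continuous phi ->
    (forall x, 0 <= phi x <= 1) -> (forall x, ~ S x -> phi x = 0) ->
    fine (\int[p k]_(x in S) (phi x)%:E)%E @[k --> U] -->
      fine (\int[m]_(x in S) (phi x)%:E)%E.
Proof.
have [m [cm mc]] := content_extension c0 le_c c_subadditive c_superadditive.
have mfin K : compact K -> K `<=` Omega -> (m K < +oo)%E.
  move=> cK KO; have [V [oV KV cV VO]] := compact_sub_open_nbhs cK Omega_open KO.
  apply: (@le_lt_trans _ _ (m V)).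
    by apply: le_measure => //; rewrite inE; [exact: compact_measurable_rV|exact: open_measurable_rV].
  by apply: le_lt_trans (mc V (closure V) oV (@subset_closure _ _) cV VO) (ltry _).
have FU : Filter U by exact: filter_filter.
exists m; split => // S phi cS SO cphi phi01 phi0.
have mphi := continuous_measurable_rV cphi.
have mS := compact_measurable_rV cS.
have [C pC] := pK cS SO.
have LS M j : layer phi M j `<=` S.
  move=> x /= h; apply: contrapT => /phi0 px.
  by move: h; rewrite /layer /= px leNgt divr_gt0.
have SL M j : S `&` layer phi M j = layer phi M j by exact/setIidPr/LS.
have mL M j : measurable (layer phi M j) by exact: measurable_superlevel.
have cL M j : compact (layer phi M j).
  apply: (subclosed_compact_rV _ cS); last exact: LS.
  rewrite (_ : layer _ _ _ = phi @^-1` [set t | j.+1%:R / M.+1%:R <= t]) //.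
  by apply: closed_comp; [move=> x _; exact: cphi|exact: closed_ge].
have LO M j : layer phi M j `<=` Omega by move=> x /LS /SO.
have mSf : m S \is a fin_num by rewrite ge0_fin_numE// mfin.
have mLf M j : m (layer phi M j) \is a fin_num.
  by rewrite ge0_fin_numE// mfin.
pose I k := fine (\int[p k]_(x in S) (phi x)%:E)%E.
pose A k M := M.+1%:R^-1 * \sum_(j < M.+1) fine (p k (layer phi M j)).
have IA k M : A k M <= I k <= A k M + M.+1%:R^-1 * fine (p k S).
  have [q [qC pq]] := pC k.
  have qS : (q S < +oo)%E by rewrite (le_lt_trans qC)// ltry.
  have := layer_integral mS qS mphi phi01 M.
  rewrite /I (integral_eq_on_compact (m1 := p k) (m2 := q) (K := S))//.
  have -> : A k M = M.+1%:R^-1 * \sum_(j < M.+1) fine (q (S `&` layer phi M j)).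
    by congr (_ * _); apply: eq_bigr => j _; rewrite SL pq//; exact: LS.
  by rewrite (pq S)//.
have pf k B : measurable B -> B `<=` S -> 0 <= fine (p k B) <= C.
  move=> mB BS; have [q [qC ->//]] := pC k.
  have qBC : (q B <= C%:E)%E.
    by apply: le_trans qC; apply: le_measure => //; rewrite inE.
  have qf : q B \is a fin_num by rewrite ge0_fin_numE// (le_lt_trans qBC)// ltry.
  by rewrite fine_ge0//= -lee_fin fineK.
have /cvg_ex[i Ii] : cvg (I k @[k --> U]).
  apply: (@ultrafilter_bounded_cvg R U _ (C + C) UU) => k.
  have /andP[I1 I2] := IA k 0%N; move: I1 I2; rewrite /A !big_ord1 invr1 !mul1r.
  have /andP[a1 a2] := pf k _ (mL 0%N 0%N) (@LS 0%N 0%N).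
  have /andP[b1 b2] := pf k _ mS (@subset_refl _ S).
  by move=> I1 I2; rewrite ger0_norm; lra.
have Ai M : M.+1%:R^-1 * \sum_(j < M.+1) c (layer phi M j) <= i <=
    M.+1%:R^-1 * \sum_(j < M.+1) c (layer phi M j) + M.+1%:R^-1 * c S.
  have AM : A k M @[k --> U] --> M.+1%:R^-1 * \sum_(j < M.+1) c (layer phi M j).
    rewrite /A; apply: cvgMl_tmp; apply: cvg_big => [|j _].
      exact: add_continuous.
    exact: (c_cvg (@cL M j) (@LO M j)).
  apply/andP; split.
    by apply: ler_cvg_to AM Ii _; apply: nearW => k; have /andP[] := IA k M.
  apply: ler_cvg_to Ii (cvgD AM (cvgMl_tmp (c_cvg cS SO))) _.
  by apply: nearW => k; have /andP[] := IA k M.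
pose J := fine (\int[m]_(x in S) (phi x)%:E)%E.
have Jb M : M.+1%:R^-1 * \sum_(j < M.+1) fine (m (layer phi M j)) <= J <=
    M.+1%:R^-1 * \sum_(j < M.+1) fine (m (layer phi M j)) + M.+1%:R^-1 * fine (m S).
  have := layer_integral mS (mfin _ cS SO) mphi phi01 M.
  by under eq_bigr do rewrite SL.
have cmf K : compact K -> K `<=` Omega -> c K <= fine (m K).
  move=> cK KO; rewrite -lee_fin fineK; first exact: cm.
  by rewrite ge0_fin_numE// mfin.
(* A closed layer lies in the open superlevel set one step lower, whose measure is at most the
   content of the closed layer of that height. The shift leaves the lowest layer over, bounded by
   the mass of [S]. *)
have sums M : \sum_(j < M.+1) fine (m (layer phi M j)) <=
    \sum_(j < M.+1) c (layer phi M j) + fine (m S).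
  rewrite big_ord_recl addrC; apply: lerD; last first.
    by apply: fine_le => //; apply: le_measure => //; rewrite inE.
  rewrite big_ord_recr /= -[leLHS]addr0; apply: lerD; last first.
    by have := le_c (@compact0 _) (@cL M M) (@sub0set _ _) (@LO M M); rewrite c0.
  apply: ler_sum => j _; rewrite -lee_fin fineK// /bump add1n.
  apply: (@le_trans _ _ (m [set x | j.+1%:R / M.+1%:R < phi x])).
    apply: le_measure; rewrite ?inE//.
      apply: open_measurable_rV; rewrite (_ : mkset _ = phi @^-1` [set t | j.+1%:R / M.+1%:R < t]) //.
      by apply: open_comp; [move=> x _; exact: cphi|exact: open_gt].
    move=> x /=; apply: lt_le_trans; rewrite ltr_pM2r ?invr_gt0//.
    by rewrite ltr_nat.
  apply: mc => //.
    rewrite (_ : mkset _ = phi @^-1` [set t | j.+1%:R / M.+1%:R < t]) //.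
    by apply: open_comp; [move=> x _; exact: cphi|exact: open_gt].
  by move=> x /=; exact: ltW.
suff JE : J = i by rewrite -/J JE; exact: Ii.
apply/eqP; rewrite -subr_eq0 -normr_le0; apply/ler_addgt0Pl => e e0; rewrite addr0.
have mS0 : 0 <= fine (m S) by exact: fine_ge0.
(* Two error terms of size m S / (M + 1) remain; the added 1 makes the divisor positive. *)
have [M _ /(_ M (leqnn _)) Me] := near_infty_natSinv_lt
  (PosNum (divr_gt0 e0 (ltr_wpDl (mulr_ge0 (ler0n R 2) mS0) ltr01))).
rewrite /= ltr_pdivlMr in Me; last by rewrite ltr_wpDl// mulr_ge0.
have M0 : 0 < M.+1%:R^-1 :> R by [].
have /andP[i1 i2] := Ai M; have /andP[j1 j2] := Jb M.
have s1 : M.+1%:R^-1 * \sum_(j < M.+1) fine (m (layer phi M j)) <=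
    M.+1%:R^-1 * \sum_(j < M.+1) c (layer phi M j) + M.+1%:R^-1 * fine (m S).
  by rewrite -mulrDr ler_wpM2l// ltW.
have s2 : M.+1%:R^-1 * \sum_(j < M.+1) c (layer phi M j) <=
    M.+1%:R^-1 * \sum_(j < M.+1) fine (m (layer phi M j)).
  by rewrite ler_wpM2l// ?(ltW M0)//; apply: ler_sum => j _; exact: cmf.
have s3 : M.+1%:R^-1 * c S <= M.+1%:R^-1 * fine (m S).
  by rewrite ler_wpM2l// ?(ltW M0)//; exact: cmf.
have s4 : M.+1%:R^-1 * fine (m S) >= 0 by rewrite mulr_ge0// ltW.
have {}Me : M.+1%:R^-1 * fine (m S) + M.+1%:R^-1 * fine (m S) <= e.
  apply: le_trans (ltW Me); rewrite mulrDr mulr1 mulr2n mulrDl mul1r mulrDr.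
  by rewrite lerDl ltW.
rewrite ler_norml; apply/andP.
move: i1 i2 j1 j2 s1 s2 s3 s4 Me.
move: (M.+1%:R^-1 * fine (m S)) (M.+1%:R^-1 * c S) => x y.
move: (_ * \sum_(j < M.+1) fine _) (_ * \sum_(j < M.+1) c _) => a b.
by move=> *; split; lra.
Qed.

End ultralimit_of_measures.

(** * Continuity of integrals in the domain of integration *)

Section symmetric_difference_integral.
Context {d} {T : measurableType d} {R : realType} (mu : {measure set T -> \bar R}).
Implicit Types (W A : set T) (psi : T -> R).

Lemma normr_Rintegral_le A psi (C : R) : measurable A -> (mu A < +oo)%E ->
  measurable_fun setT psi -> (forall x, `|psi x| <= C) ->
  `|\int[mu]_(x in A) psi x| <= C * fine (mu A).
Proof.
move=> mA muA mpsi psiC.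
have ibnd (f : T -> R) : measurable_fun setT f -> (forall x, `|f x| <= C) ->
    mu.-integrable A (EFin \o f).
  move=> mf fC; apply: measurable_bounded_integrable => //.
    exact: measurable_funTS.
  exists C; split; first exact: num_real.
  by move=> r Cr x _ /=; rewrite (le_trans (fC x))// ltW.
apply: le_trans (le_normr_Rintegral mA (ibnd _ mpsi psiC)) _.
rewrite -Rintegral_cst//; apply: le_Rintegral => //.
- by apply: (ibnd (fun x => `|psi x|)) => [|x]; [exact: measurableT_comp|rewrite normr_id].
- apply: (ibnd (cst C)) => // x /=.
  by rewrite ger0_norm// (le_trans _ (psiC x)).
Qed.

Lemma normr_RintegralB_symdiff W W' psi (C : R) : measurable W -> measurable W' ->
  measurable_fun setT psi -> (forall x, `|psi x| <= C) ->
  mu.-integrable W (EFin \o psi) -> mu.-integrable W' (EFin \o psi) ->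
  (mu (W `+` W') < +oo)%E ->
  `|\int[mu]_(x in W) psi x - \int[mu]_(x in W') psi x| <= C * fine (mu (W `+` W')).
Proof.
move=> mW mW' mpsi psiC iW iW' muWW.
have mD := measurableD mW mW'; have mD' := measurableD mW' mW.
have split_int V V' : measurable V -> measurable V' -> mu.-integrable V (EFin \o psi) ->
    \int[mu]_(x in V) psi x =
    \int[mu]_(x in V `\` V') psi x + \int[mu]_(x in V `&` V') psi x.
  move=> mV mV' iV.
  have VE : (V `\` V') `|` (V `&` V') = V.
    apply/seteqP; split => [x [[]|[]]//|x Vx].
    by have [V'x|nV'x] := pselect (V' x); [right|left].
  rewrite -Rintegral_setU ?VE//.
  - exact: measurableD.
  - exact: measurableI.
  - by apply/disj_setPS => x [[_ nx] [_ /nx]].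
rewrite (split_int W W')// (split_int W' W)// [W' `&` W]setIC.
rewrite opprD addrACA subrr addr0.
have DE : (mu (W `+` W') = mu (W `\` W') + mu (W' `\` W))%E.
  rewrite measureU//; apply/seteqP; split => // x [[_ nW'] [W'x _]]; exact: nW'.
have fD : (mu (W `\` W') < +oo)%E by apply: le_lt_trans muWW; rewrite DE leeDl.
have fD' : (mu (W' `\` W) < +oo)%E by apply: le_lt_trans muWW; rewrite DE leeDr.
rewrite DE fineD ?ge0_fin_numE// mulrDr.
apply: le_trans (ler_normB _ _) _.
by apply: lerD; exact: normr_Rintegral_le.
Qed.

Lemma cvg_Rintegral_symdiff (W : nat -> set T) W0 psi (C : R) :
  (forall k, measurable (W k)) -> measurable W0 ->
  measurable_fun setT psi -> (forall x, `|psi x| <= C) ->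
  (forall k, mu.-integrable (W k) (EFin \o psi)) -> mu.-integrable W0 (EFin \o psi) ->
  mu (W k `+` W0) @[k --> \oo] --> 0%E ->
  \int[mu]_(x in W k) psi x @[k --> \oo] --> \int[mu]_(x in W0) psi x.
Proof.
move=> mW mW0 mpsi psiC iW iW0 /fine_cvgP[fW cW].
apply/cvgrPdist_le => e e0.
have cC : C * fine (mu (W k `+` W0)) @[k --> \oo] --> 0.
  by rewrite -(mulr0 C); exact: cvgMl_tmp.
near=> k; rewrite distrC.
apply: (le_trans (normr_RintegralB_symdiff (mW k) mW0 mpsi psiC (iW k) iW0 _)).
  by rewrite -ge0_fin_numE//; near: k.
by near: k; apply: (cvgr_le _ cC).
Unshelve. all: by end_near. Qed.

End symmetric_difference_integral.

(** * The limit set has locally finite perimeter *)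

Section limit_perimeter.
Context {R : realType} {n : nat}.
Implicit Types (B K S : set 'rV[R]_n) (phi : 'rV[R]_n -> R).
Local Notation mu := (@lebesgue_rV R n).

Lemma ultralimit_measure_bounded (Omega : set 'rV[R]_n) (U : set_system nat)
    (UU : UltraFilter U) (p : nat -> set 'rV[R]_n -> \bar R) :
  open Omega -> locally_bounded_measures Omega p ->
  exists m : {measure set 'rV[R]_n -> \bar R},
  (forall K, compact K -> K `<=` Omega -> (m K < +oo)%E) /\
  forall S phi (M : R), compact S -> S `<=` Omega -> continuous phi ->
    (forall x, `|phi x| <= M) -> (forall x, ~ S x -> phi x = 0) ->
    fine (\int[p k]_(x in S) (phi x)%:E)%E @[k --> U] -->
      fine (\int[m]_(x in S) (phi x)%:E)%E.
Proof.
move=> Omega_open pK; have [m [mfin mcvg]] := ultralimit_measure UU Omega_open pK.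
have UF : ProperFilter U by exact: ultra_proper.
have FU : Filter U by exact: filter_filter.
exists m; split => // S phi M cS SO cphi phiM phi0.
have mS := compact_measurable_rV cS.
(* Scaling by [M'] puts the positive and negative parts of [phi] into [0, 1]; then phi = (M' / 2)(f
   - g). *)
pose M' : R := 2 * (`|M| + 1).
have M'0 : 0 < M' by rewrite mulr_gt0// ltr_wpDl.
pose f x : R := (`|phi x| + phi x) / M'; pose g x : R := (`|phi x| - phi x) / M'.
have phib x : - `|phi x| <= phi x <= `|phi x| /\ `|phi x| <= `|M|.
  split; first by rewrite -ler_norml.
  by apply: le_trans (phiM x) _; exact: ler_norm.
have f01 x : 0 <= f x <= 1.
  have [/andP[h1 h2] h3] := phib x.
  by rewrite /f divr_ge0 ?(ltW M'0)//= ?ler_pdivrMr//; rewrite /M'; lra.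
have g01 x : 0 <= g x <= 1.
  have [/andP[h1 h2] h3] := phib x.
  by rewrite /g divr_ge0 ?(ltW M'0)//= ?ler_pdivrMr//; rewrite /M'; lra.
have f0 x : ~ S x -> f x = 0 by move=> /phi0 px; rewrite /f px normr0 addr0 mul0r.
have g0 x : ~ S x -> g x = 0 by move=> /phi0 px; rewrite /g px normr0 subr0 mul0r.
have cn : continuous (fun x => `|phi x|).
  by move=> x; apply: (continuous_comp (cphi x)); exact: norm_continuous.
have cf : continuous f.
  by move=> x; exact: (cvgMr_tmp (cvgD (cn x) (cphi x))).
have cg : continuous g.
  by move=> x; exact: (cvgMr_tmp (cvgB (cn x) (cphi x))).
have bnd01 (h : 'rV[R]_n -> R) : (forall x, 0 <= h x <= 1) -> forall x, `|h x| <= 1.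
  by move=> h01 x; have /andP[h0 h1] := h01 x; rewrite ger0_norm.
have dec (q : {measure set 'rV[R]_n -> \bar R}) : (q S < +oo)%E ->
    fine (\int[q]_(x in S) (phi x)%:E)%E =
    M' / 2 * fine (\int[q]_(x in S) (f x)%:E)%E - M' / 2 * fine (\int[q]_(x in S) (g x)%:E)%E.
  move=> qS.
  have If := bounded_integrable_compact mS qS (continuous_measurable_rV cf) (bnd01 _ f01).
  have Ig := bounded_integrable_compact mS qS (continuous_measurable_rV cg) (bnd01 _ g01).
  rewrite -[LHS]/(\int[q]_(x in S) phi x) -[X in M' / 2 * X - _]/(\int[q]_(x in S) f x).
  rewrite -[X in _ - _ * X]/(\int[q]_(x in S) g x) -mulrBr -RintegralB// -RintegralZl//.
    apply: eq_Rintegral => x _; rewrite /f /g.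
    by field; rewrite gt_eqF.
  exact: (integrableB mS If Ig).
have [C pC] := pK S cS SO.
rewrite dec ?mfin//.
rewrite (_ : (fun k => _) = fun k =>
    M' / 2 * fine (\int[p k]_(x in S) (f x)%:E)%E - M' / 2 * fine (\int[p k]_(x in S) (g x)%:E)%E).
  have cfU := mcvg S f cS SO cf f01 f0; have cgU := mcvg S g cS SO cg g01 g0.
  by apply: cvgB; [exact: (cvgMl_tmp cfU)|exact: (cvgMl_tmp cgU)].
apply/funext => k; have [q [qC pq]] := pC k.
have qS : (q S < +oo)%E by rewrite (le_lt_trans qC)// ltry.
have E h : (\int[p k]_(x in S) h x = \int[q]_(x in S) h x)%E.
  exact: (integral_eq_on_compact (K := S)).
by rewrite !E dec.
Qed.

Lemma measure_fine_cvg (m : {measure set 'rV[R]_n -> \bar R}) K (F : nat -> set 'rV[R]_n) :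
  measurable K -> (m K < +oo)%E -> (forall k, measurable (F k)) ->
  (forall k, F k `<=` K) -> trivIset setT F ->
  \sum_(k < j) fine (m (F k)) @[j --> \oo] --> fine (m (\bigcup_k F k)).
Proof.
move=> mK mKoo mF FK tF.
have mUF := bigcup_measurable (fun k (_ : [set: nat] k) => mF k).
have fin B : measurable B -> B `<=` K -> m B \is a fin_num.
  by move=> mB BK; exact: sub_measure_fin_num BK mKoo.
have UK : \bigcup_k F k `<=` K by move=> x [k _ /FK].
have : (\sum_(0 <= k < j) m (F k))%E @[j --> \oo] --> (fine (m (\bigcup_k F k)))%:E.
  by rewrite fineK ?fin//; exact: measure_semi_sigma_additive.
move=> /fine_cvgP[_].
rewrite (_ : fine \o _ = fun j => \sum_(k < j) fine (m (F k))) => //.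
apply/funext => j /=; rewrite big_mkord sum_fine// => k _.
by rewrite fin.
Qed.

Variables (Omega : set 'rV[R]_n) (W : nat -> set 'rV[R]_n) (W0 : set 'rV[R]_n).
Variable lam : nat -> set 'rV[R]_n -> 'rV[R]_n.
Hypotheses (Omega_open : open Omega) (mW : forall k, measurable (W k))
  (mW0 : measurable W0) (gradW : forall k, is_gradient_measure Omega (W k) (lam k))
  (TV_bnd : forall K, compact K -> K `<=` Omega -> exists C : R, forall k,
     (Defs.total_variation Omega (lam k) K <= C%:E)%E)
  (cvgW : mu (W k `+` W0) @[k --> \oo] --> 0%E).

Lemma cvg_integral_partial i phi : test_function Omega phi ->
  \int[mu]_(x in W k) partial i phi x @[k --> \oo] --> \int[mu]_(x in W0) partial i phi x.
Proof.
move=> tphi; have [C phiC] := partial_bounded i tphi.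
apply: (cvg_Rintegral_symdiff _ _ _ phiC) => //.
- by apply: continuous_measurable_rV; exact: test_function_partial_continuous tphi.
- by move=> k; exact: (integrable_partial i (mW k) tphi).
- exact: (integrable_partial i mW0 tphi).
Qed.

Lemma fine_signed_integral_gradient k i phi : test_function Omega phi ->
  fine (signed_integral Omega (fun B => lam k B ord0 i) phi) =
  - \int[mu]_(x in W k) partial i phi x.
Proof. by move=> tphi; rewrite (gradW k).2// fineN. Qed.

Lemma pos_variation_bounded (nu : nat -> set 'rV[R]_n -> R) :
  (forall k, locally_finite_smeasure Omega (nu k)) ->
  (forall k B, `|nu k B| <= enorm (lam k B)) ->
  locally_bounded_measures Omega (fun k => pos_variation Omega (nu k)).
Proof.
move=> nuO nulam K cK KO; have [C TC] := TV_bnd cK KO; exists C => k.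
have [p [q [pK qK pq]]] := pos_variation_jordan (nuO k) cK KO.
have mK := compact_measurable_rV cK.
exists p; split; last by move=> B mB BK; have [] := pq B mB BK.
have [<- _ _] := pq K mK (@subset_refl _ K).
apply: le_trans (TC k); apply: ge_ereal_sup => _ [B [mB rB BK] <-].
apply: le_trans (enorm_le_total_variation _ mB rB BK).
by rewrite lee_fin (le_trans (ler_norm _)).
Qed.

(** Positive and negative parts are passed to the limit separately in each coordinate, because the
    limit construction needs positive measures. Along the ultrafilter the signed integrals then have
    two limits, one from the limit measures and one from the convergence of the sets, and these
    coincide. *)
Lemma limit_locally_finite_perimeter : locally_finite_perimeter Omega W0.
Proof.
have [U [UU sU]] := ultraFilterLemma eventually_filter.
have UF : ProperFilter U by exact: ultra_proper.
have FU : Filter U by exact: filter_filter.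
have cU (u : nat -> R) (l : R) : u k @[k --> \oo] --> l -> u k @[k --> U] --> l.
  by move=> ul A /ul; exact: sU.
pose nu i k B := lam k B ord0 i.
have nuO i k : locally_finite_smeasure Omega (nu i k).
  by apply: locally_finite_vmeasure_coord; case: (gradW k).
have nuNO i k : locally_finite_smeasure Omega (fun B => - nu i k B).
  exact: locally_finite_smeasureN.
have /choice[mp mpP] i := ultralimit_measure_bounded UU Omega_open
  (pos_variation_bounded (nuO i) (fun k B => enorm_coord (lam k B) i)).
have nuN i k B : `|- nu i k B| <= enorm (lam k B) by rewrite normrN enorm_coord.
have /choice[mq mqP] i := ultralimit_measure_bounded UU Omega_open
  (pos_variation_bounded (nuNO i) (nuN i)).
(* Where a limit measure is infinite, [fine] returns 0; the measures are finite on compact subsets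
   of [Omega], where alone [lam0] is evaluated. *)
pose lam0 B : 'rV[R]_n := \row_i (fine (mp i B) - fine (mq i B)).
have mxB (u v : 'rV[R]_n) i : (u - v) ord0 i = u ord0 i - v ord0 i by rewrite !mxE.
have lam0O : locally_finite_vmeasure Omega lam0.
  move=> K cK KO F mF FK tF; have mK := compact_measurable_rV cK.
  have coord i : (\sum_(k < j) lam0 (F k)) ord0 i @[j --> \oo] --> lam0 (\bigcup_k F k) ord0 i.
    have [mpK _] := mpP i; have [mqK _] := mqP i.
    rewrite mxE (_ : (fun j => _) = fun j => \sum_(k < j) fine (mp i (F k)) -
        \sum_(k < j) fine (mq i (F k))).
      by apply: cvgB; apply: (measure_fine_cvg mK) => //; [exact: mpK|exact: mqK].
    by apply/funext => j; rewrite summxE -sumrB; apply: eq_bigr => k _; rewrite mxE.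
  apply/cvgrPdist_lt => e e0.
  have near_e i : \forall j \near \oo,
      `|lam0 (\bigcup_k F k) ord0 i - (\sum_(k < j) lam0 (F k)) ord0 i| < e.
    by apply: (cvgrPdist_lt _ _).1 => //; exact: coord.
  have := filter_forall eventually_filter near_e.
  by apply: filterS => j ej; apply: rV_norm_lt => // i; rewrite mxB; exact: ej.
exists lam0; split => // phi tphi i.
have cS := test_function_compact tphi; have SO := test_function_sub tphi.
have cphi := test_function_continuous tphi; have [M phiM] := test_function_bounded tphi.
have phi0 x : ~ support_set phi x -> phi x = 0 by exact: (test_function_out tphi).
have [mpK mpcvg] := mpP i; have [mqK mqcvg] := mqP i.
have mphi := continuous_measurable_rV cphi.
have lam0E B : measurable B -> B `<=` support_set phi ->
    (lam0 B ord0 i)%:E = (mp i B - mq i B)%E.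
  have mS := compact_measurable_rV cS.
  move=> mB BS; rewrite mxE EFinB !fineK//.
    exact: sub_measure_fin_num BS (mqK _ cS SO).
  exact: sub_measure_fin_num BS (mpK _ cS SO).
have s0 := signed_integralE (@locally_finite_vmeasure_coord _ _ Omega lam0 i lam0O) cS SO (mpK _ cS SO)
  (mqK _ cS SO) lam0E mphi phiM phi0.
have fin (q : {measure set 'rV[R]_n -> \bar R}) : (q (support_set phi) < +oo)%E ->
    (\int[q]_(x in support_set phi) (phi x)%:E)%E \is a fin_num.
  move=> qS; apply: integrable_fin_num; first exact: compact_measurable_rV.
  by apply: (bounded_integrable_compact _ qS mphi phiM); exact: compact_measurable_rV.
have s0fin : signed_integral Omega (fun B => lam0 B ord0 i) phi \is a fin_num.
  by rewrite s0 fin_numB !fin ?mpK ?mqK.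
have ip : (\int[mu]_(x in W0) (partial i phi x)%:E)%E \is a fin_num.
  apply: integrable_fin_num => //; exact: (integrable_partial i mW0 tphi).
suff E : fine (signed_integral Omega (fun B => lam0 B ord0 i) phi) =
    - \int[mu]_(x in W0) partial i phi x.
  by rewrite -(fineK s0fin) E EFinN /Rintegral fineK.
have lim1 : fine (signed_integral Omega (nu i k) phi) @[k --> U] -->
    - \int[mu]_(x in W0) partial i phi x.
  under eq_fun do rewrite fine_signed_integral_gradient//.
  by apply: cvgN; apply: cU; exact: cvg_integral_partial.
have lim2 : fine (signed_integral Omega (nu i k) phi) @[k --> U] -->
    fine (signed_integral Omega (fun B => lam0 B ord0 i) phi).
  rewrite s0 fineB ?fin ?mpK ?mqK//.
  have c1 := mpcvg _ _ _ cS SO cphi phiM phi0.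
  have c2 := mqcvg _ _ _ cS SO cphi phiM phi0.
  rewrite (_ : (fun k => _) = fun k =>
    fine (\int[pos_variation Omega (nu i k)]_(x in support_set phi) (phi x)%:E)%E -
    fine (\int[pos_variation Omega (fun B => - nu i k B)%R]_(x in support_set phi) (phi x)%:E)%E).
    exact: (cvgB c1 c2).
  apply/funext => k; have [p [q [pS qS pq]]] := pos_variation_jordan (nuO i k) cS SO.
  rewrite (signed_integralE (nuO i k) cS SO pS qS _ mphi phiM phi0); last first.
    by move=> B mB BS; have [] := pq B mB BS.
  rewrite fineB ?fin//; congr (fine _ - fine _).
    symmetry; apply: (integral_eq_on_compact (K := support_set phi)) => // B mB BS.
    by have [] := pq B mB BS.
  symmetry; apply: (integral_eq_on_compact (K := support_set phi)) => // B mB BS.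
  by have [] := pq B mB BS.
exact: (cvg_unique _ lim2 lim1).
Unshelve. all: by end_near. Qed.

End limit_perimeter.

(** * Recovering the norm of a vector measure from smooth cutoffs *)

Section vector_measure_pieces.
Context {R : realType} {n : nat}.
Variables (Omega : set 'rV[R]_n) (lam : set 'rV[R]_n -> 'rV[R]_n).
Hypothesis lamO : locally_finite_vmeasure Omega lam.
Hypothesis Omega_open : open Omega.
Implicit Types (A B C E F K O V : set 'rV[R]_n) (psi : 'rV[R]_n -> R).

Local Notation TV := (Defs.total_variation Omega lam).

Lemma vmeasureU K A B : compact K -> K `<=` Omega -> measurable A -> measurable B ->
  A `<=` K -> B `<=` K -> A `&` B = set0 -> lam (A `|` B) = lam A + lam B.
Proof.
move=> cK KO mA mB AK BK AB; apply/rowP => i; rewrite mxE.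
have [p [q [pK qK pq]]] :=
  pos_variation_jordan (@locally_finite_vmeasure_coord _ _ Omega lam i lamO) cK KO.
have mK := compact_measurable_rV cK.
have fin (m : {measure set 'rV[R]_n -> \bar R}) C : (m K < +oo)%E ->
    measurable C -> C `<=` K -> m C \is a fin_num.
  by move=> mKoo mC CK; exact: sub_measure_fin_num CK mKoo.
have nuE C : measurable C -> C `<=` K -> lam C ord0 i = fine (p C) - fine (q C).
  move=> mC CK; have [_ _ E] := pq C mC CK.
  by apply: EFin_inj; rewrite E EFinB !fineK ?fin.
have UK : A `|` B `<=` K by rewrite subUset.
have mU (m : {measure set 'rV[R]_n -> \bar R}) : (m K < +oo)%E ->
    fine (m (A `|` B)) = fine (m A) + fine (m B).
  by move=> mKoo; rewrite measureU// fineD ?fin.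
rewrite (nuE _ (measurableU _ _ mA mB) UK) (nuE _ mA AK) (nuE _ mB BK) !mU//.
by rewrite opprD addrACA.
Qed.

Lemma enormD (u v : 'rV[R]_n) : enorm (u + v) <= enorm u + enorm v.
Proof.
have [w w1 <-] := enorm_dotv (u + v); rewrite dotvDr.
by apply: lerD; apply: le_trans (dotv_le _ _) _; rewrite ler_piMl ?enorm_ge0.
Qed.

Lemma dotvNl (u v : 'rV[R]_n) : dotv (- u) v = - dotv u v.
Proof. by rewrite /dotv -sumrN; apply: eq_bigr => i _; rewrite mxE mulNr. Qed.

Lemma enormN (u : 'rV[R]_n) : enorm (- u) = enorm u.
Proof. by rewrite /enorm; under eq_bigr do rewrite mxE sqrrN. Qed.

Lemma total_variation_regular F K (e : R) : measurable F -> compact K -> K `<=` Omega ->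
  F `<=` K -> 0 < e -> exists C O, [/\ compact C, open O, C `<=` F, F `<=` O &
    (TV ((O `\` C) `&` K) < e%:E)%E].
Proof.
move=> mF cK KO FK e0; have mK := compact_measurable_rV cK.
have fin : (mrestr (total_variation_measure lamO) mK setT < +oo)%E.
  by rewrite /mrestr setTI; exact: total_variation_compact.
have [C [ O [clC oO CF FO H]]] := borel_regular fin mF e0.
exists C, O; split => //.
by apply: subclosed_compact_rV clC cK (subset_trans CF FK).
Qed.

Definition norming_pair F O (e : R) psi (v : 'rV[R]_n) :=
  [/\ test_function (O `&` Omega) psi, forall x, 0 <= psi x <= 1, enorm v <= 1 &
      enorm (lam F) - e <=
        \sum_i v ord0 i * fine (signed_integral Omega (fun B => lam B ord0 i) psi)].

(** The compact set is chosen before [O], so that a caller can first collect several compact sets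
    and then separate them by disjoint neighbourhoods. Half of [e] pays for replacing [F] by [K],
    the other half for the variation near but outside [K]. *)
Lemma enorm_le_signed_integral F (e : R) : measurable F -> relatively_compact Omega F ->
  0 < e -> exists K, [/\ compact K, K `<=` F & forall O, open O -> K `<=` O ->
    exists psi v, norming_pair F O e psi v].
Proof.
move=> mF [L [cL LO FL]] e0; have e20 : 0 < e / 2 by rewrite divr_gt0.
have [K [OF [cK _ KF FOF TVF]]] := total_variation_regular mF cL LO FL e20.
exists K; split => // O oO KO.
have mK := compact_measurable_rV cK.
have oOO : open (O `&` Omega) by exact: openI.
have KOO : K `<=` O `&` Omega by move=> x Kx; split; [exact: KO|exact/LO/FL/KF].
have [V [oV KV cV VOO]] := compact_sub_open_nbhs cK oOO KOO.
have VO : closure V `<=` Omega by move=> x /VOO[].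
have KclV : K `<=` closure V by move=> x /KV; exact: subset_closure.
have [C [ O' [_ oO' CK KO' TVK]]] := total_variation_regular mK cV VO KclV e20.
have oU : open (O' `&` V) by exact: openI.
have KU : K `<=` O' `&` V by move=> x Kx; split; [exact: KO'|exact: KV].
have UclV : O' `&` V `<=` closure V by move=> x [_ /subset_closure].
have [psi [tpsi psi01 psi1]] := smooth_cutoff cK oU KU.
have [v v1 vK] := enorm_dotv (lam K).
have tpsiO : test_function (O `&` Omega) psi.
  by apply: test_functionW tpsi => x /UclV /VOO.
have tpsiOmega : test_function Omega psi by apply: test_functionW tpsiO => x [].
have mpsi := continuous_measurable_rV (test_function_continuous tpsi).
exists psi, v; split => //.
have small B E : measurable B -> B `<=` E -> relatively_compact Omega B ->
    (TV E < (e / 2)%:E)%E -> enorm (lam B) <= e / 2.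
  move=> mB BE rB TVE; rewrite -lee_fin; apply: le_trans (ltW TVE).
  exact: enorm_le_total_variation.
have h1 : enorm (lam F) <= enorm (lam K) + e / 2.
  rewrite -(setDUK KF) (vmeasureU cL LO mK (measurableD mF mK)).
  - apply: le_trans (enormD _ _) _; rewrite lerD2l.
    apply: small TVF; first exact: measurableD.
      by move=> x [Fx nKx]; split; [split => //; exact: FOF|exact: FL].
    by exists L; split => // x [/FL].
  - exact: subset_trans FL.
  - by move=> x [/FL].
  - by rewrite setDIK.
(* Every superlevel set of [psi] at a height in (0, 1] lies between [K] and a neighbourhood of [K]
   with variation below e / 2 outside [K]. *)
have h2 : enorm (lam K) - e / 2 <= \sum_i v ord0 i *
    fine (signed_integral Omega (fun B => lam B ord0 i) psi) <= enorm (lam K) + e / 2.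
  apply: (signed_integral_between (v := fun i => v ord0 i) lamO tpsiOmega psi01).
  move=> s /andP[s0 s1]; rewrite -/(dotv v (lam [set x | s <= psi x])).
  have mL := measurable_superlevel mpsi s.
  have KL : K `<=` [set x | s <= psi x] by move=> x /psi1 /= ->.
  have LU : [set x | s <= psi x] `<=` O' `&` V.
    move=> x /= sx; apply: (test_function_sub tpsi); apply: subset_closure => /=.
    by rewrite gt_eqF// (lt_le_trans s0).
  rewrite -(setDUK KL) (vmeasureU cV VO mK (measurableD mL mK)) ?setDIK//; last first.
    by move=> x [/LU /UclV].
  have : enorm (lam ([set x | s <= psi x] `\` K)) <= e / 2.
    apply: small TVK; first exact: measurableD.
      move=> x [Lx nKx]; split; last exact/UclV/LU.
      by split; [have [] := LU _ Lx|move=> /CK].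
    by exists (closure V); split => // x [/LU /UclV].
  move: (_ `\` K) => B Be; rewrite dotvDr vK.
  have := dotv_le v (lam B); have := dotv_le (- v) (lam B).
  rewrite dotvNl enormN.
  have : enorm v * enorm (lam B) <= e / 2.
    by apply: le_trans Be; rewrite ler_piMl ?enorm_ge0.
  by move=> x1 x2 x3; apply/andP; split; lra.
have /andP[h3 _] := h2.
by apply: le_trans h3; lra.
Qed.

End vector_measure_pieces.

(** * Lower limits of extended real sequences *)

Section lower_limit.
Context {R : realType}.
Implicit Types (x : nat -> \bar R) (l : \bar R).

(** This expresses that [l] is at most the lower limit of [x]; real thresholds avoid arithmetic with
    infinite values. *)
Definition le_lower_limit l x := forall c : R,
  (c%:E < l)%E -> \forall k \near \oo, (c%:E < x k)%E.

Lemma lt_sum_EFin m (y : 'I_m -> \bar R) (c : R) : (forall i, 0 <= y i)%E ->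
  (c%:E < \sum_i y i)%E ->
  exists b : 'I_m -> R, (forall i, ((b i)%:E < y i)%E) /\ c < \sum_i b i.
Proof.
move=> y0 cy; have [[i0 yi0]|/forallNP yoo] := pselect (exists i, y i = +oo%E).
  (* The infinite term takes c + m and each of the m - 1 others takes -1, strictly below its
     nonnegative value; the total is c + 1. *)
  exists (fun i => if i == i0 then c + m%:R else -1); split.
    move=> i; case: eqP => [->|_]; first by rewrite yi0 ltry.
    by rewrite (lt_le_trans _ (y0 i))// lte_fin ltrN10.
  rewrite (bigD1 i0)//= eqxx (eq_bigr (fun=> -1)); last first.
    by move=> i /negbTE ->.
  rewrite sumr_const (_ : #|_| = m.-1); last first.
    have := cardC1 i0; rewrite card_ord => <-.
    by apply: eq_card => i; rewrite !inE.
  rewrite mulNrn -addrA ltrDl subr_gt0 ltr_nat prednK//.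
  by case: i0 {yi0} => j; exact: leq_ltn_trans.
have yf i : y i \is a fin_num by rewrite ge0_fin_numE// ltey; apply/eqP/yoo.
have cs : c < \sum_i fine (y i).
  by rewrite -lte_fin -sumEFin; under eq_bigr do rewrite fineK//.
pose s := \sum_i fine (y i) - c; have s0 : 0 < s by rewrite subr_gt0.
(* Dividing by m + 1 keeps the total loss, m s / (m + 1), strictly below the gap [s]. *)
exists (fun i => fine (y i) - s / m.+1%:R); split.
  by move=> i; rewrite -[ltRHS](fineK (yf i)) lte_fin ltrBlDr ltrDl divr_gt0.
rewrite sumrB sumr_const card_ord -[_ *+ m]mulr_natr mulrAC.
by rewrite ltrBrDl -ltrBrDr -/s ltr_pdivrMr// ltr_pM2l// ltr_nat.
Qed.

Lemma le_lower_limit_sum m (y0 : 'I_m -> \bar R) (y : 'I_m -> nat -> \bar R) :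
  (forall i, 0 <= y0 i)%E -> (forall i, le_lower_limit (y0 i) (y i)) ->
  le_lower_limit (\sum_i y0 i)%E (fun k => \sum_i y i k)%E.
Proof.
move=> y00 yy c /(lt_sum_EFin y00)[b [by0 cb]].
have := filter_forall eventually_filter (fun i => yy i (b i) (by0 i)).
apply: filterS => k bk; apply: (@lt_le_trans _ _ (\sum_i b i)%:E).
  by rewrite lte_fin.
by rewrite -sumEFin; apply: lee_sum => i _; exact/ltW/bk.
Qed.

Lemma le_lower_limitZ (r : R) l x : 0 < r -> le_lower_limit l x ->
  le_lower_limit (r%:E * l)%E (fun k => r%:E * x k)%E.
Proof.
move=> r0 xx c; rewrite -lte_pdivrMl// -EFinM => /xx; apply: filterS => k.
by rewrite EFinM lte_pdivrMl.
Qed.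

End lower_limit.

(** * Lower semicontinuity of the perimeter on open sets *)

Section perimeter_lower_semicontinuity.
Context {R : realType} {n : nat}.
Implicit Types U : set 'rV[R]_n.
Local Notation mu := (@lebesgue_rV R n).
Variables (Omega : set 'rV[R]_n) (W : nat -> set 'rV[R]_n) (W0 : set 'rV[R]_n).
Variables (lam : nat -> set 'rV[R]_n -> 'rV[R]_n) (lam0 : set 'rV[R]_n -> 'rV[R]_n).
Hypotheses (Omega_open : open Omega) (mW : forall k, measurable (W k))
  (mW0 : measurable W0) (gradW : forall k, is_gradient_measure Omega (W k) (lam k))
  (gradW0 : is_gradient_measure Omega W0 lam0)
  (cvgW : mu (W k `+` W0) @[k --> \oo] --> 0%E).

(** For finitely many fixed cutoffs the tested gradients of the sequence converge, being integrals
    of partial derivatives over converging sets. Disjoint supports inside [U] keep each tested sum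
    below the variation of [U]. *)
Lemma total_variation_lower_limit U : open U ->
  le_lower_limit (Defs.total_variation Omega lam0 U)
    (fun k => Defs.total_variation Omega (lam k) U).
Proof.
move=> oU c /ereal_sup_gt[_ [m [F [F1 tF ->]]]]; rewrite lte_fin => cF.
have [lam0O _] := gradW0.
pose s := \sum_(j < m) enorm (lam0 (F j)) - c.
have s0 : 0 < s by rewrite subr_gt0.
(* A loss of [e] on each of the m pieces stays below the gap [s]. *)
pose e := s / m.+1%:R; have e0 : 0 < e by rewrite divr_gt0.
have /choice[K KP] j : exists K, [/\ compact K, K `<=` F j & forall O, open O -> K `<=` O ->
    exists psi v, norming_pair Omega lam0 (F j) O e psi v].
  by have [mF rF _] := F1 j; exact: enorm_le_signed_integral.
have cK j : compact (K j) by have [] := KP j.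
have KF j : K j `<=` F j by have [] := KP j.
have tK : trivIset setT K.
  move=> i j _ _ [x [/KF Kx /KF Kx']]; apply: tF => //; by exists x.
have [d d0 tO] := disjoint_compacts_thicken cK tK.
pose O j := thicken_open (K j) d `&` U.
have oO j : open (O j) by apply: openI => //; exact: open_thicken_open.
have KO j : K j `<=` O j.
  move=> x Kx; split; first exact: sub_thicken_open.
  by have [_ _] := F1 j; apply; exact: KF.
have /choice[psi /choice[v pv]] j : exists psi v, norming_pair Omega lam0 (F j) (O j) e psi v.
  by have [_ _] := KP j; apply.
have tpsi j : test_function Omega (psi j).
  by have [h _ _ _] := pv j; apply: test_functionW h => x [].
pose I (l : set 'rV[R]_n -> 'rV[R]_n) :=
  \sum_(j < m) \sum_i v j ord0 i * fine (signed_integral Omega (fun B => l B ord0 i) (psi j)).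
have cI0 : c < I lam0.
  apply: (@lt_le_trans _ _ (\sum_(j < m) (enorm (lam0 (F j)) - e))).
    rewrite sumrB sumr_const card_ord -[_ *+ m]mulr_natr mulrAC.
    by rewrite ltrBrDl -ltrBrDr -/s ltr_pdivrMr// ltr_pM2l// ltr_nat.
  by apply: ler_sum => j _; have [] := pv j.
have cvgI : I (lam k) @[k --> \oo] --> I lam0.
  apply: cvg_big => [|j _]; first exact: add_continuous.
  apply: cvg_big => [|i _]; first exact: add_continuous.
  apply: cvgMl_tmp.
  rewrite (gradW0.2 _ (tpsi j)) fineN.
  under eq_fun do rewrite (gradW _).2// fineN.
  by apply: cvgN; exact: cvg_integral_partial.
have : \forall k \near \oo, c < I (lam k) by apply: (cvgr_gt _ cvgI).
apply: filterS => k cIk; apply: (@lt_le_trans _ _ (I (lam k))%:E); first by rewrite lte_fin.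
have [lamO _] := gradW k.
apply: (@le_trans _ _ (\sum_(j < m) total_variation_measure lamO (O j))%E).
  rewrite -sumEFin; apply: lee_sum => j _; have [h1 h2 h3 _] := pv j.
  apply: signed_integral_le_total_variation => // x /= px.
  have /(test_function_sub h1)[//] : support_set (psi j) x.
  exact: subset_closure.
apply: (@le_trans _ _ (total_variation_measure lamO U)) => //.
have tOU : trivIset setT O.
  move=> i j _ _ [x [[x1 _] [x2 _]]]; apply: tO => //; by exists x.
apply: sum_measure_le => //.
- exact: index_enum_uniq.
- by move=> j; exact: open_measurable_rV.
- exact: open_measurable_rV.
- by move=> j _ x [].
Qed.

End perimeter_lower_semicontinuity.

(** * The weight as a superposition of open superlevel sets *)

Section weighted_perimeter.
Context {R : realType} {n : nat}.
Variables (Omega : set 'rV[R]_n) (a : 'rV[R]_n -> R).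
Hypotheses (Omega_open : open Omega) (a_cont : {within Omega, continuous a})
  (a_ge0 : forall x, Omega x -> 0 <= a x).

Definition weight_level s := [set x | Omega x /\ s < a x].

Lemma open_weight_level s : open (weight_level s).
Proof.
have := a_cont; rewrite continuous_open_subspace// => ca.
rewrite openE => x [Ox sx].
have /ca cx : x \in Omega by rewrite inE.
have Onear : \near x, Omega x by exact: open_nbhs_nbhs.
have snear : \forall y \near x, s < a y by apply: (cvgr_gt _ cx).
by apply: filterS2 Onear snear => y.
Qed.

Lemma measurable_weight : measurable_fun Omega (EFin \o a).
Proof.
apply/measurable_EFinP.
apply: (measurability _ (measurable_realfun.RGenOInfty.measurableE R)).
move=> _ [_ [s ->] <-]; rewrite (_ : _ `&` _ = weight_level s).
  by apply: open_measurable_rV; exact: open_weight_level.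
by apply/seteqP; split => x /=; rewrite in_itv /= andbT.
Qed.

(** Layers of thickness 1 / (m + 1), in number (m + 1)^2, reach height m + 1: the weight may be
    unbounded, so the height must grow with m. Strict superlevel sets are used because they are
    open. *)
Definition weight_layers m x : R := m.+1%:R^-1 *
  \sum_(j < m.+1 * m.+1) \1_(weight_level (j.+1%:R / m.+1%:R)) x.

Lemma weight_layers_ge0 m x : (0 <= (weight_layers m x)%:E)%E.
Proof. by rewrite lee_fin mulr_ge0 ?invr_ge0// sumr_ge0. Qed.

Lemma measurable_weight_layers m :
  measurable_fun Omega (fun x => (weight_layers m x)%:E).
Proof.
apply/measurable_EFinP; apply: measurable_funM => //.
apply: measurable_sum => j; apply: measurable_funTS; apply: measurable_indic.
by apply: open_measurable_rV; exact: open_weight_level.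
Qed.

Lemma weight_layers_bound m x : Omega x ->
  Num.min m.+1%:R (a x - m.+1%:R^-1) <= weight_layers m x <= a x.
Proof.
move=> Ox; have m0 : 0 < m.+1%:R :> R by [].
have := @count_bounds R (fun j => x \in weight_level (j.+1%:R / m.+1%:R))
  (m.+1%:R * a x) (m.+1 * m.+1)
  ltac:(by rewrite mulr_ge0// a_ge0)
  ltac:(by move=> j; rewrite inE => -[_ /ltW]; rewrite ler_pdivrMr// mulrC)
  ltac:(by move=> j; rewrite notin_setE => nj; rewrite mulrC -ler_pdivlMr// leNgt;
    apply/negP => h; exact: nj).
move=> hb; rewrite /weight_layers (eq_bigr (fun j : 'I_(m.+1 * m.+1) =>
  (x \in weight_level (j.+1%:R / m.+1%:R))%:R)) => [|j _]; last by rewrite indicE.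
move: hb; rewrite ler_pdivlMl// ler_pdivrMl// minr_pMr ?ler0n//.
by rewrite mulrBr mulfV ?gt_eqF// -natrM.
Qed.

Lemma weight_layers_cvg x : Omega x -> weight_layers m x @[m --> \oo] --> a x.
Proof.
move=> Ox; apply/cvgrPdist_le => e e0; near=> m.
have /andP[h1 h2] := weight_layers_bound m Ox.
have am : a x <= m%:R by near: m; exact: nbhs_infty_ger.
have me : m.+1%:R^-1 < e by near: m; exact: near_infty_natSinv_lt (PosNum e0).
rewrite ger0_norm ?subr_ge0//.
have : a x - m.+1%:R^-1 <= weight_layers m x.
  apply: le_trans h1; rewrite le_min lexx andbT lerBlDr (le_trans am)//.
  by rewrite -natr1 -addrA lerDl addr_ge0// invr_ge0.
rewrite !lerBlDr => /le_trans; apply; rewrite addrC lerD2r ltW//.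
Unshelve. all: by end_near. Qed.

Lemma integral_weight_layers (q : {measure set 'rV[R]_n -> \bar R}) m :
  (\int[q]_(x in Omega) (weight_layers m x)%:E =
  (m.+1%:R^-1)%:E * \sum_(j < m.+1 * m.+1) q (weight_level (j.+1%:R / m.+1%:R)%R))%E.
Proof.
have mO := open_measurable_rV Omega_open.
have ml s : measurable (weight_level s) by apply: open_measurable_rV; exact: open_weight_level.
under eq_integral do rewrite /weight_layers EFinM -sumEFin.
rewrite ge0_integralZl//.
- rewrite ge0_integral_sum//.
  + congr (_ * _)%E; apply: eq_bigr => j _; rewrite integral_indic//.
    by congr (q _); apply/setIidPl => x [].
  + move=> j; apply/measurable_EFinP; apply: measurable_funTS; exact: measurable_indic.
- apply: emeasurable_sum => j; apply/measurable_EFinP; apply: measurable_funTS; exact: measurable_indic.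
- by move=> x _; apply: sume_ge0 => j _; rewrite lee_fin.
Qed.

(** The approximations are not monotone in m, so Fatou's lemma is applied to their pointwise
    convergence. *)
Lemma lt_integral_weight_layers (q : {measure set 'rV[R]_n -> \bar R}) (c : R) :
  (c%:E < \int[q]_(x in Omega) (a x)%:E)%E ->
  exists m, (c%:E < \int[q]_(x in Omega) (weight_layers m x)%:E)%E.
Proof.
move=> ca; apply: contrapT => /forallNP nm.
have mO := open_measurable_rV Omega_open.
suff : (\int[q]_(x in Omega) (a x)%:E <= c%:E)%E by rewrite leNgt ca.
have := fatou q mO measurable_weight_layers (fun m x _ => weight_layers_ge0 m x).
rewrite (eq_integral (fun x => (a x)%:E)) => [h|x].
  apply: le_trans h _; rewrite limn_einf_lim; apply: lime_le; first exact: is_cvg_einfs.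
  apply: nearW => m.
  apply: (@le_trans _ _ (\int[q]_(x in Omega) (weight_layers m x)%:E)%E).
    by apply: ereal_inf_lbound; exists m => /=.
  by rewrite leNgt; apply/negP; exact: nm.
rewrite inE => Ox.
have cg : (weight_layers m x)%:E @[m --> \oo] --> (a x)%:E.
  by apply: cvg_EFin; [exact: nearW|exact: weight_layers_cvg].
rewrite is_cvg_limn_einfE; last by apply/cvg_ex; exists (a x)%:E.
exact: cvg_lim.
Qed.

Lemma le_integral_weight_layers (q : {measure set 'rV[R]_n -> \bar R}) m :
  (\int[q]_(x in Omega) (weight_layers m x)%:E <= \int[q]_(x in Omega) (a x)%:E)%E.
Proof.
have mO := open_measurable_rV Omega_open.
apply: ge0_le_integral => //.
- by move=> x _; exact: weight_layers_ge0.
- exact: measurable_weight_layers.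
- exact: measurable_weight.
- by move=> x Ox; rewrite lee_fin; have /andP[] := weight_layers_bound m Ox.
Qed.

End weighted_perimeter.

(** * Weighted perimeters *)

Section weighted_lower_semicontinuity.
Context {R : realType} {n : nat}.
Implicit Types (K W : set 'rV[R]_n) (phi : 'rV[R]_n -> R).
Local Notation mu := (@lebesgue_rV R n).
Variable Omega : set 'rV[R]_n.
Hypothesis Omega_open : open Omega.

Lemma gradient_measureP W : locally_finite_perimeter Omega W ->
  is_gradient_measure Omega W (gradient_measure Omega W).
Proof. exact: xgetPex. Qed.

Lemma is_gradient_measure_cst0 W : measurable W ->
  (forall phi i, test_function Omega phi -> \int[mu]_(x in W) partial i phi x = 0) ->
  is_gradient_measure Omega W (fun=> 0).
Proof.
move=> mW W0; have l0 : locally_finite_vmeasure Omega (fun=> 0 : 'rV[R]_n).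
  move=> K cK KO F mF FK tF.
  by rewrite (_ : (fun m => _) = cst 0); [exact: cvg_cst|apply/funext => m; rewrite big1].
split => // phi tphi i.
have [M phiM] := test_function_bounded tphi.
rewrite (@signed_integralE _ _ Omega (support_set phi) _ mzero mzero phi M).
- rewrite !integral_measure_zero sube0.
  have := W0 phi i tphi; rewrite /Rintegral => W0'.
  rewrite -(@fineK _ (\int[mu]_(x in W) _)%E) ?W0' ?oppe0//.
  by apply: integrable_fin_num => //; exact: integrable_partial mW tphi.
- exact: locally_finite_vmeasure_coord l0.
- exact: test_function_compact tphi.
- exact: test_function_sub tphi.
- exact: ltry.
- exact: ltry.
- by move=> B _ _; rewrite mxE sube0.
- exact: continuous_measurable_rV (test_function_continuous tphi).
- exact: phiM.
- by move=> x; exact: test_function_out tphi.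
Qed.

Lemma locally_finite_perimeter_set0 : locally_finite_perimeter Omega set0.
Proof.
exists (fun=> 0); apply: is_gradient_measure_cst0 => // phi i tphi.
by rewrite Rintegral_set0.
Qed.

(** A test function vanishes outside [Omega], so its partial derivatives have the same integral over
    [Omega] as over the whole space, namely 0. *)
Lemma locally_finite_perimeter_full : locally_finite_perimeter Omega Omega.
Proof.
exists (fun=> 0); apply: is_gradient_measure_cst0 => [|phi i tphi].
  exact: open_measurable_rV.
rewrite Rintegral_mkcond -[RHS](@integral_partial_eq0 _ _ phi i); last first.
  by apply: test_functionW tphi.
apply: eq_Rintegral => x _; rewrite patchE; case: ifPn => // /negP.
rewrite inE => nO; symmetry; apply: (partial_out i tphi) => sx.
exact/nO/(test_function_sub tphi).
Qed.

Variable a : 'rV[R]_n -> R.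
Hypotheses (a_cont : {within Omega, continuous a}) (a_gt0 : forall x, Omega x -> 0 < a x).

Let a_ge0 x (Ox : Omega x) : 0 <= a x := ltW (a_gt0 Ox).

Lemma weighted_total_variation_ge0 lam :
  locally_finite_vmeasure Omega lam ->
  (0 <= \int[Defs.total_variation Omega lam]_(x in Omega) (a x)%:E)%E.
Proof.
move=> lamO; have := @integral_ge0 _ _ _ (total_variation_measure lamO) Omega (EFin \o a).
by apply => x Ox; rewrite lee_fin a_ge0.
Qed.

(** The constant is the minimum of the weight on [K]. It does not depend on [lam], so one bound
    serves a whole minimising sequence; the empty set has no minimum and is treated apart. *)
Lemma total_variation_le_weighted K : compact K -> K `<=` Omega ->
  exists2 d : R, 0 < d & forall lam, locally_finite_vmeasure Omega lam ->
  (d%:E * Defs.total_variation Omega lam K <=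
   \int[Defs.total_variation Omega lam]_(x in Omega) (a x)%:E)%E.
Proof.
move=> cK KO; have [->|/set0P K0] := eqVneq K set0.
  exists 1 => // lam lamO.
  by rewrite total_variation_set0// mule0 weighted_total_variation_ge0.
have [|z Kz az] := EVT_min_rV K0 cK (f := a).
  exact: continuous_subspaceW a_cont.
rewrite inE in Kz.
exists (a z); first exact/a_gt0/KO.
move=> lam lamO; have mO := open_measurable_rV Omega_open.
have mK := compact_measurable_rV cK.
pose q := total_variation_measure lamO.
rewrite -[X in (_ * X <= _)%E]/(q K) -[X in (_ <= X)%E]/(\int[q]_(x in Omega) (a x)%:E)%E.
have {1}-> : K = K `&` Omega by symmetry; apply/setIidPl.
rewrite -integral_indic// -ge0_integralZl//; last 2 first.
- by apply/measurable_EFinP; apply: measurable_funTS; exact: measurable_indic.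
- by rewrite lee_fin; exact/a_ge0/KO.
apply: ge0_le_integral => //.
- by move=> x Ox; rewrite mule_ge0// lee_fin; exact/a_ge0/KO.
- apply/measurable_EFinP; apply: measurable_funM; first exact: measurable_cst.
  by apply: measurable_funTS; exact: measurable_indic.
- exact: measurable_weight.
- move=> x Ox; rewrite -EFinM lee_fin indicE; case: (boolP (x \in K)) => xK.
    by rewrite mulr1 az.
  by rewrite mulr0 a_ge0.
Qed.

Lemma weighted_total_variation_lower_limit (W : nat -> set 'rV[R]_n) W0 lam lam0 :
  (forall k, measurable (W k)) -> measurable W0 ->
  (forall k, is_gradient_measure Omega (W k) (lam k)) ->
  is_gradient_measure Omega W0 lam0 ->
  mu (W k `+` W0) @[k --> \oo] --> 0%E ->
  le_lower_limit (\int[Defs.total_variation Omega lam0]_(x in Omega) (a x)%:E)%E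
    (fun k => \int[Defs.total_variation Omega (lam k)]_(x in Omega) (a x)%:E)%E.
Proof.
move=> mW mW0 gW gW0 cvgW c.
have [l0O _] := gW0.
move=> /(lt_integral_weight_layers Omega_open a_cont a_ge0 (q := total_variation_measure l0O))[m].
rewrite integral_weight_layers// => hc.
have oW s : open (weight_level Omega a s) by exact: open_weight_level.
have lsc j := total_variation_lower_limit Omega_open mW mW0 gW gW0 cvgW
  (oW (j.+1%:R / m.+1%:R)).
have m0 : 0 < m.+1%:R^-1 :> R by rewrite invr_gt0.
have lscm := le_lower_limitZ m0 (le_lower_limit_sum
  (fun j : 'I_(m.+1 * m.+1) => total_variation_ge0 Omega lam0 _) (fun j : 'I_(m.+1 * m.+1) => lsc j)).
have := lscm c hc; apply: filterS => k hk.
have [lkO _] := gW k.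
apply: lt_le_trans (le_integral_weight_layers Omega_open a_cont a_ge0 (total_variation_measure lkO) m).
by rewrite integral_weight_layers.
Qed.

End weighted_lower_semicontinuity.

(** * Compactness and lower semicontinuity in the class of partitions *)

Section partition_class.
Context {R : realType} {n N : nat}.
Local Notation mu := (@lebesgue_rV R n).
Implicit Types (W : 'I_N -> set 'rV[R]_n).
Variables (Omega : set 'rV[R]_n) (a : 'rV[R]_n -> R).
Hypotheses (Omega_open : open Omega) (Omega_bnd : bounded_set Omega)
  (a_cont : {within Omega, continuous a}) (a_gt0 : forall x, Omega x -> 0 < a x).

Lemma F_class_neq0 : (0 < N)%N -> exists W, F_class Omega W.
Proof.
move=> N0; pose W (i : 'I_N) := if i == Ordinal N0 then Omega else set0.
exists W; split.
  move=> i; rewrite /W; case: ifPn => _; split => //.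
  - exact: open_measurable_rV.
  - exact: locally_finite_perimeter_full.
  - exact: locally_finite_perimeter_set0.
apply: aeW => x; rewrite (bigD1 (Ordinal N0))//= /W eqxx big1 ?addr0// => i /negbTE ->.
by rewrite indic0.
Qed.

Lemma perimeter_term_ge0 W i : F_class Omega W ->
  (0 <= \int[perimeter_measure Omega (W i)]_(x in Omega) (a x)%:E)%E.
Proof.
case=> /(_ i)[_ _ /gradient_measureP[lO _]] _.
exact: weighted_total_variation_ge0.
Qed.

Lemma F_w_ge0 W : F_class Omega W -> (0 <= F_w Omega a W)%E.
Proof. by move=> FW; apply: sume_ge0 => i _; exact: perimeter_term_ge0. Qed.

Lemma perimeter_term_le W i : F_class Omega W ->
  (\int[perimeter_measure Omega (W i)]_(x in Omega) (a x)%:E <= F_w Omega a W)%E.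
Proof.
move=> FW; rewrite /F_w (bigD1 i)//= leeDl// sume_ge0// => j _.
exact: perimeter_term_ge0.
Qed.

Lemma F_w_lower_limit (W : nat -> 'I_N -> set 'rV[R]_n) W0 :
  (forall k, F_class Omega (W k)) -> F_class Omega W0 ->
  dist_w (W k) W0 @[k --> \oo] --> 0%E ->
  le_lower_limit (F_w Omega a W0) (fun k => F_w Omega a (W k)).
Proof.
move=> FW FW0 cvgW; apply: le_lower_limit_sum => i; first exact: perimeter_term_ge0.
have cvgWi : mu (W k i `+` W0 i) @[k --> \oo] --> 0%E.
  apply: (squeeze_cvge _ (cvg_cst 0%E) cvgW); apply: nearW => k.
  by rewrite measure_ge0 /dist_w (bigD1 i)//= leeDl// sume_ge0.
apply: (weighted_total_variation_lower_limit Omega_open a_cont a_gt0 _ _ _ _ cvgWi).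
- by move=> k; have [/(_ i)[]] := FW k.
- by have [/(_ i)[]] := FW0.
- by move=> k; apply: gradient_measureP; have [/(_ i)[]] := FW k.
- by apply: gradient_measureP; have [/(_ i)[]] := FW0.
Qed.

(** One subsequence serves all components because the Cauchy extraction is simultaneous. The
    partition identity passes to the limit since almost every point has its memberships eventually
    constant. *)
Lemma F_class_compact (W : nat -> 'I_N -> set 'rV[R]_n) (C : R) :
  (forall k, F_class Omega (W k)) -> (forall k, (F_w Omega a (W k) <= C%:E)%E) ->
  exists (s : nat -> nat) W0, [/\ forall j, (j <= s j)%N, F_class Omega W0 &
    dist_w (W (s j)) W0 @[j --> \oo] --> 0%E].
Proof.
move=> FW FC.
have mW k i : measurable (W k i) by have [/(_ i)[]] := FW k.
have WO k i : W k i `<=` Omega by have [/(_ i)[]] := FW k.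
have gW k i : is_gradient_measure Omega (W k i) (gradient_measure Omega (W k i)).
  by apply: gradient_measureP; have [/(_ i)[]] := FW k.
have TV_bnd i K : compact K -> K `<=` Omega -> exists C : R, forall k,
    (Defs.total_variation Omega (gradient_measure Omega (W k i)) K <= C%:E)%E.
  move=> cK KO; have [d d0 dK] := total_variation_le_weighted Omega_open a_cont a_gt0 cK KO.
  exists (d^-1 * C) => k; rewrite EFinM lee_pdivlMl//.
  have [lO _] := gW k i; have := dK _ lO; move=> /le_trans; apply.
  by apply: le_trans (FC k); exact: perimeter_term_le.
have tb i (e : R) : 0 < e -> exists (I : finType) (col : nat -> I), forall k l,
    col k = col l -> (mu (W k i `+` W l i) <= e%:E)%E.
  move=> e0; have [I [col H]] := coloring Omega_open Omega_bnd
    (fun k => mW k i) (fun k => WO k i) (fun k => gW k i) (TV_bnd i) e0.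
  by exists {ffun I -> bool}, col.
have [s [js sC]] := totally_bounded_cauchy_subsequence tb.
pose V i j := W (s j) i; pose W0 i := lim_sup_set (V i).
have mV i j : measurable (V i j) by exact: mW.
have VV i j : (mu (V i j `+` V i j.+1) <= ((2 ^ j.+1)%:R^-1)%:E)%E by exact: sC.
have mW0 i : measurable (W0 i) by apply: lim_sup_set_measurable => j; exact: mV.
have W0O i : W0 i `<=` Omega by move=> x /(_ 0%N Logic.I)[j _]; exact: WO.
have cvg2 : ((2 ^ j)%:R^-1 : R)%:E @[j --> \oo] --> 0%E.
  have h : (2 ^ j)%:R^-1 @[j --> \oo] --> (0 : R).
    rewrite (_ : (fun j => _) = fun j => (2^-1 : R) ^+ j).
      by apply: cvg_expr; rewrite ger0_norm// invf_lt1// ltr1n.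
    by apply/funext => j /=; rewrite natrX exprVn.
  by apply: cvg_EFin; [exact: nearW|exact: h].
have cvgW i : mu (V i j `+` W0 i) @[j --> \oo] --> 0%E.
  apply: (squeeze_cvge _ (cvg_cst 0%E) cvg2); apply: nearW => j.
  by rewrite measure_ge0 (lim_sup_set_dist (mV i) (VV i)).
exists s, W0; split => //.
- split.
    move=> i; split => //.
    apply: (limit_locally_finite_perimeter Omega_open (mV i) (mW0 i)
      (fun k => gW (s k) i) _ (cvgW i)).
    by move=> K cK KO; have [D HD] := TV_bnd i K cK KO; exists D => k; exact: HD.
  have ev : {ae mu, forall x, forall i, exists m, forall l, (m <= l)%N -> V i l x <-> W0 i x}.
    have AF : Filter (almost_everywhere mu) by exact: ae_filter_ringOfSetsType.
    by apply: (filter_forall AF) => i; exact: ae_eventually_lim_sup_set (mV i) (VV i).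
  have one : {ae mu, forall x, forall j : nat, \sum_i \1_(W (s j) i) x = \1_Omega x :> R}.
    by apply: ae_foralln => j; have [] := FW (s j).
  (* From the maximum of the N stabilisation indices on, every component agrees with its limit at x,
     so the identity at this one index is the identity for the limit. *)
  apply: filterS2 ev one => x /choice[m mP] /(_ (\max_i m i)%N) <-.
  apply: eq_bigr => i _; have /mP mi : (m i <= \max_i m i)%N by exact: leq_bigmax.
  rewrite !indicE -/(V i (\max_i m i)%N) (_ : (x \in V i _) = (x \in W0 i))//.
  by apply/idP/idP; rewrite !inE => /mi.
- have E0 : (\sum_(i < N) 0 = 0 :> \bar R)%E by rewrite big1.
  rewrite -E0; apply: cvg_nnesum => i _; last exact: cvgW.
  by apply: nearW => j; exact: measure_ge0.
Qed.

End partition_class.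

(** * Existence of a minimiser *)

Theorem theorem3p1 (R : realType) (n N : nat) (hn : (0 < n)%N) (hN : (0 < N)%N)
    (Omega : set 'rV[R]_n)
    (Omega_open : open Omega) (Omega_conn : connected Omega)
    (Omega_neq0 : Omega !=set0) (Omega_bnd : bounded_set Omega)
    (a : 'rV[R]_n -> R)
    (a_cont : {within Omega, continuous a})
    (a_gt0 : forall x, Omega x -> 0 < a x)
    (G : ('I_N -> set 'rV[R]_n) -> R)
    (G_bnd : exists M : R, forall W, F_class Omega W -> `|G W| <= M)
    (G_cont : forall (W : 'I_N -> set 'rV[R]_n)
                     (Wk : nat -> 'I_N -> set 'rV[R]_n),
        F_class Omega W -> (forall k, F_class Omega (Wk k)) ->
        dist_w (Wk k) W @[k --> \oo] --> 0%E ->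
        G (Wk k) @[k --> \oo] --> G W) :
  exists W0 : 'I_N -> set 'rV[R]_n,
    F_class Omega W0 /\
    forall W, F_class Omega W -> (J_w Omega a G W0 <= J_w Omega a G W)%E.
Proof.
have [M GM] := G_bnd.
pose J W := J_w Omega a G W.
pose m := ereal_inf [set J W | W in F_class Omega].
have mJ W : F_class Omega W -> (m <= J W)%E by move=> FW; apply: ereal_inf_lbound; exists W.
have [W1 FW1] := F_class_neq0 Omega_open hN.
have Mm : ((- M)%:E <= m)%E.
  apply: le_ereal_inf_tmp => _ [W FW <-]; rewrite /J /J_w -[leLHS]add0e.
  apply: leeD; first exact: F_w_ge0.
  by rewrite lee_fin; have := GM W FW; rewrite ler_norml => /andP[].
(* If the infimum is infinite, every admissible tuple is a minimiser. *)
have [moo|mlty] := eqVneq m +oo%E.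
  by exists W1; split => // W FW; have := mJ W FW; rewrite moo leye_eq => /eqP; rewrite /J => ->; exact: leey.
have mfin : m \is a fin_num.
  by rewrite fin_numE mlty andbT; apply: contraTN Mm => /eqP ->.
have /choice[W WP] k : exists W, F_class Omega W /\ (J W < m + (k.+1%:R^-1)%:E)%E.
  have k0 : 0 < k.+1%:R^-1 :> R by [].
  by have [_ [W FW <-] lt] := lb_ereal_inf_adherent k0 mfin; exists W.
have FW k : F_class Omega (W k) by have [] := WP k.
(* The error 1 / (k + 1) is at most 1 and - G is at most M, so the weighted perimeters stay bounded
   along the minimising sequence. *)
have FC k : (F_w Omega a (W k) <= (fine m + 1 + M)%:E)%E.
  have [_ /ltW] := WP k; rewrite /J /J_w -{1}(fineK mfin) -EFinD -leeBrDr//.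
  move=> /le_trans; apply; rewrite -EFinB lee_fin; apply: lerD.
    by rewrite lerD2l invf_le1// ler1n.
  by have := GM _ (FW k); rewrite ler_norml => /andP[h _]; rewrite lerNl.
have [s [W0 [js FW0 dW0]]] := F_class_compact Omega_open Omega_bnd a_cont a_gt0 FW FC.
exists W0; split => // W' FW'; apply: le_trans (mJ _ FW').
rewrite leNgt; apply/negP => mJ0.
have lsc := F_w_lower_limit Omega_open a_cont a_gt0 (fun k => FW (s k)) FW0 dW0.
have cG := G_cont _ _ FW0 (fun k => FW (s k)) dW0.
(* If [W0] were not optimal, its weighted perimeter would exceed m - G W0 by more than some d > 0.
   Half of d absorbs the variation of [G], the other half the error of the minimising sequence. *)
have [d d0 md] : exists2 d : R, 0 < d & ((fine m - G W0 + d)%:E < F_w Omega a W0)%E.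
  move: mJ0; rewrite /J_w -{1}(fineK mfin) -lteBlDr// -EFinB.
  case: (F_w Omega a W0) => [r| |//] h.
    rewrite lte_fin in h; exists ((r - (fine m - G W0)) / 2).
      by rewrite divr_gt0// subr_gt0.
    by rewrite lte_fin; lra.
  by exists 1 => //; exact: ltry.
have d20 : 0 < d / 2 by rewrite divr_gt0.
have nG : \forall k \near \oo, G W0 - d / 2 < G (W (s k)).
  by apply: (cvgr_gt _ cG); rewrite ltrBlDr ltrDl.
have nd : \forall k \near \oo, k.+1%:R^-1 < d / 2 := near_infty_natSinv_lt (PosNum d20).
have [k [[h1 h2] h3]] := filter_ex (filterI (filterI (lsc _ md) nG) nd).
have [_] := WP (s k); apply/negP; rewrite -leNgt /J /J_w -{1}(fineK mfin) -EFinD.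
apply: (@le_trans _ _ ((fine m - G W0 + d)%:E + (G (W (s k)))%:E)%E); last first.
  by apply: leeD; [exact: ltW h1|exact: lexx].
rewrite -EFinD lee_fin.
(* The extracted indices satisfy k <= s k, so the error at [s k] is at most the error at k. *)
have h4 : (s k).+1%:R^-1 <= k.+1%:R^-1 :> R.
  by rewrite lef_pV2 ?posrE// ler_nat ltnS.
move: h2 h3 h4; clear.
by move: (G W0) (G (W (s k))) (fine m) ((s k).+1%:R^-1) (k.+1%:R^-1) => *; lra.
Qed.
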